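(* Let $M,V>0$ and $(\rho_\dagger,R_\dagger)=(\rho_\dagger[M,V],R_\dagger[M,V])$. Let $\hat R:\mathbb R\to(0,\infty)$ be an arbitrary positive $C^1$ function with $\hat R(0)=R_\dagger$ and $\hat R'(0)\ne1$, and for $\alpha\in\mathbb R$ define $$\hat\rho(\alpha)=\frac1{\mathfrak{R}T_c}\left(\frac{2\sigma}{\hat R(\alpha)}+\frac{2\bar\sigma}{\sqrt[3]{\hat R(\alpha)^3+\overline V}}\right).$$ Then $\hat\rho(0)=\rho_\dagger$. Write $\mathbf x\in X$ as $\mathbf x=\alpha\mathbf U$, $\alpha\in\mathbb R$, and define the curve $\mathbf y=h(\mathbf x)=h(\alpha\mathbf U)$ by $$h(\mathbf x)=\Big[\hat\rho(\alpha)+\Big(\frac{2\sigma}{\mathfrak{R}T_cR_\dagger^2}+\frac{2\bar\sigma R_\dagger^2}{\mathfrak{R}T_c\overline R_\dagger^4}\Big)\alpha-\rho_\dagger,\ \ \hat R(\alpha)-\alpha-R_\dagger,\ 0,\ 0,\ \cdots\Big]^\top .$$ Then the curve $h$ is a global center manifold for the system $$\dot{\mathbf x}=\mathcal Q_1\mathcal N(\mathbf x+\mathbf y,\dot{\mathbf x}+\dot{\mathbf y}),\qquad \dot{\mathbf y}=\mathcal L\mathbf y+\mathcal Q_2\mathcal N(\mathbf x+\mathbf y,\dot{\mathbf x}+\dot{\mathbf y}),\qquad t>0.$$ Moreover, for $\mathbf x(t)=\alpha(t)\mathbf U$ with $|\alpha(t)|$ small enough, the equation on the center manifold $$\dot{\mathbf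 x}=\mathcal Q_1\big[\mathcal N^1(\mathbf x+h(\mathbf x))[\dot{\mathbf x}+h'(\mathbf x)\dot{\mathbf x}]\big]+\mathcal Q_1\mathcal N^0(\mathbf x+h(\mathbf x))$$ is trivial, i.e. it is equivalent to $\dot\alpha\equiv0$. Therefore the zero solution of this equation is Lyapunov stable.
   Context: Constants: $\rho_l,\mu_l,\kappa,\mathfrak{c},\mathfrak{R},T_c,\sigma,\bar\sigma>0$, $\gamma=1+\mathfrak{R}/\mathfrak{c}$. $\overline V=3V/(4\pi)$; for a radius $R$, $\overline R=(R^3+\overline V)^{1/3}$. $(\rho_\dagger,R_\dagger)$ is the unique pair of positive numbers with $\frac{4\pi}{3}\rho_\dagger R_\dagger^3=M$, $\rho_\dagger=\frac2{\mathfrak{R}T_c}(\frac\sigma{R_\dagger}+\frac{\bar\sigma}{\overline R_\dagger})$. Set $\tilde R_\dagger=R_\dagger-R_\dagger^2/\overline R_\dagger$, $\chi=\kappa/(R_\dagger^2\rho_\dagger\gamma\mathfrak{c})$, $A=\frac{2\sigma}{R_\dagger^2}+\frac{2\bar\sigma R_\dagger^2}{\overline R_\dagger^4}$, $B=\frac{4\mu_l\overline V}{R_\dagger(R_\dagger^3+\overline V)}$, $\Xi_j(y)=\frac{\sin(j\pi y)}{\sqrt{2\pi}\,y}$ (as radial functions, $y=|x|$, orthonormal radial Dirichlet eigenfunctions of $-\Delta$ on the unit ball $B_1\subset\mathbb R^3$), $\zeta_j=(j\pi)^2$, $\xi_k=\frac{(-1)^{k-1}2^{3/2}(\gamma-1)}{\sqrt\pi\,\gamma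 k}$, $\omega_j=-\frac{R_\dagger\chi}{\rho_\dagger}\sqrt{\frac\pi2}(-1)^jj$. State space $\ell^2$, with elements written $\mathbf z=[\varrho_2,\mathcal R,\dot{\mathcal R},\theta_1,\theta_2,\dots]^\top$ (here $\dot{\mathcal R}$ names the third coordinate). Linear operator $\mathcal L$ on $\ell^2$: $(\mathcal L\mathbf z)_1=\frac{3\gamma\rho_\dagger}{R_\dagger}\big(\sum_j\omega_j\theta_j-\dot{\mathcal R}\big)$, $(\mathcal L\mathbf z)_2=\dot{\mathcal R}$, $(\mathcal L\mathbf z)_3=\frac1{\rho_l\tilde R_\dagger}(\mathfrak{R}T_c\varrho_2+A\mathcal R-B\dot{\mathcal R})$, $(\mathcal L\mathbf z)_{3+k}=-\chi\zeta_k\theta_k-\xi_k\frac{3\gamma\rho_\dagger}{R_\dagger}\big(\sum_j\omega_j\theta_j-\dot{\mathcal R}\big)$. Nonlinear term. For $\mathbf z=[\varrho_2,\mathcal R,\dot{\mathcal R},\theta_1,\theta_2,\dots]^\top$ and $\mathbf w=[w_1,w_2,w_3,\dots]^\top$ put $R=R_\dagger+\mathcal R$, $\varrho_1(y)=\sum_j\theta_j\Xi_j(y)$, $\varrho=\varrho_1+\varrho_2$ and $$\Pi=\tfrac{\kappa}{\gamma\mathfrak{c}}\Big[\tfrac1{R^2(\rho_\dagger+\varrho)}-\tfrac1{R_\dagger^2\rho_\dagger}\Big]\Delta_y\varrho_1-\tfrac{\kappa}{\gamma\mathfrak{c}}\tfrac{|\nabla_y\varrho_1|^2}{R^2(\rho_\dagger+\varrho)^2}+\tfrac1\gamma\tfrac{w_1}{\rho_\dagger+\varrho_2}\big(\tfrac13y\partial_y\varrho_1+\varrho_1\big),$$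 $$\Phi=-\tfrac{\kappa}{\gamma\mathfrak{c}}\Big[\tfrac1{R(\rho_\dagger+\varrho_2)^2}-\tfrac1{R_\dagger\rho_\dagger^2}\Big]\partial_y\varrho_1(1)-\tfrac{\mathcal Rw_1}{3\gamma(\rho_\dagger+\varrho_2)}+\tfrac{R_\dagger}{3\gamma}\tfrac{\varrho_2w_1}{\rho_\dagger(\rho_\dagger+\varrho_2)},$$ $$\begin{aligned}\Psi={}&\tfrac1{\mathfrak{R}T_c}\Big[4\mu_l\overline V\Big(\tfrac1{R(R^3+\overline V)}-\tfrac1{R_\dagger(R_\dagger^3+\overline V)}\Big)\dot{\mathcal R}+\Big(\tfrac{2\sigma}{R_\dagger^2}\mathcal R+\tfrac{2\sigma}{R}-\tfrac{2\sigma}{R_\dagger}\Big)+\Big(\tfrac{2\bar\sigma R_\dagger^2}{\overline R_\dagger^4}\mathcal R+\tfrac{2\bar\sigma}{\overline R}-\tfrac{2\bar\sigma}{\overline R_\dagger}\Big)\Big]\\&+\tfrac{\rho_l}{\mathfrak{R}T_c}\Big[\Big(\mathcal R+\tfrac{R_\dagger^2}{\overline R_\dagger}-\tfrac{R^2}{\overline R}\Big)w_3+\Big(\tfrac32-\tfrac{2R}{\overline R}+\tfrac{R^4}{2\overline R^4}\Big)\dot{\mathcal R}^2\Big],\end{aligned}$$ $\Pi_k=\int_{B_1}\Pi\,\Xi_k\,dy$, and $$\mathcal N(\mathbf z,\mathbf w)=\Big[\tfrac{3\gamma\rho_\dagger}{R_\dagger}\Phi,\ 0,\ -\tfrac{\mathfrak{R}T_c}{\rho_l\tilde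 R_\dagger}\Psi,\ \Pi_1-\xi_1\tfrac{3\gamma\rho_\dagger}{R_\dagger}\Phi,\ \Pi_2-\xi_2\tfrac{3\gamma\rho_\dagger}{R_\dagger}\Phi,\ \cdots\Big]^\top .$$ $\mathcal N$ is affine in $\mathbf w$: $\mathcal N(\mathbf z,\mathbf w)=\mathcal N^1(\mathbf z)\mathbf w+\mathcal N^0(\mathbf z)$, with $\mathcal N^0(\mathbf z)=\mathcal N(\mathbf z,\mathbf 0)$ and $\mathcal N^1(\mathbf z)$ linear. Projections. $X=\ker\mathcal L=\mathrm{span}(\mathbf U)$ with $\mathbf U=[-A/(\mathfrak{R}T_c),1,0,0,\dots]^\top$; left eigenvector $\Upsilon^\top=[\frac{4\pi}3,\frac{4\pi\rho_\dagger}{R_\dagger},0,\frac{\gamma\xi_1}{\gamma-1},\frac{\gamma\xi_2}{\gamma-1},\dots]$ (so $\Upsilon^\top\mathcal L=0$), $\Upsilon_0^\top=\langle\Upsilon^\top,\mathbf U\rangle^{-1}\Upsilon^\top$; $\mathcal Q_1\mathbf z=(\Upsilon_0^\top\mathbf z)\mathbf U\in X$, $\mathcal Q_2\mathbf z=\mathbf z-\mathcal Q_1\mathbf z\in Y:=\mathcal Q_2\ell^2$; $\ell^2=X\oplus Y$. A solution $\mathbf z$ of $\dot{\mathbf z}=\mathcal L\mathbf z+\mathcal N(\mathbf z,\dot{\mathbf z})$ is decomposed as $\mathbf z=\mathbf x+\mathbf y$, $\mathbf x=\mathcal Q_1\mathbf z$, $\mathbf y=\mathcal Q_2\mathbf z$.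 An invariant manifold for the $(\mathbf x,\mathbf y)$-system is a curve $\mathbf y=h(\mathbf x)$ such that the solution $(\mathbf x(t),\mathbf y(t))$ passing through $(\mathbf x(0),h(\mathbf x(0)))$ satisfies $\mathbf y(t)=h(\mathbf x(t))$. A center manifold is an invariant manifold that is tangent to the subspace $X$ at the origin; it is called global when $h$ is defined for all $\mathbf x\in X$ rather than only for $|\mathbf x|$ small. *)

(* Defs.v *)
From Stdlib Require Import Reals.
From Coquelicot Require Import Coquelicot.
Open Scope R_scope.

(* z 0, z 1, z 2 are the coordinates rho_2, R, Rdot, and z (2 + j) is theta_j
   for j >= 1. *)
Definition state := nat -> R.

Definition vzero : state := fun _ => 0.
Definition vadd (z w : state) : state := fun n => z n + w n.
Definition vsub (z w : state) : state := fun n => z n - w n.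
Definition vscal (a : R) (z : state) : state := fun n => a * z n.

Definition l2 (z : state) : Prop := ex_series (fun n => z n ^ 2).
Definition l2norm (z : state) : R := sqrt (Series (fun n => z n ^ 2)).
Definition pairing (u z : state) : R := Series (fun n => u n * z n).

(* [Series], hence [l2norm], is a junk value outside [l2]: membership in [l2]
   is therefore always required alongside. *)
Definition is_l2_derive (f : R -> state) (t : R) (d : state) : Prop :=
  l2 d /\ locally t (fun s => l2 (f s)) /\
  is_lim (fun s => l2norm (vsub (vscal (/ (s - t)) (vsub (f s) (f t))) d)) t 0.

Definition l2_right_continuous (f : R -> state) (t : R) : Prop :=
  filterlim (fun s => l2norm (vsub (f s) (f t))) (at_right t) (locally 0).

Definition cbrt (x : R) : R := Rpower x (1 / 3).

Record params := Params {
  rho_l : R; mu_l : R; kappa : R; c_v : R; R_gas : R; T_c : R;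
  sigma : R; sigma_bar : R;
  mass : R; (* M *)
  vol : R;  (* V *)
  rho_dag : R; R_dag : R }.

Definition positive_constants (p : params) : Prop :=
  0 < rho_l p /\ 0 < mu_l p /\ 0 < kappa p /\ 0 < c_v p /\ 0 < R_gas p /\
  0 < T_c p /\ 0 < sigma p /\ 0 < sigma_bar p.

Section Bubble.

Context (p : params).

Definition gamma : R := 1 + R_gas p / c_v p.
Definition Vbar : R := 3 * vol p / (4 * PI).
Definition bar (r : R) : R := cbrt (r ^ 3 + Vbar).

Definition is_equilibrium : Prop :=
  0 < rho_dag p /\ 0 < R_dag p /\
  4 * PI / 3 * rho_dag p * R_dag p ^ 3 = mass p /\
  rho_dag p = 2 / (R_gas p * T_c p)
              * (sigma p / R_dag p + sigma_bar p / bar (R_dag p)).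

Definition R_tilde : R := R_dag p - R_dag p ^ 2 / bar (R_dag p).
Definition chi : R := kappa p / (R_dag p ^ 2 * rho_dag p * gamma * c_v p).
Definition coefA : R :=
  2 * sigma p / R_dag p ^ 2
  + 2 * sigma_bar p * R_dag p ^ 2 / bar (R_dag p) ^ 4.
Definition coefB : R :=
  4 * mu_l p * Vbar / (R_dag p * (R_dag p ^ 3 + Vbar)).
Definition zeta (j : nat) : R := (INR j * PI) ^ 2.
(* [xi] and [omega], like [Xi] below, are meant for indices >= 1. *)
Definition xi (k : nat) : R :=
  (-1) ^ (k - 1) * Rpower 2 (3 / 2) * (gamma - 1) / (sqrt PI * gamma * INR k).
Definition omega (j : nat) : R :=
  - (R_dag p * chi / rho_dag p) * sqrt (PI / 2) * (-1) ^ j * INR j.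

(* The value at the origin is the limit of sin (j PI y) / (sqrt (2 PI) y). *)
Definition Xi (j : nat) (y : R) : R :=
  if Req_EM_T y 0 then INR j * PI / sqrt (2 * PI)
  else sin (INR j * PI * y) / (sqrt (2 * PI) * y).

Definition theta (z : state) (j : nat) : R := z (2 + j)%nat.

Definition lin_row1 (z : state) : R :=
  3 * gamma * rho_dag p / R_dag p
  * (Series (fun n => omega (S n) * theta z (S n)) - z 2%nat).

Definition opL (z : state) : state := fun n =>
  match n with
  | 0%nat => lin_row1 z
  | 1%nat => z 2%nat
  | 2%nat => 1 / (rho_l p * R_tilde)
             * (R_gas p * T_c p * z 0%nat + coefA * z 1%nat - coefB * z 2%nat)
  | S (S k) => - chi * zeta k * theta z k - xi k * lin_row1 z
  end.

(* [opL] is unbounded on [l2]; this is its maximal domain. *)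
Definition dom_L (z : state) : Prop :=
  l2 z /\ ex_series (fun n => omega (S n) * theta z (S n)) /\ l2 (opL z).

(* Radial functions on the ball are functions of y = |x|. *)
Definition rho1 (z : state) (y : R) : R :=
  Series (fun n => theta z (S n) * Xi (S n) y).
Definition rho_pert (z : state) (y : R) : R := rho1 z y + z 0%nat.
Definition radius (z : state) : R := R_dag p + z 1%nat.

Definition radial_laplacian (f : R -> R) (y : R) : R :=
  Derive_n f 2 y + 2 / y * Derive f y.

(* |grad f| = |f'| for radial f. *)
Definition Pi_fun (z w : state) (y : R) : R :=
  kappa p / (gamma * c_v p)
  * (1 / (radius z ^ 2 * (rho_dag p + rho_pert z y))
     - 1 / (R_dag p ^ 2 * rho_dag p))
  * radial_laplacian (rho1 z) y
  - kappa p / (gamma * c_v p)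
    * (Derive (rho1 z) y ^ 2
       / (radius z ^ 2 * (rho_dag p + rho_pert z y) ^ 2))
  + 1 / gamma * (w 0%nat / (rho_dag p + z 0%nat))
    * (1 / 3 * y * Derive (rho1 z) y + rho1 z y).

(* The integral over the unit ball, in polar coordinates. *)
Definition Pi_coef (z w : state) (k : nat) : R :=
  RInt (fun y => Pi_fun z w y * Xi k y * (4 * PI * y ^ 2)) 0 1.

Definition Phi (z w : state) : R :=
  - (kappa p / (gamma * c_v p))
    * (1 / (radius z * (rho_dag p + z 0%nat) ^ 2)
       - 1 / (R_dag p * rho_dag p ^ 2))
    * Derive (rho1 z) 1
  - z 1%nat * w 0%nat / (3 * gamma * (rho_dag p + z 0%nat))
  + R_dag p / (3 * gamma)
    * (z 0%nat * w 0%nat / (rho_dag p * (rho_dag p + z 0%nat))).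

Definition Psi (z w : state) : R :=
  let r := radius z in
  1 / (R_gas p * T_c p)
  * (4 * mu_l p * Vbar
       * (1 / (r * (r ^ 3 + Vbar)) - 1 / (R_dag p * (R_dag p ^ 3 + Vbar)))
       * z 2%nat
     + (2 * sigma p / R_dag p ^ 2 * z 1%nat
        + 2 * sigma p / r - 2 * sigma p / R_dag p)
     + (2 * sigma_bar p * R_dag p ^ 2 / bar (R_dag p) ^ 4 * z 1%nat
        + 2 * sigma_bar p / bar r - 2 * sigma_bar p / bar (R_dag p)))
  + rho_l p / (R_gas p * T_c p)
    * ((z 1%nat + R_dag p ^ 2 / bar (R_dag p) - r ^ 2 / bar r) * w 2%nat
       + (3 / 2 - 2 * r / bar r + r ^ 4 / (2 * bar r ^ 4)) * z 2%nat ^ 2).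

Definition nonlin (z w : state) : state := fun n =>
  match n with
  | 0%nat => 3 * gamma * rho_dag p / R_dag p * Phi z w
  | 1%nat => 0
  | 2%nat => - (R_gas p * T_c p / (rho_l p * R_tilde)) * Psi z w
  | S (S k) => Pi_coef z w k
               - xi k * (3 * gamma * rho_dag p / R_dag p) * Phi z w
  end.

Definition nonlin0 (z : state) : state := nonlin z vzero.
Definition nonlin1 (z w : state) : state := vsub (nonlin z w) (nonlin z vzero).

(* x |-> f |x| is C^2 on the closed unit ball iff f is the restriction of an
   even C^2 function of the radial variable. *)
Definition C2_ball (f : R -> R) : Prop :=
  exists g : R -> R,
    (forall y, 0 <= y <= 1 -> f y = g y) /\
    (forall y, g (- y) = g y) /\
    (forall y, ex_derive g y) /\
    (forall y, ex_derive_n g 2 y) /\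
    (forall y, continuous (Derive_n g 2) y).

(* States at which [opL] and [nonlin] are classically defined. *)
Definition admissible (z : state) : Prop :=
  dom_L z /\ C2_ball (rho1 z) /\ 0 < radius z /\
  (forall y, 0 <= y <= 1 -> 0 < rho_dag p + rho_pert z y).

Definition vecU : state := fun n =>
  match n with
  | 0%nat => - coefA / (R_gas p * T_c p)
  | 1%nat => 1
  | _ => 0
  end.

Definition Upsilon : state := fun n =>
  match n with
  | 0%nat => 4 * PI / 3
  | 1%nat => 4 * PI * rho_dag p / R_dag p
  | 2%nat => 0
  | S (S k) => gamma * xi k / (gamma - 1)
  end.

Definition Upsilon0 : state := vscal (/ pairing Upsilon vecU) Upsilon.
Definition Q1 (z : state) : state := vscal (pairing Upsilon0 z) vecU.
Definition Q2 (z : state) : state := vsub z (Q1 z).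

Definition in_X (x : state) : Prop := exists a : R, x = vscal a vecU.

(* Classical solutions on [0, T), with T <= +oo.  The component y ranges over
   all of [l2], not only over the range of [Q2]: for a general [Rhat] the curve
   h defined by [hcurve] leaves the range of [Q2]. *)
Definition is_solution (T : Rbar) (x y : R -> state) : Prop :=
  (forall t, 0 <= t -> Rbar_lt t T -> in_X (x t) /\ l2 (y t)) /\
  l2_right_continuous x 0 /\ l2_right_continuous y 0 /\
  (forall t, 0 < t -> Rbar_lt t T ->
    exists x' y' : state,
      is_l2_derive x t x' /\ is_l2_derive y t y' /\
      admissible (vadd (x t) (y t)) /\
      x' = Q1 (nonlin (vadd (x t) (y t)) (vadd x' y')) /\
      y' = vadd (opL (y t))
                (Q2 (nonlin (vadd (x t) (y t)) (vadd x' y')))).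

(* Through every point of the curve there is a solution, global in time, and
   every solution starting on the curve stays on it. *)
Definition invariant_manifold (h : state -> state) : Prop :=
  (forall x0, in_X x0 ->
    exists x y, is_solution p_infty x y /\ x 0 = x0 /\ y 0 = h x0) /\
  (forall (T : Rbar) (x y : R -> state),
    Rbar_lt 0 T -> is_solution T x y -> y 0 = h (x 0) ->
    forall t, 0 <= t -> Rbar_lt t T -> y t = h (x t)).

(* Tangency is that of the curve a |-> h (a U) itself, not of the graph
   a |-> a U + h (a U). *)
Definition tangent_to_X (h : state -> state) : Prop :=
  h vzero = vzero /\
  exists v : state,
    is_l2_derive (fun a => h (vscal a vecU)) 0 v /\ in_X v /\ v <> vzero.

Definition global_center_manifold (h : state -> state) : Prop :=
  (forall x, in_X x -> l2 (h x)) /\ invariant_manifold h /\ tangent_to_X h.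

(* The reduced equation at time t; dh stands for h'(x) x'. *)
Definition manifold_equation (h : state -> state) (x : R -> state) (t : R) :
    Prop :=
  exists x' dh : state,
    is_l2_derive x t x' /\
    is_l2_derive (fun s => h (vadd (x t) (vscal s x'))) 0 dh /\
    x' = vadd (Q1 (nonlin1 (vadd (x t) (h (x t))) (vadd x' dh)))
              (Q1 (nonlin0 (vadd (x t) (h (x t))))).

Definition manifold_solution (h : state -> state) (T : Rbar) (x : R -> state) :
    Prop :=
  (forall t, 0 <= t -> Rbar_lt t T -> in_X (x t)) /\
  l2_right_continuous x 0 /\
  (forall t, 0 < t -> Rbar_lt t T -> manifold_equation h x t).

Definition zero_lyapunov_stable (h : state -> state) : Prop :=
  manifold_solution h p_infty (fun _ => vzero) /\
  forall eps, 0 < eps -> exists delta, 0 < delta /\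
    forall (T : Rbar) (x : R -> state),
      Rbar_lt 0 T -> manifold_solution h T x -> l2norm (x 0) < delta ->
      forall t, 0 <= t -> Rbar_lt t T -> l2norm (x t) < eps.

Definition rhohat (Rhat : R -> R) (a : R) : R :=
  1 / (R_gas p * T_c p)
  * (2 * sigma p / Rhat a + 2 * sigma_bar p / cbrt (Rhat a ^ 3 + Vbar)).

(* For x = a U the coordinate a is x 1, since U has second entry 1. *)
Definition hcurve (Rhat : R -> R) (x : state) : state :=
  let a := x 1%nat in
  fun n =>
  match n with
  | 0%nat =>
      rhohat Rhat a
      + (2 * sigma p / (R_gas p * T_c p * R_dag p ^ 2)
         + 2 * sigma_bar p * R_dag p ^ 2
           / (R_gas p * T_c p * bar (R_dag p) ^ 4)) * a
      - rho_dag p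
  | 1%nat => Rhat a - a - R_dag p
  | _ => 0
  end.

End Bubble.

(* Main.v *)
Require Import Defs.
From Stdlib Require Import Reals Arith Lra Lia Psatz FunctionalExtensionality Classical.
From Coquelicot Require Import Coquelicot.
Open Scope R_scope.

(** The curve [h] is chosen so that each point [x + h x] of its graph is a uniform
    state: constant gas density [rhohat a], radius [Rhat a], no motion, with the gas
    pressure in balance with the capillary pressure. Such a state is a stationary
    solution of the full system ([uniform_equilibrium]), which gives a global solution
    through every point of the curve. Adding the equations of [x] and [y] gives back the
    full system, so invariance amounts to uniqueness of classical solutions that start
    at a uniform equilibrium ([equilibrium_uniqueness]).

    This uniqueness is the substance of the proof. Write [b] for the boundary density,
    [r] for the radius, [v] for its velocity, [g] for the density profile relative to
    [b], [S] for its squared norm and [e] for the mean density. The equation contains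
    the derivative [b'], which is tied to the boundary flux and is not controlled by
    the norm of the state. Three facts make it harmless. First, transport turns the
    derivative of [S] into
    [S' <= a (b' / b) S - 2 (1 - a) b' N], where [a = 1 / gamma] and [N] is the integral
    of the profile over the ball ([temperature_energy_balance]). Secondly, the kinematic
    condition turns the flux into [v] and [b'], and the combination [e = b + N / |B|]
    obeys [e' = - 3 b v / r], free of [b'] ([mean_density_balance]). Thirdly, [N] is
    [|B| (e - b)], so after multiplication by [b ^ (- a)] all terms with [b'] are exact
    derivatives. They are collected in [free_energy], which is coercive in [b - e] by
    Bernoulli's inequality and the bound of [S] from below by Cauchy-Schwarz. Its sum
    with the squares of [v] and of the deviations of [e] and [r] from their equilibrium
    values satisfies a linear differential inequality near the equilibrium
    ([lyapunov_local_uniqueness]), so it remains zero.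

    The balance laws at a fixed time are obtained from the coefficients. Membership in
    the domain of the linear operator makes the coefficients of the profile summable,
    hence the profile is a uniformly convergent sine series divided by [y], and
    integrals against it are exchanged with the sum. For integrals against constants
    the sine series of [y] on the unit interval converges in mean square only, by the
    value [PI ^ 2 / 6] of the sum of inverse squares.

    On the curve the nonlinear term depends on the time derivative only through a
    boundary term that vanishes at the reference equilibrium. Hence the reduced
    equation is [c = m c] for the velocity [c], with [m < 1] near the origin, and forces
    [c = 0]; stability follows since small solutions do not move. *)

(** * Square-summable sequences *)

(* Equalities whose carrier is displayed as an algebraic structure on [R]. *)
Ltac real_eq := match goal with |- @eq _ ?x ?y => change (@eq R x y) end.

Definition sqsum (u : state) : R := Series (fun n => u n ^ 2).

Lemma l2norm_sq u : l2 u -> l2norm u ^ 2 = sqsum u.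
Proof.
intros Hu; unfold l2norm; fold (sqsum u).
rewrite pow2_sqrt; [reflexivity|].
unfold sqsum; rewrite <- (Rmult_0_l (Series (fun n => u n ^ 2))), <- Series_scal_l.
apply Series_le; [intros n; split; [|nra]|exact Hu].
nra.
Qed.

Lemma l2norm_nonneg u : 0 <= l2norm u.
Proof. apply sqrt_pos. Qed.

Lemma sqsum_nonneg u : l2 u -> 0 <= sqsum u.
Proof. intros Hu; rewrite <- l2norm_sq; auto; apply pow2_ge_0. Qed.

Lemma ex_series_mult_l2 u v :
  l2 u -> l2 v -> ex_series (fun n => u n * v n).
Proof.
intros Hu Hv.
apply (ex_series_le (K := R_AbsRing) (V := R_CompleteNormedModule))
  with (b := fun n => u n ^ 2 + v n ^ 2).
- intros n; change (Rabs (u n * v n) <= u n ^ 2 + v n ^ 2).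
  apply Rabs_le; split; nra.
- apply (ex_series_plus (K := R_AbsRing) (V := R_NormedModule)); assumption.
Qed.

Lemma l2_scal a u : l2 u -> l2 (vscal a u).
Proof.
intros Hu; apply ex_series_ext with (fun n => a ^ 2 * u n ^ 2).
- intros n; unfold vscal; real_eq; ring.
- apply (ex_series_scal_l (K := R_AbsRing) (a ^ 2) (fun n => u n ^ 2)); exact Hu.
Qed.

Lemma l2_add u v : l2 u -> l2 v -> l2 (vadd u v).
Proof.
intros Hu Hv.
apply ex_series_ext with (fun n => (u n ^ 2 + v n ^ 2) + 2 * (u n * v n)).
- intros n; unfold vadd; real_eq; ring.
- apply (ex_series_plus (K := R_AbsRing) (V := R_NormedModule)).
  + apply (ex_series_plus (K := R_AbsRing) (V := R_NormedModule)); assumption.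
  + apply (ex_series_scal_l (K := R_AbsRing) 2 (fun n => u n * v n)).
    now apply ex_series_mult_l2.
Qed.

Lemma vsub_eq u v : vsub u v = vadd u (vscal (-1) v).
Proof. apply functional_extensionality; intros n; unfold vsub, vadd, vscal; ring. Qed.

Lemma l2_sub u v : l2 u -> l2 v -> l2 (vsub u v).
Proof. intros; rewrite vsub_eq; apply l2_add; auto; now apply l2_scal. Qed.

Lemma is_series_zero (f : nat -> R) : (forall n, f n = 0) -> is_series f 0.
Proof.
intros Hf; apply is_series_ext with (fun _ => 0); [intros; symmetry; apply Hf|].
unfold is_series; apply filterlim_ext with (fun _ => 0).
- intros n; rewrite sum_n_const; real_eq; ring.
- apply filterlim_const.
Qed.

Lemma is_series_two (f : nat -> R) :
  (forall n, (2 <= n)%nat -> f n = 0) -> is_series f (f 0%nat + f 1%nat).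
Proof.
intros Hf.
apply (is_series_decr_1 (K := R_AbsRing) (V := R_NormedModule)).
apply (is_series_decr_1 (K := R_AbsRing) (V := R_NormedModule)).
match goal with |- is_series _ ?l => cut (l = 0 :> R) end.
- intros ->; apply is_series_zero; intros n; apply Hf; lia.
- change ((f 0%nat + f 1%nat) + - f 0%nat + - f 1%nat = 0); ring.
Qed.

Lemma l2_two u : (forall n, (2 <= n)%nat -> u n = 0) -> l2 u.
Proof.
intros Hu; eexists; apply is_series_two.
intros n Hn; rewrite (Hu n Hn); ring.
Qed.

Lemma l2norm_two u : (forall n, (2 <= n)%nat -> u n = 0) ->
  l2norm u = sqrt (u 0%nat ^ 2 + u 1%nat ^ 2).
Proof.
intros Hu; unfold l2norm; f_equal.
apply is_series_unique, (is_series_two (fun n => u n ^ 2)).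
intros n Hn; rewrite (Hu n Hn); ring.
Qed.

Lemma pairing_add e u v : l2 e -> l2 u -> l2 v ->
  pairing e (vadd u v) = pairing e u + pairing e v.
Proof.
intros; unfold pairing, vadd.
rewrite <- Series_plus; try now apply ex_series_mult_l2.
apply Series_ext; intros; ring.
Qed.

Lemma pairing_scal e a u : pairing e (vscal a u) = a * pairing e u.
Proof.
unfold pairing, vscal; rewrite <- Series_scal_l.
apply Series_ext; intros; ring.
Qed.

Lemma pairing_sub e u v : l2 e -> l2 u -> l2 v ->
  pairing e (vsub u v) = pairing e u - pairing e v.
Proof.
intros; rewrite vsub_eq, pairing_add, pairing_scal; auto; [ring|now apply l2_scal].
Qed.

Lemma pairing_comm u v : pairing u v = pairing v u.
Proof. apply Series_ext; intros; ring. Qed.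

Lemma pairing_self u : pairing u u = sqsum u.
Proof. apply Series_ext; intros; ring. Qed.

(** The case [B = 0] is included, so that the Cauchy-Schwarz inequality needs no
    case distinction on the second vector. *)
Lemma quadratic_nonneg_discriminant A B p :
  (forall l, 0 <= A + 2 * l * p + l ^ 2 * B) -> p ^ 2 <= A * B.
Proof.
intros H.
destruct (Req_dec B 0) as [->|HB].
- destruct (Req_dec p 0) as [->|Hp]; [lra|].
  specialize (H (- (A + 1) / (2 * p))).
  replace (A + 2 * (- (A + 1) / (2 * p)) * p + _) with (-1) in H by (field; auto).
  lra.
- pose proof (H 0) as H0.
  pose proof (H (- p / B)) as Hl.
  replace (A + 2 * (- p / B) * p + (- p / B) ^ 2 * B)
    with ((A * B - p ^ 2) / B) in Hl by (field; auto).
  assert (0 < B).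
  { destruct (Rtotal_order 0 B) as [|[|Hneg]]; [assumption|congruence|].
    exfalso.
    assert (Hl1 : forall l, 0 <= A + l ^ 2 * B).
    { intros l; pose proof (H l); pose proof (H (- l)); nra. }
    pose proof (Hl1 ((A + 1) / B - 1)) as H3.
    replace (A + ((A + 1) / B - 1) ^ 2 * B)
      with (- A - 2 + B + (A + 1) ^ 2 / B) in H3 by (field; auto).
    assert ((A + 1) ^ 2 / B < 0).
    { unfold Rdiv; assert (/ B < 0) by now apply Rinv_lt_0_compat. nra. }
    lra. }
  assert (Hm : 0 <= (A * B - p ^ 2) / B * B) by (apply Rmult_le_pos; lra).
  replace ((A * B - p ^ 2) / B * B) with (A * B - p ^ 2) in Hm by (field; auto).
  lra.
Qed.

Lemma sqsum_add u v : l2 u -> l2 v ->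
  sqsum (vadd u v) = sqsum u + 2 * pairing u v + sqsum v.
Proof.
intros Hu Hv.
assert (Huv := l2_add u v Hu Hv).
rewrite <- !pairing_self, (pairing_add (vadd u v)), (pairing_comm _ u),
  (pairing_comm _ v), !pairing_add, (pairing_comm v u); auto; ring.
Qed.

Lemma sqsum_scal a u : sqsum (vscal a u) = a ^ 2 * sqsum u.
Proof.
rewrite <- !pairing_self, pairing_scal, (pairing_comm _ u), pairing_scal; ring.
Qed.

Lemma cauchy_schwarz u v : l2 u -> l2 v -> pairing u v ^ 2 <= sqsum u * sqsum v.
Proof.
intros Hu Hv; apply quadratic_nonneg_discriminant; intros l.
pose proof (sqsum_nonneg (vadd u (vscal l v))
  (l2_add _ _ Hu (l2_scal l v Hv))) as H.
rewrite sqsum_add, pairing_scal, sqsum_scal in H; auto; [|now apply l2_scal].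
lra.
Qed.

Lemma cauchy_schwarz_norm u v :
  l2 u -> l2 v -> Rabs (pairing u v) <= l2norm u * l2norm v.
Proof.
intros Hu Hv; apply Rsqr_incr_0_var.
- rewrite <- Rsqr_abs, !Rsqr_pow2, Rpow_mult_distr, !l2norm_sq; auto.
  now apply cauchy_schwarz.
- apply Rmult_le_pos; apply l2norm_nonneg.
Qed.

Lemma l2norm_triangle u v :
  l2 u -> l2 v -> l2norm (vadd u v) <= l2norm u + l2norm v.
Proof.
intros Hu Hv; apply Rsqr_incr_0_var.
- rewrite !Rsqr_pow2, l2norm_sq, sqsum_add by (auto using l2_add).
  rewrite <- (l2norm_sq u), <- (l2norm_sq v) by auto.
  pose proof (cauchy_schwarz_norm u v Hu Hv).
  pose proof (Rle_abs (pairing u v)); nra.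
- pose proof (l2norm_nonneg u); pose proof (l2norm_nonneg v); lra.
Qed.

Lemma sqsum_entry u n : l2 u -> u n ^ 2 <= sqsum u.
Proof.
intros Hu.
apply Rle_trans with (sum_n (fun k => u k ^ 2) n).
- destruct n; [rewrite sum_O; lra|rewrite sum_Sn].
  unfold plus; simpl.
  enough (0 <= sum_n (fun k => u k ^ 2) n) by (simpl in *; lra).
  induction n; [rewrite sum_O|rewrite sum_Sn; unfold plus; simpl in *].
  + apply pow2_ge_0.
  + pose proof (pow2_ge_0 (u (S n))); simpl in *; lra.
- apply (is_lim_seq_incr_compare (sum_n (fun k => u k ^ 2))).
  + apply (Series_correct _ Hu).
  + intros k; rewrite sum_Sn; unfold plus; simpl.
    pose proof (pow2_ge_0 (u (S k))); simpl in *; lra.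
Qed.

Lemma l2norm_entry u n : l2 u -> Rabs (u n) <= l2norm u.
Proof.
intros Hu; apply Rsqr_incr_0_var; [|apply l2norm_nonneg].
rewrite <- Rsqr_abs, !Rsqr_pow2, l2norm_sq; auto; now apply sqsum_entry.
Qed.

Definition shift (k : nat) (u : state) : state := fun n => u (k + n)%nat.

Lemma l2_shift_iff k u : l2 u <-> l2 (shift k u).
Proof. exact (ex_series_incr_n (fun n => u n ^ 2) k). Qed.

Lemma l2_shift k u : l2 u -> l2 (shift k u).
Proof. apply l2_shift_iff. Qed.

Lemma sqsum_shift u : l2 u ->
  sqsum u = u 0%nat ^ 2 + u 1%nat ^ 2 + u 2%nat ^ 2 + sqsum (shift 3 u).
Proof.
intros Hu; unfold sqsum at 1; rewrite (Series_incr_n _ 3) by (auto; lia).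
simpl; unfold sqsum, shift; simpl; ring.
Qed.

Lemma l2norm_shift u : l2 u -> l2norm (shift 3 u) <= l2norm u.
Proof.
intros Hu; apply Rsqr_incr_0_var; [|apply l2norm_nonneg].
rewrite !Rsqr_pow2, !l2norm_sq, (sqsum_shift u) by (auto; now apply l2_shift).
pose proof (pow2_ge_0 (u 0%nat)); pose proof (pow2_ge_0 (u 1%nat));
pose proof (pow2_ge_0 (u 2%nat)); lra.
Qed.

(** * Differentiable curves in the sequence space *)

Lemma is_l2_derive_eps f t d : is_l2_derive f t d ->
  forall eps, 0 < eps -> exists delta, 0 < delta /\
    forall h, h <> 0 -> Rabs h < delta ->
      l2 (f (t + h)) /\
      l2norm (vsub (vscal (/ h) (vsub (f (t + h)) (f t))) d) < eps.
Proof.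
intros (Hd & Hloc & Hlim) eps Heps.
destruct Hloc as [d1 H1].
assert (Hb : locally 0 (fun y : R => Rabs y < eps)).
{ exists (mkposreal eps Heps); intros y Hy.
  change (Rabs (y - 0) < eps) in Hy; now rewrite Rminus_0_r in Hy. }
destruct (Hlim _ Hb) as [d2 H2].
exists (Rmin d1 d2); split; [apply Rmin_pos; apply cond_pos|].
intros h Hh Hhd.
assert (Hh1 : Rabs h < d1) by exact (Rlt_le_trans _ _ _ Hhd (Rmin_l _ _)).
assert (Hh2 : Rabs h < d2) by exact (Rlt_le_trans _ _ _ Hhd (Rmin_r _ _)).
assert (B : forall e : posreal, Rabs h < e -> ball t e (t + h)).
{ intros e He; change (Rabs (t + h - t) < e).
  replace (t + h - t) with h by ring; exact He. }
split; [apply H1, B, Hh1|].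
specialize (H2 (t + h) (B _ Hh2)).
replace (t + h - t) with h in H2 by ring.
eapply Rle_lt_trans; [apply Rle_abs|apply H2; lra].
Qed.

Lemma is_l2_derive_of_eps f t d : l2 d -> locally t (fun s => l2 (f s)) ->
  (forall eps, 0 < eps -> exists delta, 0 < delta /\
    forall h, h <> 0 -> Rabs h < delta ->
      l2norm (vsub (vscal (/ h) (vsub (f (t + h)) (f t))) d) < eps) ->
  is_l2_derive f t d.
Proof.
intros Hd Hl H; split; [exact Hd|split; [exact Hl|]].
intros P [e He].
destruct (H e (cond_pos e)) as (delta & Hdelta & Hh).
exists (mkposreal delta Hdelta); intros s Hs Hne.
change (Rabs (s - t) < delta) in Hs.
apply He; change (Rabs (l2norm (vsub (vscal (/ (s - t)) (vsub (f s) (f t))) d) - 0) < e).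
rewrite Rminus_0_r, Rabs_pos_eq by apply l2norm_nonneg.
replace s with (t + (s - t)) at 2 by ring.
apply Hh; lra.
Qed.

Lemma is_l2_derive_l2 f t d : is_l2_derive f t d -> l2 (f t).
Proof. intros (_ & H & _); exact (locally_singleton _ _ H). Qed.

Lemma is_derive_of_eps (f : R -> R) t d :
  (forall eps, 0 < eps -> exists delta, 0 < delta /\
    forall h, h <> 0 -> Rabs h < delta -> Rabs ((f (t + h) - f t) / h - d) < eps) ->
  is_derive f t d.
Proof.
intros H; apply is_derive_Reals; intros eps Heps.
destruct (H eps Heps) as (delta & Hd & Hh).
exists (mkposreal delta Hd); intros h Hh0 Hhd; now apply Hh.
Qed.

Lemma l2_quotient f t d h : l2 d -> l2 (f t) -> l2 (f (t + h)) ->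
  l2 (vsub (vscal (/ h) (vsub (f (t + h)) (f t))) d).
Proof. intros; apply l2_sub; auto; apply l2_scal, l2_sub; auto. Qed.

Lemma is_derive_pairing e f t d : l2 e -> is_l2_derive f t d ->
  is_derive (fun s => pairing e (f s)) t (pairing e d).
Proof.
intros He Hf; apply is_derive_of_eps; intros eps Heps.
pose proof (l2norm_nonneg e) as Hn.
destruct (is_l2_derive_eps f t d Hf (eps / (l2norm e + 1)))
  as (delta & Hdelta & Hh).
{ apply Rdiv_lt_0_compat; lra. }
exists delta; split; [exact Hdelta|]; intros h Hh0 Hhd.
destruct (Hh h Hh0 Hhd) as [Hl Hq].
assert (Ht := is_l2_derive_l2 _ _ _ Hf); assert (Hd := proj1 Hf).
replace ((pairing e (f (t + h)) - pairing e (f t)) / h - pairing e d)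
  with (pairing e (vsub (vscal (/ h) (vsub (f (t + h)) (f t))) d)).
- eapply Rle_lt_trans; [apply cauchy_schwarz_norm; auto using l2_quotient|].
  apply Rle_lt_trans with (l2norm e * (eps / (l2norm e + 1))).
  + apply Rmult_le_compat_l; lra.
  + apply Rmult_lt_reg_r with (l2norm e + 1); [lra|].
    replace (l2norm e * (eps / (l2norm e + 1)) * (l2norm e + 1))
      with (l2norm e * eps) by (field; lra).
    nra.
- rewrite pairing_sub, pairing_scal, pairing_sub; auto;
    [now field|apply l2_scal; now apply l2_sub].
Qed.

Lemma is_derive_entry f t d n : is_l2_derive f t d ->
  is_derive (fun s => f s n) t (d n).
Proof.
intros Hf; apply is_derive_of_eps; intros eps Heps.
destruct (is_l2_derive_eps f t d Hf eps Heps) as (delta & Hdelta & Hh).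
exists delta; split; [exact Hdelta|]; intros h Hh0 Hhd.
destruct (Hh h Hh0 Hhd) as [Hl Hq].
eapply Rle_lt_trans; [|exact Hq].
replace ((f (t + h) n - f t n) / h - d n)
  with (vsub (vscal (/ h) (vsub (f (t + h)) (f t))) d n)
  by (unfold vsub, vscal; now field).
apply l2norm_entry, l2_quotient; auto;
  [exact (proj1 Hf)|exact (is_l2_derive_l2 _ _ _ Hf)].
Qed.

Lemma is_derive_sqsum f t d : is_l2_derive f t d ->
  is_derive (fun s => sqsum (f s)) t (2 * pairing (f t) d).
Proof.
intros Hf.
assert (Ht := is_l2_derive_l2 _ _ _ Hf); assert (Hd := proj1 Hf).
(* |f s|^2 = |f t|^2 + 2 <f t, f s - f t> + |f s - f t|^2, and the last term
   is at most (s - t)^2 (1 + |d|)^2 near t. *)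
pose proof (is_derive_pairing (f t) f t d Ht Hf) as Hp.
apply is_derive_Reals in Hp.
apply is_derive_of_eps; intros eps Heps.
destruct (Hp (eps / 4)) as [d1 H1]; [lra|].
destruct (is_l2_derive_eps f t d Hf 1 Rlt_0_1) as (d2 & Hd2 & H2).
pose proof (l2norm_nonneg d) as Hn.
set (K := (1 + l2norm d) ^ 2) in *.
assert (HK : 0 < K) by (unfold K; nra).
exists (Rmin (Rmin d1 d2) (eps / (4 * K))); split.
{ repeat apply Rmin_pos; try apply cond_pos; try lra.
  apply Rdiv_lt_0_compat; lra. }
intros h Hh0 Hh.
assert (Hh1 : Rabs h < d1).
{ eapply Rlt_le_trans; [exact Hh|]; eapply Rle_trans; apply Rmin_l. }
assert (Hh2 : Rabs h < d2).
{ eapply Rlt_le_trans; [exact Hh|].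
  eapply Rle_trans; [apply Rmin_l|apply Rmin_r]. }
assert (Hh3 : Rabs h < eps / (4 * K)).
{ eapply Rlt_le_trans; [exact Hh|apply Rmin_r]. }
destruct (H2 h Hh0 Hh2) as [Hl Hq].
specialize (H1 h Hh0 Hh1).
set (q := vscal (/ h) (vsub (f (t + h)) (f t))) in *.
assert (Hq2 : l2 q) by (apply l2_scal; now apply l2_sub).
assert (Eq : f (t + h) = vadd (f t) (vscal h q)).
{ apply functional_extensionality; intros n; unfold q, vadd, vscal, vsub; field; auto. }
assert (Hnq : l2norm q <= 1 + l2norm d).
{ replace q with (vadd (vsub q d) d).
  - eapply Rle_trans; [apply l2norm_triangle; auto; now apply l2_sub|lra].
  - apply functional_extensionality; intros n; unfold vadd, vsub; ring. }
assert (HqK : sqsum q <= K).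
{ rewrite <- l2norm_sq by auto; unfold K; apply pow_incr; split;
    [apply l2norm_nonneg|exact Hnq]. }
assert (Hq0 := sqsum_nonneg q Hq2).
rewrite Eq in H1 |- *.
rewrite pairing_add, pairing_scal, pairing_self in H1; auto; [|now apply l2_scal].
rewrite sqsum_add, pairing_scal, sqsum_scal; auto; [|now apply l2_scal].
replace ((sqsum (f t) + h * pairing (f t) q - sqsum (f t)) / h - pairing (f t) d)
  with (pairing (f t) q - pairing (f t) d) in H1 by (field; auto).
replace ((sqsum (f t) + 2 * (h * pairing (f t) q) + h ^ 2 * sqsum q - sqsum (f t)) / h
  - 2 * pairing (f t) d)
  with (2 * (pairing (f t) q - pairing (f t) d) + h * sqsum q) by (field; auto).
eapply Rle_lt_trans; [apply Rabs_triang|].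
rewrite !Rabs_mult, (Rabs_pos_eq 2), (Rabs_pos_eq (sqsum q)) by lra.
assert (Rabs h * sqsum q <= eps / 4).
{ apply Rle_trans with (eps / (4 * K) * K).
  - apply Rmult_le_compat; try lra; apply Rabs_pos.
  - right; field; lra. }
lra.
Qed.

Lemma is_l2_derive_add f g t d e : is_l2_derive f t d -> is_l2_derive g t e ->
  is_l2_derive (fun s => vadd (f s) (g s)) t (vadd d e).
Proof.
intros Hf Hg.
apply is_l2_derive_of_eps.
- apply l2_add; [apply Hf|apply Hg].
- generalize (filter_and _ _ (proj1 (proj2 Hf)) (proj1 (proj2 Hg))).
  apply filter_imp; intros s [? ?]; now apply l2_add.
- intros eps Heps.
  destruct (is_l2_derive_eps f t d Hf (eps / 2)) as (d1 & Hd1 & H1); [lra|].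
  destruct (is_l2_derive_eps g t e Hg (eps / 2)) as (d2 & Hd2 & H2); [lra|].
  exists (Rmin d1 d2); split; [now apply Rmin_pos|]; intros h Hh0 Hh.
  destruct (H1 h Hh0) as [L1 N1]; [exact (Rlt_le_trans _ _ _ Hh (Rmin_l _ _))|].
  destruct (H2 h Hh0) as [L2 N2]; [exact (Rlt_le_trans _ _ _ Hh (Rmin_r _ _))|].
  replace (vsub _ (vadd d e)) with
    (vadd (vsub (vscal (/ h) (vsub (f (t + h)) (f t))) d)
          (vsub (vscal (/ h) (vsub (g (t + h)) (g t))) e)).
  + eapply Rle_lt_trans; [apply l2norm_triangle|lra];
      apply l2_quotient; auto; try apply Hf; try apply Hg;
      eapply is_l2_derive_l2; eauto.
  + apply functional_extensionality; intros n; unfold vadd, vsub, vscal; ring.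
Qed.

Lemma is_l2_derive_shift f t d :
  is_l2_derive f t d -> is_l2_derive (fun s => shift 3 (f s)) t (shift 3 d).
Proof.
intros Hf; apply is_l2_derive_of_eps.
- apply l2_shift, Hf.
- generalize (proj1 (proj2 Hf)); apply filter_imp; intros s; apply l2_shift.
- intros eps Heps.
  destruct (is_l2_derive_eps f t d Hf eps Heps) as (delta & Hdelta & Hh).
  exists delta; split; [exact Hdelta|]; intros h Hh0 Hhd.
  destruct (Hh h Hh0 Hhd) as [Hl Hq].
  eapply Rle_lt_trans; [|exact Hq].
  apply (l2norm_shift (vsub (vscal (/ h) (vsub (f (t + h)) (f t))) d)).
  apply l2_quotient; auto; [exact (proj1 Hf)|exact (is_l2_derive_l2 _ _ _ Hf)].
Qed.

Lemma is_l2_derive_two f t d :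
  (forall s n, (2 <= n)%nat -> f s n = 0) -> (forall n, (2 <= n)%nat -> d n = 0) ->
  is_derive (fun s => f s 0%nat) t (d 0%nat) ->
  is_derive (fun s => f s 1%nat) t (d 1%nat) ->
  is_l2_derive f t d.
Proof.
intros Hf Hd D0 D1.
apply is_derive_Reals in D0; apply is_derive_Reals in D1.
apply is_l2_derive_of_eps.
- now apply l2_two.
- exists (mkposreal 1 Rlt_0_1); intros; apply l2_two, Hf.
- intros eps Heps.
  destruct (D0 (eps / 2)) as [d0 H0]; [lra|].
  destruct (D1 (eps / 2)) as [d1 H1]; [lra|].
  exists (Rmin d0 d1); split; [apply Rmin_pos; apply cond_pos|]; intros h Hh0 Hh.
  specialize (H0 h Hh0 (Rlt_le_trans _ _ _ Hh (Rmin_l _ _))).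
  specialize (H1 h Hh0 (Rlt_le_trans _ _ _ Hh (Rmin_r _ _))).
  rewrite l2norm_two.
  2:{ intros n Hn; unfold vsub, vscal; rewrite !Hf, Hd by auto; ring. }
  unfold vsub, vscal.
  rewrite (Rmult_comm (/ h)), (Rmult_comm (/ h)).
  fold ((f (t + h) 0%nat - f t 0%nat) / h); fold ((f (t + h) 1%nat - f t 1%nat) / h).
  apply Rabs_def2 in H0; apply Rabs_def2 in H1.
  rewrite <- (sqrt_pow2 eps) by lra.
  set (p := _ / h - d 0%nat) in *; set (q := _ / h - d 1%nat) in *.
  apply sqrt_lt_1_alt; split; nra.
Qed.

Lemma is_l2_derive_const u t : (forall n, (2 <= n)%nat -> u n = 0) ->
  is_l2_derive (fun _ => u) t vzero.
Proof.
intros Hu; apply is_l2_derive_two; auto;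
  apply (is_derive_const (K := R_AbsRing) (V := R_NormedModule)).
Qed.

(** One-sided, in order to treat alike the initial
    time, where a solution is only continuous, and later times, where it is
    differentiable. *)
Definition right_lim (f : R -> R) (t l : R) : Prop :=
  filterlim f (at_right t) (locally l).

Lemma right_lim_eps (f : R -> R) t l : right_lim f t l <->
  (forall eps, 0 < eps -> exists delta, 0 < delta /\
     forall s, t < s < t + delta -> Rabs (f s - l) < eps).
Proof.
split.
- intros H eps Heps.
  assert (Hb : locally l (fun y => Rabs (y - l) < eps)).
  { exists (mkposreal eps Heps); intros y Hy; exact Hy. }
  destruct (H _ Hb) as [d Hd].
  exists d; split; [apply cond_pos|]; intros s Hs; apply Hd; [|lra].
  change (Rabs (s - t) < d); apply Rabs_def1; lra.
- intros H P [e He].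
  destruct (H e (cond_pos e)) as (d & Hd & Hs).
  exists (mkposreal d Hd); intros s Hb Hts; apply He, Hs.
  change (Rabs (s - t) < d) in Hb; apply Rabs_def2 in Hb; lra.
Qed.

Lemma right_lim_pairing e f t l :
  l2 e -> l2 l -> (exists d, 0 < d /\ forall s, t < s < t + d -> l2 (f s)) ->
  right_lim (fun s => l2norm (vsub (f s) l)) t 0 ->
  right_lim (fun s => pairing e (f s)) t (pairing e l).
Proof.
intros He Hl (d0 & Hd0 & Hloc) H; rewrite right_lim_eps in *.
intros eps Heps; pose proof (l2norm_nonneg e) as Hn.
destruct (H (eps / (l2norm e + 1))) as (d & Hd & Hs).
{ apply Rdiv_lt_0_compat; lra. }
exists (Rmin d0 d); split; [now apply Rmin_pos|]; intros s Hts.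
pose proof (Rmin_l d0 d); pose proof (Rmin_r d0 d).
assert (Hfs : l2 (f s)) by (apply Hloc; lra).
specialize (Hs s); rewrite Rminus_0_r, Rabs_pos_eq in Hs by apply l2norm_nonneg.
rewrite <- pairing_sub by auto.
eapply Rle_lt_trans; [apply cauchy_schwarz_norm; auto; now apply l2_sub|].
apply Rle_lt_trans with (l2norm e * (eps / (l2norm e + 1))).
- apply Rmult_le_compat_l; [lra|apply Rlt_le, Hs; lra].
- apply Rmult_lt_reg_r with (l2norm e + 1); [lra|].
  replace (l2norm e * (eps / (l2norm e + 1)) * (l2norm e + 1))
    with (l2norm e * eps) by (field; lra).
  nra.
Qed.

Lemma right_lim_entry f t l n :
  l2 l -> (exists d, 0 < d /\ forall s, t < s < t + d -> l2 (f s)) ->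
  right_lim (fun s => l2norm (vsub (f s) l)) t 0 ->
  right_lim (fun s => f s n) t (l n).
Proof.
intros Hl (d0 & Hd0 & Hloc) H; rewrite right_lim_eps in *.
intros eps Heps; destruct (H eps Heps) as (d & Hd & Hs).
exists (Rmin d0 d); split; [now apply Rmin_pos|]; intros s Hts.
pose proof (Rmin_l d0 d); pose proof (Rmin_r d0 d).
specialize (Hs s); rewrite Rminus_0_r, Rabs_pos_eq in Hs by apply l2norm_nonneg.
eapply Rle_lt_trans; [apply (l2norm_entry (vsub (f s) l))|apply Hs; lra].
apply l2_sub; auto; apply Hloc; lra.
Qed.

(** * The value of the sum of inverse squares *)

Lemma is_RInt_primitive (F f : R -> R) a b v : a <= b ->
  (forall x, a <= x <= b -> is_derive F x (f x)) ->
  (forall x, a <= x <= b -> continuous f x) -> F b - F a = v ->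
  is_RInt f a b v.
Proof.
intros Hab HF Hf <-.
apply (is_RInt_derive F f a b); rewrite Rmin_left, Rmax_right; auto.
Qed.

Ltac continuous_by_derive :=
  apply (ex_derive_continuous (K := R_AbsRing) (V := R_NormedModule)); auto_derive.

Lemma continuous_of_derive (f : R -> R) x l : is_derive f x l -> continuous f x.
Proof. intros H; apply (ex_derive_continuous f); eexists; eauto. Qed.

(** The two families of integrals below carry an elementary proof of Euler's value
    of the sum: integrating by parts links them by recurrences from which the sum
    telescopes. *)
Definition cos_int (n : nat) : R := RInt (fun x => cos x ^ (2 * n)) 0 (PI / 2).
Definition sq_cos_int (n : nat) : R :=
  RInt (fun x => x ^ 2 * cos x ^ (2 * n)) 0 (PI / 2).

Lemma PI2_pos : 0 < PI / 2.
Proof. pose proof PI_RGT_0; lra. Qed.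

Lemma ex_RInt_derivable (f : R -> R) a b : (forall x, ex_derive f x) -> ex_RInt f a b.
Proof.
intros H; apply (ex_RInt_continuous (V := R_CompleteNormedModule)).
intros x _; apply (ex_derive_continuous f), H.
Qed.

Lemma cos_int_correct n :
  is_RInt (fun x => cos x ^ (2 * n)) 0 (PI / 2) (cos_int n).
Proof.
apply (RInt_correct (V := R_CompleteNormedModule)), ex_RInt_derivable.
intros x; auto_derive; auto.
Qed.

Lemma sq_cos_int_correct n :
  is_RInt (fun x => x ^ 2 * cos x ^ (2 * n)) 0 (PI / 2) (sq_cos_int n).
Proof.
apply (RInt_correct (V := R_CompleteNormedModule)), ex_RInt_derivable.
intros x; auto_derive; auto.
Qed.

Lemma is_RInt_lincomb2 (f g : R -> R) a b p q u v :
  is_RInt f a b p -> is_RInt g a b q ->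
  is_RInt (fun x => u * f x + v * g x) a b (u * p + v * q).
Proof.
intros Hf Hg.
apply (is_RInt_plus (V := R_NormedModule));
  now apply (is_RInt_scal (V := R_NormedModule)).
Qed.

Lemma is_RInt_unique_eq (f : R -> R) a b p q :
  is_RInt f a b p -> is_RInt f a b q -> p = q.
Proof.
intros Hp Hq; rewrite <- (is_RInt_unique (V := R_CompleteNormedModule) _ _ _ _ Hp).
now apply is_RInt_unique.
Qed.

Lemma sin2_cos x : sin x * sin x = 1 - cos x * cos x.
Proof. pose proof (sin2_cos2 x) as H; unfold Rsqr in H; lra. Qed.

Lemma INR_double n : INR (2 * n) = 2 * INR n.
Proof. rewrite mult_INR; simpl; ring. Qed.

(** Integral of the derivative of [sin x * cos x ^ (2 n + 1)]. *)
Lemma cos_int_succ n :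
  2 * INR (S n) * cos_int (S n) = (2 * INR n + 1) * cos_int n.
Proof.
pose proof (is_RInt_lincomb2 _ _ _ _ _ _ (2 * INR (S n)) (- (2 * INR n + 1))
  (cos_int_correct (S n)) (cos_int_correct n)) as H.
apply (is_RInt_unique_eq _ _ _ _ 0) in H; [lra|].
apply is_RInt_primitive with (fun x => sin x * cos x ^ (2 * n + 1)).
- apply Rlt_le, PI2_pos.
- intros x _; auto_derive; auto.
  replace (n + (n + 0) + 1)%nat with (S (2 * n)) by lia.
  replace (2 * S n)%nat with (S (S (2 * n))) by lia.
  rewrite Nat.pred_succ, (S_INR (2 * n)), INR_double, S_INR, <- !tech_pow_Rmult.
  pose proof (sin2_cos x) as E.
  set (c := cos x ^ (2 * n)); set (k := INR n).
  match goal with |- ?l = _ =>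
    replace l with (cos x * cos x * c - (2 * k + 1) * (sin x * sin x) * c) by ring
  end.
  rewrite E; ring.
- intros x _; continuous_by_derive; auto.
- rewrite cos_PI2, sin_0, pow_i by lia; ring.
Qed.

(** Integral of the derivative of
    [x * cos x ^ (2 n + 2) + (n + 1) * x ^ 2 * sin x * cos x ^ (2 n + 1)]. *)
Lemma sq_cos_int_succ n : cos_int (S n) =
  INR (S n) * (2 * INR n + 1) * sq_cos_int n - 2 * INR (S n) ^ 2 * sq_cos_int (S n).
Proof.
pose proof (is_RInt_lincomb2 _ _ _ _ _ _ 1 1 (cos_int_correct (S n))
  (is_RInt_lincomb2 _ _ _ _ _ _ (- (INR (S n) * (2 * INR n + 1)))
     (2 * INR (S n) ^ 2) (sq_cos_int_correct n) (sq_cos_int_correct (S n)))) as H.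
apply (is_RInt_unique_eq _ _ _ _ 0) in H; [lra|].
apply is_RInt_primitive with
  (fun x => x * cos x ^ (2 * S n) + INR (S n) * x ^ 2 * sin x * cos x ^ (2 * n + 1)).
- apply Rlt_le, PI2_pos.
- intros x _; auto_derive; auto.
  replace (n + (n + 0) + 1)%nat with (S (2 * n)) by lia.
  replace (n + S (n + 0))%nat with (S (2 * n)) by lia.
  replace (2 * S n)%nat with (S (S (2 * n))) by lia.
  change (match n with O => 1 | S _ => INR n + 1 end) with (INR (S n)).
  rewrite <- !tech_pow_Rmult, ?Nat.pred_succ, ?S_INR, ?INR_double.
  pose proof (sin2_cos x) as E.
  set (c := cos x ^ (2 * n)); set (k := INR n).
  match goal with |- ?l = _ =>
    replace l with (c * cos x * cos x
     + (k + 1) * x ^ 2 * (cos x * cos x * c - (2 * k + 1) * (sin x * sin x) * c))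
  end.
  + rewrite E; ring.
  + ring.
- intros x _; continuous_by_derive; auto.
- rewrite cos_PI2, sin_0, !pow_i by lia; ring.
Qed.

Lemma cos_int_pos n : 0 < cos_int n.
Proof.
induction n as [|n IH].
- unfold cos_int; rewrite (RInt_ext _ (fun _ => 1)) by (intros; simpl; ring).
  rewrite RInt_const; unfold scal; simpl; unfold mult; simpl.
  pose proof PI2_pos; lra.
- pose proof (cos_int_succ n) as H; pose proof (pos_INR n).
  rewrite S_INR in H.
  apply Rmult_lt_reg_l with (2 * (INR n + 1)); [lra|].
  rewrite H; nra.
Qed.

(** Since [x cos x <= sin x] and [sin x ^ 2 = 1 - cos x ^ 2], the integral is at
    most [cos_int n - cos_int (S n)]. *)
Lemma sq_cos_int_bound n : 0 <= sq_cos_int (S n) <= cos_int (S n) / (2 * INR n + 1).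
Proof.
pose proof PI2_pos as Hpi; pose proof (pos_INR n).
assert (E : cos_int (S n) / (2 * INR n + 1) = cos_int n - cos_int (S n)).
{ pose proof (cos_int_succ n) as H0; rewrite S_INR in H0.
  apply Rmult_eq_reg_r with (2 * INR n + 1); [|lra].
  unfold Rdiv; rewrite Rmult_assoc, Rinv_l by lra; lra. }
rewrite E; split.
- apply RInt_ge_0; [lra|eexists; apply sq_cos_int_correct|].
  intros x Hx; apply Rmult_le_pos; [apply pow2_ge_0|].
  rewrite pow_mult; apply pow_le, pow2_ge_0.
- pose proof (is_RInt_lincomb2 _ _ _ _ _ _ 1 (-1)
    (cos_int_correct n) (cos_int_correct (S n))) as HI.
  replace (cos_int n - cos_int (S n)) with (1 * cos_int n + -1 * cos_int (S n)) by ring.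
  rewrite <- (is_RInt_unique (V := R_CompleteNormedModule) _ _ _ _ HI).
  apply RInt_le; [lra|eexists; apply sq_cos_int_correct|eexists; exact HI|].
  intros x Hx.
  assert (Hsin : x * cos x <= sin x).
  { destruct (MVT_gen (fun y => sin y - y * cos y) 0 x (fun y => y * sin y))
      as (c & Hc & Heq).
    - intros y _; auto_derive; auto; ring.
    - intros y _; apply continuity_pt_filterlim.
      change (continuous (fun y : R => sin y - y * cos y) y).
      continuous_by_derive; auto.
    - rewrite Rmin_left, Rmax_right in Hc by lra.
      rewrite sin_0 in Heq.
      assert (0 <= sin c) by (apply sin_ge_0; lra).
      assert (0 <= c * sin c * (x - 0)) by (repeat apply Rmult_le_pos; lra).
      lra. }
  assert (Hcos : 0 <= cos x) by (apply cos_ge_0; lra).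
  replace (2 * S n)%nat with (S (S (2 * n))) by lia.
  cbv beta; rewrite <- !tech_pow_Rmult.
  set (c := cos x ^ (2 * n)).
  assert (0 <= c) by (unfold c; rewrite pow_mult; apply pow_le, pow2_ge_0).
  replace (x * (x * x ^ 0) * (cos x * (cos x * c))) with ((x * cos x) ^ 2 * c) by ring.
  replace (1 * c + -1 * (cos x * (cos x * c))) with ((1 - cos x * cos x) * c) by ring.
  rewrite <- sin2_cos. apply Rmult_le_compat_r; [assumption|].
  replace (sin x * sin x) with (sin x ^ 2) by ring.
  apply pow_incr; split; [apply Rmult_le_pos; lra|exact Hsin].
Qed.

(** The recurrences make [1 / (n + 1) ^ 2] a telescoping difference of the
    quotients [2 sq_cos_int n / cos_int n]. *)
Lemma is_series_inv_sq : is_series (fun n => / INR (S n) ^ 2) (PI ^ 2 / 6).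
Proof.
set (u := fun n => 2 * (sq_cos_int n / cos_int n)).
assert (Hsum : forall n, sum_n (fun n => / INR (S n) ^ 2) n = PI ^ 2 / 6 - u (S n)).
{ assert (Hu0 : u 0%nat = PI ^ 2 / 6).
  { unfold u.
    assert (H1 : cos_int 0 = PI / 2).
    { apply (is_RInt_unique_eq _ _ _ _ _ (cos_int_correct 0)).
      apply is_RInt_primitive with (fun x => x); [apply Rlt_le, PI2_pos| | |lra].
      - intros x _; auto_derive; auto; simpl; ring.
      - intros x _; continuous_by_derive; auto. }
    assert (H2 : sq_cos_int 0 = (PI / 2) ^ 3 / 3).
    { apply (is_RInt_unique_eq _ _ _ _ _ (sq_cos_int_correct 0)).
      apply is_RInt_primitive with (fun x => x ^ 3 / 3); [apply Rlt_le, PI2_pos| | |].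
      - intros x _; auto_derive; auto; simpl; field.
      - intros x _; continuous_by_derive; auto.
      - field. }
    rewrite H1, H2; pose proof PI_RGT_0; field; lra. }
  assert (Hstep : forall n, / INR (S n) ^ 2 = u n - u (S n)).
  { intros n; unfold u.
    pose proof (cos_int_pos n); pose proof (cos_int_pos (S n)).
    pose proof (cos_int_succ n) as E1; pose proof (sq_cos_int_succ n) as E2.
    pose proof (pos_INR n).
    assert (Hk : INR (S n) <> 0) by (rewrite S_INR; lra).
    assert (E3 : cos_int n = 2 * INR (S n) * cos_int (S n) / (2 * INR n + 1)).
    { rewrite E1; field; lra. }
    rewrite E3.
    apply Rmult_eq_reg_l with (INR (S n) ^ 2 * cos_int (S n));
      [|apply Rmult_integral_contrapositive; split; [now apply pow_nonzero|lra]].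
    transitivity (cos_int (S n)); [field; auto|].
    rewrite E2 at 1; field; repeat split; lra. }
  induction n as [|n IH].
  - rewrite sum_O, Hstep, Hu0; reflexivity.
  - rewrite sum_Sn, IH, Hstep; unfold plus; simpl; ring. }
apply (is_lim_seq_ext (fun n => PI ^ 2 / 6 - u (S n)) _ (PI ^ 2 / 6)).
{ intros n; symmetry; apply Hsum. }
change (is_lim_seq (fun n => PI ^ 2 / 6 - u (S n)) (PI ^ 2 / 6)).
cut (is_lim_seq (fun n => PI ^ 2 / 6 - u (S n)) (PI ^ 2 / 6 - 0)).
{ now rewrite Rminus_0_r. }
apply is_lim_seq_minus'; [apply is_lim_seq_const|].
apply is_lim_seq_le_le with (fun _ => 0) (fun n => 2 * / (INR (S n))).
- intros n; pose proof (sq_cos_int_bound n) as [B1 B2].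
  pose proof (cos_int_pos (S n)) as Hc; pose proof (pos_INR n).
  unfold u; split.
  + apply Rmult_le_pos; [lra|]; apply Rdiv_le_0_compat; auto.
  + apply Rmult_le_compat_l; [lra|].
    apply Rmult_le_reg_r with (cos_int (S n)); auto.
    unfold Rdiv; rewrite Rmult_assoc, Rinv_l, Rmult_1_r by lra.
    eapply Rle_trans; [exact B2|]; unfold Rdiv; rewrite Rmult_comm.
    apply Rmult_le_compat_r; [lra|].
    apply Rinv_le_contravar; rewrite S_INR; lra.
- apply is_lim_seq_const.
- replace (Finite 0) with (Rbar_mult 2 (Finite 0)) by (simpl; f_equal; ring).
  apply is_lim_seq_scal_l.
  apply (is_lim_seq_incr_1 (fun n => / INR n)).
  replace (Finite 0) with (Rbar_inv p_infty) by reflexivity.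
  apply is_lim_seq_inv; [apply is_lim_seq_INR|discriminate].
Qed.

(** * Sine series on the unit interval *)

Definition sine (n : nat) (y : R) : R := sin (INR (S n) * PI * y).
Definition sine_sum (c : nat -> R) (N : nat) (y : R) : R :=
  sum_n (fun n => c n * sine n y) N.

Definition continuous01 (F : R -> R) : Prop :=
  forall y, 0 <= y <= 1 -> continuous F y.

Lemma ex_RInt01 F : continuous01 F -> ex_RInt F 0 1.
Proof.
intros HF; apply (ex_RInt_continuous (V := R_CompleteNormedModule)).
rewrite Rmin_left, Rmax_right by lra; exact HF.
Qed.

Lemma continuous01_mult F G :
  continuous01 F -> continuous01 G -> continuous01 (fun y => F y * G y).
Proof.
intros HF HG y Hy.
apply (continuous_mult (K := R_AbsRing)); auto.
Qed.

Lemma continuous01_plus F G :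
  continuous01 F -> continuous01 G -> continuous01 (fun y => F y + G y).
Proof.
intros HF HG y Hy; apply (continuous_plus (V := R_NormedModule)); auto.
Qed.

Lemma continuous01_minus F G :
  continuous01 F -> continuous01 G -> continuous01 (fun y => F y - G y).
Proof.
intros HF HG y Hy; apply (continuous_minus (V := R_NormedModule)); auto.
Qed.

Lemma continuous01_const c : continuous01 (fun _ => c).
Proof. intros y _; apply continuous_const. Qed.

Lemma continuous01_id : continuous01 (fun y => y).
Proof. intros y _; apply continuous_id. Qed.

Lemma continuous01_sine n : continuous01 (sine n).
Proof. intros y _; unfold sine; continuous_by_derive; auto. Qed.

Lemma continuous01_sine_sum c N : continuous01 (sine_sum c N).
Proof.
induction N as [|N IH]; unfold sine_sum.
- intros y Hy; apply continuous_ext with (fun y => c 0%nat * sine 0 y).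
  + intros x; now rewrite sum_O.
  + apply (continuous01_mult (fun _ => c 0%nat)); auto using continuous01_const.
    apply continuous01_sine.
- intros y Hy.
  apply continuous_ext with (fun y => sine_sum c N y + c (S N) * sine (S N) y).
  + intros x; now rewrite sum_Sn.
  + apply (continuous01_plus (sine_sum c N)); auto.
    apply (continuous01_mult (fun _ => c (S N))); auto using continuous01_const.
    apply continuous01_sine.
Qed.

Lemma RInt_plus01 F G : continuous01 F -> continuous01 G ->
  RInt (fun y => F y + G y) 0 1 = RInt F 0 1 + RInt G 0 1.
Proof.
intros HF HG; apply (RInt_plus (V := R_CompleteNormedModule)); now apply ex_RInt01.
Qed.

Lemma RInt_minus01 F G : continuous01 F -> continuous01 G ->
  RInt (fun y => F y - G y) 0 1 = RInt F 0 1 - RInt G 0 1.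
Proof.
intros HF HG; apply (RInt_minus (V := R_CompleteNormedModule)); now apply ex_RInt01.
Qed.

Lemma RInt_scal01 c F : continuous01 F ->
  RInt (fun y => c * F y) 0 1 = c * RInt F 0 1.
Proof.
intros HF; apply (RInt_scal (V := R_CompleteNormedModule)); now apply ex_RInt01.
Qed.

Lemma RInt_ext01 (F G : R -> R) : (forall y, 0 < y < 1 -> F y = G y) ->
  RInt F 0 1 = RInt G 0 1.
Proof.
intros H; apply (RInt_ext (V := R_CompleteNormedModule)).
rewrite Rmin_left, Rmax_right by lra; exact H.
Qed.

Lemma RInt_primitive01 (F f : R -> R) v :
  (forall x, 0 <= x <= 1 -> is_derive F x (f x)) -> continuous01 f ->
  F 1 - F 0 = v -> RInt f 0 1 = v.
Proof.
intros HF Hf Hv; apply is_RInt_unique.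
apply is_RInt_primitive with F; auto; lra.
Qed.

Lemma RInt_sine_sum c N F : continuous01 F ->
  RInt (fun y => F y * sine_sum c N y) 0 1
  = sum_n (fun n => c n * RInt (fun y => F y * sine n y) 0 1) N.
Proof.
intros HF.
assert (Hs : forall n, continuous01 (fun y => F y * sine n y)).
{ intros n; apply continuous01_mult; auto; apply continuous01_sine. }
induction N as [|N IH].
- rewrite sum_O, <- RInt_scal01 by auto.
  apply RInt_ext01; intros y _; unfold sine_sum; rewrite sum_O; ring.
- rewrite sum_Sn, <- IH, <- RInt_scal01 by auto.
  transitivity (RInt (fun y => F y * sine_sum c N y + c (S N) * (F y * sine (S N) y)) 0 1).
  + apply RInt_ext01; intros y _; unfold sine_sum; rewrite sum_Sn.
    unfold plus; simpl; ring.
  + apply RInt_plus01.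
    * apply continuous01_mult; auto; apply continuous01_sine_sum.
    * apply (continuous01_mult (fun _ => c (S N))); auto; apply continuous01_const.
Qed.

(** All sine series below are integrated term by term through this lemma, both those
    that converge uniformly and the one that converges in mean square only. *)
Lemma mean_square_weak F G (H : nat -> R -> R) :
  continuous01 F -> continuous01 G -> (forall N, continuous01 (H N)) ->
  is_lim_seq (fun N => RInt (fun y => (G y - H N y) ^ 2) 0 1) 0 ->
  is_lim_seq (fun N => RInt (fun y => F y * H N y) 0 1) (RInt (fun y => F y * G y) 0 1).
Proof.
intros HF HG HH Hlim.
apply is_lim_seq_spec in Hlim; apply is_lim_seq_spec; intros eps.
assert (sq : forall K, continuous01 K -> continuous01 (fun y => K y ^ 2)).
{ intros K HK y Hy; apply continuous_ext with (fun y => K y * K y).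
  - intros; simpl; ring.
  - now apply (continuous01_mult K K). }
set (A := RInt (fun y => F y ^ 2) 0 1).
assert (HA : 0 <= A).
{ apply RInt_ge_0; [lra|apply ex_RInt01; auto|intros; apply pow2_ge_0]. }
pose proof (cond_pos eps) as Heps.
set (l := eps / (A + 1)).
assert (Hl : 0 < l) by (apply Rdiv_lt_0_compat; lra).
assert (HlA : l * A <= eps).
{ unfold l; apply Rmult_le_reg_r with (A + 1); [lra|].
  replace (eps / (A + 1) * A * (A + 1)) with (eps * A) by (field; lra). nra. }
destruct (Hlim (mkposreal (l * eps) (Rmult_lt_0_compat _ _ Hl Heps))) as [N0 HN].
exists N0; intros N HNN; specialize (HN N HNN); cbv beta in HN.
change (pos (mkposreal (l * eps) _)) with (l * eps) in HN.
set (B := RInt (fun y => (G y - H N y) ^ 2) 0 1) in *.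
set (D := fun y => G y - H N y).
assert (HD : continuous01 D) by (now apply continuous01_minus).
rewrite <- RInt_minus01 by now apply continuous01_mult.
rewrite (RInt_ext01 _ (fun y => (-1) * (F y * D y))) by (intros; unfold D; ring).
rewrite RInt_scal01 by now apply continuous01_mult.
set (P := RInt (fun y => F y * D y) 0 1).
(* Young's inequality 2 |F D| <= l F^2 + D^2 / l. *)
assert (Hy : forall s, s ^ 2 = 1 -> 2 * s * P <= l * A + / l * B).
{ intros s Hs; unfold P, A, B.
  rewrite <- !RInt_scal01 by (auto using continuous01_mult; exact (sq D HD)).
  rewrite <- (RInt_plus01 (fun y => l * F y ^ 2) (fun y => / l * (G y - H N y) ^ 2)).
  2:{ apply (continuous01_mult (fun _ => l)); auto using continuous01_const. }
  2:{ apply (continuous01_mult (fun _ => / l) (fun y => D y ^ 2)); auto.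
      apply continuous01_const. }
  apply RInt_le; [lra| | |].
  - apply ex_RInt01, (continuous01_mult (fun _ => 2 * s) (fun y => F y * D y));
      auto using continuous01_const, continuous01_mult.
  - apply ex_RInt01, (continuous01_plus (fun y => l * F y ^ 2) (fun y => / l * D y ^ 2)).
    + apply (continuous01_mult (fun _ => l)); auto using continuous01_const.
    + apply (continuous01_mult (fun _ => / l) (fun y => D y ^ 2)); auto.
      apply continuous01_const.
  - intros y _; change (G y - H N y) with (D y).
    apply Rmult_le_reg_l with l; [exact Hl|].
    rewrite Rmult_plus_distr_l, <- (Rmult_assoc l (/ l)), Rinv_r, Rmult_1_l by lra.
    pose proof (pow2_ge_0 (l * s * F y - D y)).
    replace ((l * s * F y - D y) ^ 2)
      with (s ^ 2 * l ^ 2 * F y ^ 2 - 2 * l * s * F y * D y + D y ^ 2) in H0 by ring.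
    rewrite Hs in H0; lra. }
assert (HB : / l * B < eps).
{ apply Rmult_lt_reg_l with l; [exact Hl|].
  rewrite <- Rmult_assoc, Rinv_r, Rmult_1_l by lra.
  apply Rabs_def2 in HN; lra. }
pose proof (Hy 1 ltac:(ring)); pose proof (Hy (-1) ltac:(ring)).
apply Rabs_def1; lra.
Qed.

Lemma sin_nPI n : sin (INR n * PI) = 0.
Proof.
induction n as [|n IH]; [simpl; rewrite Rmult_0_l; apply sin_0|].
rewrite S_INR, Rmult_plus_distr_r, Rmult_1_l, neg_sin, IH; ring.
Qed.

Lemma cos_nPI n : cos (INR n * PI) = (-1) ^ n.
Proof.
induction n as [|n IH]; [simpl; rewrite Rmult_0_l; apply cos_0|].
rewrite S_INR, Rmult_plus_distr_r, Rmult_1_l, neg_cos, IH; simpl; ring.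
Qed.

Lemma sine_1 n : sine n 1 = 0.
Proof. unfold sine; rewrite Rmult_1_r; apply sin_nPI. Qed.

Lemma sine_0 n : sine n 0 = 0.
Proof. unfold sine; rewrite Rmult_0_r; apply sin_0. Qed.

Lemma freq_pos n : 0 < INR (S n) * PI.
Proof. apply Rmult_lt_0_compat; [apply lt_0_INR; lia|apply PI_RGT_0]. Qed.

Lemma RInt_sine_sq n : RInt (fun y => sine n y * sine n y) 0 1 = / 2.
Proof.
pose proof (freq_pos n) as Hk.
apply RInt_primitive01 with
  (fun y => y / 2 - sine n y * cos (INR (S n) * PI * y) / (2 * (INR (S n) * PI))).
- intros y _; unfold sine; set (k := INR (S n) * PI) in *.
  auto_derive; auto.
  pose proof (sin2_cos (k * y)) as E.
  replace (1 * / 2 + - ((k * 1 * cos (k * y) * cos (k * y) +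
     sin (k * y) * (k * 1 * - sin (k * y))) * / (2 * k)))
   with (/ 2 + - (cos (k * y) * cos (k * y) - sin (k * y) * sin (k * y)) * / 2)
   by (field; lra).
  rewrite E; lra.
- apply continuous01_mult; apply continuous01_sine.
- rewrite sine_0, sine_1; set (k := INR (S n) * PI) in *; field; lra.
Qed.

Lemma RInt_sine_sine n m : n <> m ->
  RInt (fun y => sine n y * sine m y) 0 1 = 0.
Proof.
intros Hnm.
pose proof PI_RGT_0 as Hpi; pose proof (pos_INR n); pose proof (pos_INR m).
set (p := (INR (S n) - INR (S m)) * PI).
set (q := (INR (S n) + INR (S m)) * PI).
assert (Hp : p <> 0).
{ unfold p; apply Rmult_integral_contrapositive; split; [|lra].
  rewrite !S_INR; intros E; apply Hnm, INR_eq; lra. }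
assert (Hq : q <> 0).
{ unfold q; rewrite !S_INR; apply Rmult_integral_contrapositive; split; lra. }
apply RInt_primitive01 with (fun y => sin (p * y) / (2 * p) - sin (q * y) / (2 * q)).
- intros y _; auto_derive; auto.
  replace (p * 1 * cos (p * y) * / (2 * p) + - (q * 1 * cos (q * y) * / (2 * q)))
    with ((cos (p * y) - cos (q * y)) / 2) by (field; auto).
  unfold sine, p, q; rewrite Rmult_minus_distr_r, Rmult_plus_distr_r.
  set (a := INR (S n) * PI); set (b := INR (S m) * PI).
  rewrite Rmult_minus_distr_r, Rmult_plus_distr_r, cos_minus, cos_plus; field.
- apply continuous01_mult; apply continuous01_sine.
- rewrite !Rmult_1_r, !Rmult_0_r, sin_0.
  unfold p, q; rewrite Rmult_minus_distr_r, Rmult_plus_distr_r.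
  rewrite sin_minus, sin_plus, !sin_nPI; unfold Rdiv; ring.
Qed.

Lemma RInt_id_sine n :
  RInt (fun y => y * sine n y) 0 1 = (-1) ^ n / (INR (S n) * PI).
Proof.
pose proof (freq_pos n) as Hk.
apply RInt_primitive01 with
  (fun y => sine n y / (INR (S n) * PI) ^ 2
            - y * cos (INR (S n) * PI * y) / (INR (S n) * PI)).
- intros y _; unfold sine; set (k := INR (S n) * PI) in *.
  auto_derive; auto; field; lra.
- apply (continuous01_mult (fun y => y)); [apply continuous01_id|apply continuous01_sine].
- rewrite sine_0, sine_1, Rmult_1_r, cos_nPI; set (k := INR (S n) * PI) in *.
  change ((-1) ^ S n) with (-1 * (-1) ^ n).
  set (u := (-1) ^ n); field; lra.
Qed.

Lemma is_derive_mult_R (f g : R -> R) x df dg :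
  is_derive f x df -> is_derive g x dg ->
  is_derive (fun y => f y * g y) x (df * g x + f x * dg).
Proof.
intros Hf Hg; apply (is_derive_mult (K := R_AbsRing) f g x df dg Hf Hg).
intros; apply Rmult_comm.
Qed.

(** The Dirichlet conditions remove both boundary terms of the two integrations
    by parts. *)
Lemma RInt_second_derivative_sine (F F1 F2 : R -> R) n :
  (forall y, 0 <= y <= 1 -> is_derive F y (F1 y)) ->
  (forall y, 0 <= y <= 1 -> is_derive F1 y (F2 y)) ->
  continuous01 F2 -> F 0 = 0 -> F 1 = 0 ->
  RInt (fun y => F2 y * sine n y) 0 1
  = - (INR (S n) * PI) ^ 2 * RInt (fun y => F y * sine n y) 0 1.
Proof.
intros H1 H2 HF2 H00 H01.
set (k := INR (S n) * PI).
assert (HF : continuous01 F).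
{ intros y Hy; eapply continuous_of_derive; eauto. }
assert (HFs : continuous01 (fun y => F y * sine n y)).
{ apply continuous01_mult; auto; apply continuous01_sine. }
assert (HF2s : continuous01 (fun y => F2 y * sine n y)).
{ apply continuous01_mult; auto; apply continuous01_sine. }
assert (HkFs : continuous01 (fun y => k ^ 2 * (F y * sine n y))).
{ apply (continuous01_mult (fun _ => k ^ 2)); auto; apply continuous01_const. }
assert (E : RInt (fun y => F2 y * sine n y + k ^ 2 * (F y * sine n y)) 0 1 = 0).
{ apply RInt_primitive01 with (fun y => F1 y * sine n y - F y * (k * cos (k * y))).
  - intros y Hy.
    assert (Ds : is_derive (sine n) y (k * cos (k * y))).
    { unfold sine; fold k; auto_derive; auto; ring. }
    assert (Dc : is_derive (fun y => k * cos (k * y)) y (- k ^ 2 * sine n y)).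
    { unfold sine; fold k; auto_derive; auto; ring. }
    replace (F2 y * sine n y + k ^ 2 * (F y * sine n y))
      with ((F2 y * sine n y + F1 y * (k * cos (k * y)))
            - (F1 y * (k * cos (k * y)) + F y * (- k ^ 2 * sine n y))) by ring.
    apply (is_derive_minus (V := R_NormedModule)).
    + apply (is_derive_mult_R F1 (sine n)); auto.
    + apply (is_derive_mult_R F (fun y => k * cos (k * y))); auto.
  - now apply continuous01_plus.
  - rewrite sine_0, sine_1, H00, H01; ring. }
rewrite RInt_plus01, RInt_scal01 in E; auto; lra.
Qed.

(** Sine coefficients of the identity function. *)
Definition id_sine_coef (n : nat) : R := 2 * (-1) ^ n / (INR (S n) * PI).

Lemma RInt_sq_remainder N :
  RInt (fun y => (y - sine_sum id_sine_coef N y) ^ 2) 0 1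
  = / 3 - sum_n (fun n => id_sine_coef n ^ 2 / 2) N.
Proof.
assert (Hid := continuous01_id).
assert (Hsum := continuous01_sine_sum id_sine_coef).
assert (Hs := continuous01_sine).
(* Bessel's identity: both cross terms reduce to sums of squared coefficients. *)
assert (Hc : forall n M,
  RInt (fun y => sine n y * sine_sum id_sine_coef M y) 0 1
  = if Nat.leb n M then id_sine_coef n / 2 else 0).
{ intros n M; rewrite RInt_sine_sum by auto.
  induction M as [|M IH].
  - rewrite sum_O; destruct n as [|n].
    + simpl Nat.leb; cbv iota; rewrite RInt_sine_sq; lra.
    + rewrite RInt_sine_sine by lia; simpl; real_eq; ring.
  - rewrite sum_Sn, IH; unfold plus; simpl; real_eq.
    destruct (Nat.leb_spec n M) as [Hle|Hgt].
    + rewrite (proj2 (Nat.leb_le n (S M))) by lia.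
      rewrite RInt_sine_sine by lia; ring.
    + destruct (Nat.eq_dec n (S M)) as [->|Hne].
      * rewrite Nat.leb_refl, RInt_sine_sq; lra.
      * rewrite (proj2 (Nat.leb_gt n (S M))) by lia.
        rewrite RInt_sine_sine by lia; ring. }
assert (Hy2 : RInt (fun y => y * y) 0 1 = / 3).
{ apply RInt_primitive01 with (fun y => y ^ 3 / 3).
  - intros y _; auto_derive; auto; simpl; field.
  - now apply continuous01_mult.
  - field. }
assert (Hcross : RInt (fun y => y * sine_sum id_sine_coef N y) 0 1
  = sum_n (fun n => id_sine_coef n ^ 2 / 2) N).
{ rewrite (RInt_sine_sum id_sine_coef N (fun y => y)) by auto.
  apply sum_n_ext; intros n; rewrite RInt_id_sine; unfold id_sine_coef; real_eq.
  pose proof (freq_pos n); set (k := INR (S n) * PI) in *.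
  set (u := (-1) ^ n); field; lra. }
assert (Hsq : RInt (fun y => sine_sum id_sine_coef N y * sine_sum id_sine_coef N y) 0 1
  = sum_n (fun n => id_sine_coef n ^ 2 / 2) N).
{ rewrite (RInt_sine_sum id_sine_coef N (sine_sum id_sine_coef N)) by auto.
  rewrite <- (sum_n_ext_loc (fun n => id_sine_coef n ^ 2 / 2)); [reflexivity|].
  intros n Hn; real_eq.
  rewrite (RInt_ext01 _ (fun y => sine n y * sine_sum id_sine_coef N y))
    by (intros; ring).
  rewrite Hc, (proj2 (Nat.leb_le n N)) by lia; field. }
rewrite (RInt_ext01 _ (fun y => (y * y - y * sine_sum id_sine_coef N y)
   + (sine_sum id_sine_coef N y * sine_sum id_sine_coef N y
      - y * sine_sum id_sine_coef N y))) by (intros; ring).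
rewrite RInt_plus01, !RInt_minus01, Hy2, Hcross, Hsq;
  auto using continuous01_mult, continuous01_minus.
real_eq; ring.
Qed.

(** The sum of inverse squares is what makes the sine series of [y], that is, of
    the constant function on the ball, converge in mean square. *)
Lemma id_sine_series F : continuous01 F ->
  is_series (fun n => id_sine_coef n * RInt (fun y => F y * sine n y) 0 1)
    (RInt (fun y => F y * y) 0 1).
Proof.
intros HF.
apply (is_lim_seq_ext (fun N => RInt (fun y => F y * sine_sum id_sine_coef N y) 0 1)
  _ (RInt (fun y => F y * y) 0 1)).
{ intros N; now apply RInt_sine_sum. }
apply (mean_square_weak F (fun y => y) (sine_sum id_sine_coef)); auto.
- apply continuous01_id.
- apply continuous01_sine_sum.
- apply (is_lim_seq_ext (fun N => / 3 - sum_n (fun n => id_sine_coef n ^ 2 / 2) N)).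
  { intros N; symmetry; apply RInt_sq_remainder. }
  assert (Hser : is_series (fun n => id_sine_coef n ^ 2 / 2) (/ 3)).
  { replace (/ 3) with (2 / PI ^ 2 * (PI ^ 2 / 6)).
    2:{ pose proof PI_RGT_0; field; lra. }
    apply (is_series_ext (fun n => 2 / PI ^ 2 * / INR (S n) ^ 2)).
    - intros n; unfold id_sine_coef; real_eq.
      assert (0 < INR (S n)) by (apply lt_0_INR; lia).
      assert (E : (-1) ^ n * (-1) ^ n = 1).
      { rewrite <- Rpow_mult_distr; replace (-1 * -1) with 1 by ring; apply pow1. }
      pose proof PI_RGT_0.
      transitivity (2 / PI ^ 2 * ((-1) ^ n * (-1) ^ n) * / INR (S n) ^ 2);
        [rewrite E|]; field; lra.
    - exact (is_series_scal_l (K := R_AbsRing) (2 / PI ^ 2)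
        (fun n => / INR (S n) ^ 2) _ is_series_inv_sq). }
  change (is_lim_seq (fun N => / 3 - sum_n (fun n => id_sine_coef n ^ 2 / 2) N) 0).
  cut (is_lim_seq (fun N => / 3 - sum_n (fun n => id_sine_coef n ^ 2 / 2) N) (/ 3 - / 3)).
  { now rewrite Rminus_diag. }
  apply is_lim_seq_minus'; [apply is_lim_seq_const|exact Hser].
Qed.

Lemma Rabs_mult_sine (c : R) n y : Rabs (c * sine n y) <= Rabs c.
Proof.
rewrite Rabs_mult; pose proof (Rabs_pos c).
assert (Rabs (sine n y) <= 1) by (apply Rabs_le, SIN_bound).
nra.
Qed.

(** With summable coefficients the series converges uniformly, hence in mean
    square. *)
Lemma abs_sine_series (c : nat -> R) F f :
  ex_series (fun n => Rabs (c n)) -> continuous01 F -> continuous01 f ->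
  (forall y, 0 <= y <= 1 -> f y = Series (fun n => c n * sine n y)) ->
  is_series (fun n => c n * RInt (fun y => F y * sine n y) 0 1)
    (RInt (fun y => F y * f y) 0 1).
Proof.
intros Hc HF Hf Hfs.
apply (is_lim_seq_ext (fun N => RInt (fun y => F y * sine_sum c N y) 0 1)
  _ (RInt (fun y => F y * f y) 0 1)).
{ intros N; now apply RInt_sine_sum. }
apply (mean_square_weak F f (sine_sum c)); auto.
{ apply continuous01_sine_sum. }
set (tail := fun N => Series (fun n => Rabs (c (S N + n)%nat))).
assert (Ht : forall N, tail N = Series (fun n => Rabs (c n)) - sum_n (fun n => Rabs (c n)) N).
{ intros N; unfold tail; rewrite (Series_incr_n (fun n => Rabs (c n)) (S N)) by (auto; lia).
  rewrite sum_n_Reals; simpl Init.Nat.pred; ring. }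
assert (Hex : forall N, ex_series (fun n => Rabs (c (S N + n)%nat))).
{ intros N; now apply (ex_series_incr_n (fun n => Rabs (c n)) (S N)). }
assert (Hb : forall N y, 0 <= y <= 1 -> Rabs (f y - sine_sum c N y) <= tail N).
{ intros N y Hy01.
  assert (Hey : forall M, ex_series (fun n => Rabs (c (M + n)%nat * sine (M + n) y))).
  { intros M.
    apply (ex_series_le (K := R_AbsRing) (V := R_CompleteNormedModule))
      with (fun n => Rabs (c (M + n)%nat)).
    - intros n; change (Rabs (Rabs (c (M + n)%nat * sine (M + n) y)) <= Rabs (c (M + n)%nat)).
      rewrite Rabs_Rabsolu; apply Rabs_mult_sine.
    - now apply (ex_series_incr_n (fun n => Rabs (c n)) M). }
  rewrite Hfs by exact Hy01; unfold sine_sum.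
  rewrite (Series_incr_n (fun n => c n * sine n y) (S N)), sum_n_Reals; [|lia|].
  2:{ apply ex_series_Rabs, (Hey 0%nat). }
  simpl Init.Nat.pred.
  match goal with |- Rabs (?a + ?b - ?a) <= _ => replace (a + b - a) with b by ring end.
  eapply Rle_trans; [apply Series_Rabs, (Hey (S N))|].
  apply Series_le; [|apply Hex].
  intros n; split; [apply Rabs_pos|apply Rabs_mult_sine]. }
assert (Htl : is_lim_seq tail 0).
{ apply (is_lim_seq_ext (fun N => Series (fun n => Rabs (c n))
    - sum_n (fun n => Rabs (c n)) N)); [intros; now rewrite Ht|].
  cut (is_lim_seq (fun N => Series (fun n => Rabs (c n)) - sum_n (fun n => Rabs (c n)) N)
    (Series (fun n => Rabs (c n)) - Series (fun n => Rabs (c n)))).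
  { now rewrite Rminus_diag. }
  apply is_lim_seq_minus'; [apply is_lim_seq_const|apply (Series_correct _ Hc)]. }
assert (Hcont : forall N, continuous01 (fun y => (f y - sine_sum c N y) ^ 2)).
{ intros N y Hy.
  apply continuous_ext with
    (fun y => (f y - sine_sum c N y) * (f y - sine_sum c N y)); [intros; simpl; ring|].
  apply (continuous01_mult (fun y => f y - sine_sum c N y) (fun y => f y - sine_sum c N y));
    auto; apply continuous01_minus; auto; apply continuous01_sine_sum. }
apply is_lim_seq_le_le with (fun _ => 0) (fun N => tail N * tail N).
- intros N; split.
  + apply RInt_ge_0; [lra|apply ex_RInt01; auto|intros; apply pow2_ge_0].
  + eapply Rle_trans; [apply Rle_abs|].
    replace (tail N * tail N) with ((1 - 0) * (tail N * tail N)) by ring.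
    apply abs_RInt_le_const; [lra|apply ex_RInt01; auto|].
    intros y Hy; specialize (Hb N y Hy); pose proof (Rabs_pos (f y - sine_sum c N y)).
    rewrite <- RPow_abs; simpl; nra.
- apply is_lim_seq_const.
- cut (is_lim_seq (fun N => tail N * tail N) (0 * 0)); [now rewrite Rmult_0_l|].
  now apply is_lim_seq_mult'.
Qed.

(** * Coefficients of radial functions on the ball *)

(** For radial [f] and [F y = y * f y], the coefficient of [f] along the
    eigenfunction of index [n + 1] is [ball_coef F n]. *)
Definition ball_scale : R := 4 * PI / sqrt (2 * PI).
Definition ball_coef (F : R -> R) (n : nat) : R :=
  ball_scale * RInt (fun y => F y * sine n y) 0 1.

(** Coefficients of the constant function 1. *)
Definition one_coef (n : nat) : R := ball_scale / 2 * id_sine_coef n.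

Lemma sqrt_2PI_pos : 0 < sqrt (2 * PI).
Proof. apply sqrt_lt_R0; pose proof PI_RGT_0; lra. Qed.

Lemma ball_scale_sqrt : ball_scale * sqrt (2 * PI) = 4 * PI.
Proof. unfold ball_scale; pose proof sqrt_2PI_pos; field; lra. Qed.

Lemma ball_scale_sq : ball_scale * ball_scale = 8 * PI.
Proof.
pose proof PI_RGT_0 as Hpi; pose proof sqrt_2PI_pos.
unfold ball_scale.
transitivity (16 * PI ^ 2 / (sqrt (2 * PI) * sqrt (2 * PI))); [field; lra|].
rewrite sqrt_sqrt by lra; field; lra.
Qed.

Lemma is_series_scal_R (c : R) (u : nat -> R) l :
  is_series u l -> is_series (fun n => c * u n) (c * l).
Proof. intros H; exact (is_series_scal_l (K := R_AbsRing) c u l H). Qed.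

Lemma is_series_eq (u v : nat -> R) k l :
  is_series u k -> (forall n, u n = v n) -> k = l -> is_series v l.
Proof. intros H Huv <-; now apply is_series_ext with u. Qed.

Lemma one_coef_series F : continuous01 F ->
  is_series (fun n => one_coef n * ball_coef F n)
    (4 * PI * RInt (fun y => F y * y) 0 1).
Proof.
intros HF; eapply is_series_eq.
- apply (is_series_scal_R (ball_scale * ball_scale / 2)), (id_sine_series F HF).
- intros n; cbv beta; unfold one_coef, ball_coef; field.
- rewrite ball_scale_sq; real_eq; field.
Qed.

Lemma one_coef_eq n : one_coef n = ball_coef (fun y => y) n.
Proof.
unfold ball_coef, one_coef, id_sine_coef; rewrite RInt_id_sine.
pose proof (freq_pos n); set (k := INR (S n) * PI) in *; field; lra.
Qed.

Lemma one_coef_sq_series : is_series (fun n => one_coef n ^ 2) (4 * PI / 3).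
Proof.
eapply is_series_eq; [apply (one_coef_series (fun y => y)), continuous01_id| |].
- intros n; cbv beta; rewrite <- one_coef_eq; ring.
- cut (RInt (fun y => y * y) 0 1 = / 3); [intros ->; real_eq; field|].
  apply RInt_primitive01 with (fun y => y ^ 3 / 3).
  + intros y _; auto_derive; auto; simpl; field.
  + apply (continuous01_mult (fun y => y) (fun y => y)); apply continuous01_id.
  + field.
Qed.

Lemma l2_one_coef : l2 one_coef.
Proof. eexists; apply one_coef_sq_series. Qed.

Lemma sqsum_one_coef : sqsum one_coef = 4 * PI / 3.
Proof. apply is_series_unique, one_coef_sq_series. Qed.

Lemma is_series_single (u : nat -> R) m :
  (forall n, n <> m -> u n = 0) -> is_series u (u m).
Proof.
intros Hu.
assert (Hs : forall N, sum_n u N = if Nat.leb m N then u m else 0).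
{ induction N as [|N IH].
  - rewrite sum_O; destruct m as [|m]; [reflexivity|now rewrite Hu].
  - rewrite sum_Sn, IH; unfold plus; simpl; real_eq.
    destruct (Nat.leb_spec m N) as [Hle|Hgt].
    + rewrite (proj2 (Nat.leb_le m (S N))), (Hu (S N)) by lia; ring.
    + destruct (Nat.eq_dec m (S N)) as [->|Hne].
      * rewrite Nat.leb_refl; ring.
      * rewrite (proj2 (Nat.leb_gt m (S N))), (Hu (S N)) by lia; ring. }
unfold is_series; apply filterlim_ext_loc with (fun _ => u m).
- exists m; intros N HN; rewrite Hs, (proj2 (Nat.leb_le m N)) by lia; reflexivity.
- apply filterlim_const.
Qed.

(** ** Expansions with summable coefficients *)

Section Expansion.

Context (th : nat -> R) (f : R -> R)
  (Hth : ex_series (fun n => Rabs (th n)))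
  (Hf : continuous01 f)
  (Hsum : forall y, 0 <= y <= 1 ->
     f y = Series (fun n => th n / sqrt (2 * PI) * sine n y)).

(** Parseval's identity in the form that is needed here: the expanded function has
    summable coefficients while [F] is only continuous. *)
Lemma expansion_weak F : continuous01 F ->
  is_series (fun n => th n * ball_coef F n) (4 * PI * RInt (fun y => F y * f y) 0 1).
Proof.
intros HF; pose proof sqrt_2PI_pos as Hs.
assert (Hc : ex_series (fun n => Rabs (th n / sqrt (2 * PI)))).
{ apply ex_series_ext with (fun n => / sqrt (2 * PI) * Rabs (th n)).
  - intros n; unfold Rdiv; rewrite Rabs_mult, (Rabs_pos_eq (/ _)); [real_eq; ring|].
    now apply Rlt_le, Rinv_0_lt_compat.
  - now apply (ex_series_scal_l (K := R_AbsRing) (/ sqrt (2 * PI))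
      (fun n => Rabs (th n))). }
eapply is_series_eq.
- apply (is_series_scal_R (4 * PI)), (abs_sine_series _ F f Hc HF Hf Hsum).
- intros n; cbv beta; unfold ball_coef; rewrite <- ball_scale_sqrt; field; lra.
- reflexivity.
Qed.

Lemma expansion_coef n : th n = ball_coef f n.
Proof.
pose proof sqrt_2PI_pos as Hs; pose proof PI_RGT_0.
assert (Hd : forall m, m <> n -> th m * ball_coef (sine n) m = 0).
{ intros m Hm; unfold ball_coef; rewrite RInt_sine_sine by auto; ring. }
pose proof (is_series_unique _ _ (is_series_single _ n Hd)) as E1.
pose proof (is_series_unique _ _ (expansion_weak (sine n) (continuous01_sine n))) as E2.
rewrite E1 in E2; unfold ball_coef in E2; rewrite RInt_sine_sq in E2.
unfold ball_coef; rewrite (RInt_ext01 _ (fun y => sine n y * f y)) by (intros; ring).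
set (I := RInt _ 0 1) in *.
apply Rmult_eq_reg_r with (ball_scale * / 2).
- transitivity (ball_scale * ball_scale * I / 2); [rewrite ball_scale_sq; lra|field].
- assert (0 < ball_scale) by (apply Rdiv_lt_0_compat; lra); lra.
Qed.

Lemma expansion_sq : is_series (fun n => th n ^ 2)
  (4 * PI * RInt (fun y => f y * f y) 0 1).
Proof.
eapply is_series_eq; [apply (expansion_weak f Hf)| |reflexivity].
intros n; cbv beta; rewrite <- expansion_coef; ring.
Qed.

End Expansion.

(** * The balance laws at a fixed time *)

(** Here [g] is the perturbation profile, [k0], [k1] stand for the factors
    [kappa / (gamma c_v R^2)] and [w_1 / (gamma rho_b)], and [bulk] is [y] times
    the right-hand side of the density equation
    [k0 Delta (log rho) + k1 (y g' / 3 + g)] with [rho = r + g]. *)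
Section Bulk.

Context (g g1 g2 : R -> R) (r k0 k1 : R)
  (Hg1 : forall y, is_derive g y (g1 y)) (Hg2 : forall y, is_derive g1 y (g2 y))
  (Hg2c : forall y, continuous g2 y) (Hg_1 : g 1 = 0)
  (Hr : forall y, 0 <= y <= 1 -> 0 < r + g y).

Definition bulk (y : R) : R :=
  k0 * ((y * g2 y + 2 * g1 y) / (r + g y) - y * g1 y ^ 2 / (r + g y) ^ 2)
  + k1 * (y ^ 2 * g1 y / 3 + y * g y).

Lemma profile_Derive y : Derive (fun x => g x) y = g1 y.
Proof. apply is_derive_unique, Hg1. Qed.

Lemma profile1_Derive y : Derive (fun x => g1 x) y = g2 y.
Proof. apply is_derive_unique, Hg2. Qed.

Lemma profile_continuous : continuous01 g.
Proof. intros y _; eapply continuous_of_derive; eauto. Qed.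

Lemma profile1_continuous : continuous01 g1.
Proof. intros y _; eapply continuous_of_derive; eauto. Qed.

Lemma inv_density_continuous : continuous01 (fun y => / (r + g y)).
Proof.
intros y Hy; pose proof (Hr y Hy).
apply (continuous_of_derive _ _ (- g1 y / (r + g y) ^ 2)).
replace (- g1 y / (r + g y) ^ 2) with (- (0 + g1 y) / (r + g y) ^ 2) by (f_equal; ring).
apply (is_derive_inv (fun y => r + g y)); [|lra].
apply (is_derive_plus (V := R_NormedModule)); [|apply Hg1].
apply (is_derive_const (K := R_AbsRing) (V := R_NormedModule)).
Qed.

Ltac derivability := lazymatch goal with
  | |- ex_derive (fun x => g1 x) _ => eexists; apply Hg2
  | |- ex_derive (fun x => g x) _ => eexists; apply Hg1
  | |- True => exact I
  | |- _ <> 0 => lra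
  end.

Lemma profile2_continuous : continuous01 g2.
Proof. intros y _; apply Hg2c. Qed.

Ltac cont01 := lazymatch goal with
  | |- continuous01 (fun _ => ?c) => apply continuous01_const
  | |- continuous01 (fun y => y) => apply continuous01_id
  | |- continuous01 (fun y => / (r + g y)) => apply inv_density_continuous
  | |- continuous01 (fun y => @?F y + @?G y) => apply (continuous01_plus F G); cont01
  | |- continuous01 (fun y => @?F y - @?G y) => apply (continuous01_minus F G); cont01
  | |- continuous01 (fun y => @?F y * @?G y) => apply (continuous01_mult F G); cont01
  | |- continuous01 (fun y => ?F y) => change (continuous01 F); cont01
  | |- continuous01 g => apply profile_continuous
  | |- continuous01 g1 => apply profile1_continuous
  | |- continuous01 g2 => apply profile2_continuous
  | |- continuous01 _ => assumption
  end.

Lemma continuous01_ext F G : (forall y, F y = G y) -> continuous01 F -> continuous01 G.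
Proof. intros E HF y Hy; now apply continuous_ext with F; [|apply HF]. Qed.

Lemma bulk_continuous : continuous01 bulk.
Proof.
apply continuous01_ext with (fun y =>
  k0 * ((y * g2 y + 2 * g1 y) * / (r + g y)
        - y * (g1 y * g1 y) * (/ (r + g y) * / (r + g y)))
  + k1 * (y * y * g1 y * / 3 + y * g y)).
- intros y; unfold bulk, Rdiv; rewrite <- pow_inv; ring.
- cont01.
Qed.

Lemma bulk_flux : RInt (fun y => bulk y * y) 0 1 = k0 * g1 1 / r.
Proof.
apply RInt_primitive01 with
  (fun y => k0 * (y ^ 2 * g1 y / (r + g y)) + k1 * (y ^ 3 * g y / 3)).
- intros y Hy; pose proof (Hr y Hy).
  auto_derive.
  + repeat split; derivability.
  + rewrite profile_Derive, profile1_Derive.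
    unfold bulk; field; lra.
- apply continuous01_mult; [apply bulk_continuous|apply continuous01_id].
- rewrite Hg_1; pose proof (Hr 1 ltac:(lra)) as H; rewrite Hg_1 in H.
  pose proof (Hr 0 ltac:(lra)); field; lra.
Qed.

(** The diffusion term is dissipative whatever the size of the density, and the
    transport term reproduces the squared norm itself. *)
Lemma bulk_energy : 0 <= k0 ->
  RInt (fun y => bulk y * (y * g y)) 0 1
  <= k1 / 2 * RInt (fun y => (y * g y) * (y * g y)) 0 1.
Proof.
intros Hk0.
set (D := fun y => y * y * (g1 y * g1 y) * / (r + g y)).
assert (HD : continuous01 D) by (unfold D; cont01).
assert (Hbulk := bulk_continuous).
assert (HD0 : 0 <= RInt D 0 1).
{ apply RInt_ge_0; [lra|now apply ex_RInt01|].
  intros y Hy; pose proof (Hr y ltac:(lra)); unfold D.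
  apply Rmult_le_pos; [|now apply Rlt_le, Rinv_0_lt_compat].
  replace (y * y * (g1 y * g1 y)) with ((y * g1 y) ^ 2) by ring; apply pow2_ge_0. }
assert (HS : continuous01 (fun y => y * g y * (y * g y))) by cont01.
assert (HB : continuous01 (fun y => bulk y * (y * g y))) by cont01.
assert (E : RInt (fun y => bulk y * (y * g y)
    + (k0 * D y - k1 / 2 * (y * g y * (y * g y)))) 0 1 = 0).
{ apply RInt_primitive01 with
    (fun y => k0 * (y ^ 2 * g1 y * g y / (r + g y)) + k1 * (y ^ 3 * (g y * g y) / 6)).
  - intros y Hy; pose proof (Hr y Hy).
    auto_derive.
    + repeat split; derivability.
    + rewrite profile_Derive, profile1_Derive.
      unfold bulk, D; field; lra.
  - cont01.
  - pose proof (Hr 0 ltac:(lra)); pose proof (Hr 1 ltac:(lra)) as H1.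
    rewrite Hg_1 in H1 |- *; field; lra. }
rewrite RInt_plus01, RInt_minus01, !RInt_scal01 in E by (try assumption; cont01).
assert (0 <= k0 * RInt D 0 1) by now apply Rmult_le_pos.
lra.
Qed.

Lemma laplacian_flux :
  RInt (fun y => (y * g2 y + 2 * g1 y) * y) 0 1 = g1 1.
Proof.
apply RInt_primitive01 with (fun y => y ^ 2 * g1 y).
- intros y _; auto_derive; [eexists; apply Hg2|].
  rewrite profile1_Derive; ring.
- cont01.
- ring.
Qed.

Lemma laplacian_coef n : ball_coef (fun y => y * g2 y + 2 * g1 y) n
  = - (INR (S n) * PI) ^ 2 * ball_coef (fun y => y * g y) n.
Proof.
unfold ball_coef.
rewrite (RInt_second_derivative_sine (fun y => y * g y) (fun y => g y + y * g1 y)).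
- ring.
- intros y _; auto_derive; [eexists; apply Hg1|].
  rewrite profile_Derive; ring.
- intros y _; auto_derive; [repeat split; derivability|].
  rewrite profile_Derive, profile1_Derive; ring.
- cont01.
- ring.
- rewrite Hg_1; ring.
Qed.

End Bulk.

(** * Constants of the bubble *)

Definition well_posed (p : params) : Prop :=
  positive_constants p /\ 0 < vol p /\ is_equilibrium p.

Section Constants.

Context (p : params) (Hp : well_posed p).

Lemma gamma_gt_1 : 1 < gamma p.
Proof.
destruct Hp as ((_ & _ & _ & Hc & Hr & _) & _); unfold gamma.
assert (0 < R_gas p / c_v p) by now apply Rdiv_lt_0_compat.
lra.
Qed.

Lemma rho_dag_pos : 0 < rho_dag p.
Proof. apply Hp. Qed.

Lemma R_dag_pos : 0 < R_dag p.
Proof. apply Hp. Qed.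

Lemma RT_pos : 0 < R_gas p * T_c p.
Proof. destruct Hp as ((_ & _ & _ & _ & Hr & Ht & _) & _); now apply Rmult_lt_0_compat. Qed.

Lemma diffusivity_pos : 0 < kappa p / (gamma p * c_v p).
Proof.
destruct Hp as ((_ & _ & Hk & Hc & _) & _); pose proof gamma_gt_1.
apply Rdiv_lt_0_compat; [assumption|apply Rmult_lt_0_compat; lra].
Qed.

Lemma chi_eq : chi p = kappa p / (gamma p * c_v p) / (R_dag p ^ 2 * rho_dag p).
Proof.
destruct Hp as ((_ & _ & _ & Hc & _) & _).
pose proof gamma_gt_1; pose proof rho_dag_pos; pose proof R_dag_pos.
unfold chi; field; repeat split; lra.
Qed.

Lemma chi_pos : 0 < chi p.
Proof.
rewrite chi_eq; apply Rdiv_lt_0_compat; [apply diffusivity_pos|].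
apply Rmult_lt_0_compat; [apply pow_lt, R_dag_pos|apply rho_dag_pos].
Qed.

Lemma Vbar_pos : 0 < Vbar p.
Proof.
destruct Hp as (_ & Hv & _); unfold Vbar; pose proof PI_RGT_0.
apply Rdiv_lt_0_compat; lra.
Qed.

Lemma bar_pos r : 0 < bar p r.
Proof. apply exp_pos. Qed.

Lemma bar_cube r : 0 < r -> bar p r ^ 3 = r ^ 3 + Vbar p.
Proof.
intros Hr; pose proof Vbar_pos; pose proof (pow_lt r 3 Hr).
unfold bar, cbrt; rewrite <- (Rpower_pow 3) by apply exp_pos.
rewrite Rpower_mult; replace (1 / 3 * INR 3) with 1 by (simpl; field).
apply Rpower_1; lra.
Qed.

Lemma bar_gt r : 0 < r -> r < bar p r.
Proof.
intros Hr; pose proof (bar_cube r Hr) as E; pose proof Vbar_pos.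
pose proof (bar_pos r) as Hb.
destruct (Rlt_le_dec r (bar p r)) as [|Hle]; [assumption|exfalso].
assert (bar p r ^ 3 <= r ^ 3) by (apply pow_incr; lra).
lra.
Qed.

Lemma shell_pos r : 0 < r -> 0 < r - r ^ 2 / bar p r.
Proof.
intros Hr; pose proof (bar_gt r Hr); pose proof (bar_pos r).
replace (r - r ^ 2 / bar p r) with (r * (bar p r - r) / bar p r) by (field; lra).
apply Rdiv_lt_0_compat; [apply Rmult_lt_0_compat; lra|assumption].
Qed.

Lemma R_tilde_pos : 0 < R_tilde p.
Proof. apply shell_pos, R_dag_pos. Qed.

Lemma xi_eq n : xi p (S n) = (1 - / gamma p) * one_coef n.
Proof.
pose proof gamma_gt_1; pose proof PI_RGT_0 as Hpi.
assert (Hn : 0 < INR (S n)) by (apply lt_0_INR; lia).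
assert (Hs : 0 < sqrt PI) by now apply sqrt_lt_R0.
assert (Hs2 : 0 < sqrt 2) by (apply sqrt_lt_R0; lra).
unfold xi, one_coef, id_sine_coef, ball_scale.
replace (S n - 1)%nat with n by lia.
replace (Rpower 2 (3 / 2)) with (2 * sqrt 2).
2:{ replace (3 / 2) with (1 + / 2) by field.
    rewrite Rpower_plus, Rpower_1, Rpower_sqrt; lra. }
rewrite sqrt_mult by lra.
transitivity ((gamma p - 1) * (-1) ^ n * (sqrt 2 * sqrt 2 * 2)
  / (sqrt 2 * sqrt PI * gamma p * INR (S n))); [field; lra|].
rewrite sqrt_sqrt by lra; field; lra.
Qed.

Lemma l2_xi : l2 (fun n => xi p (S n)).
Proof.
apply ex_series_ext with (fun n => vscal (1 - / gamma p) one_coef n ^ 2).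
- intros n; unfold vscal; now rewrite xi_eq.
- apply l2_scal, l2_one_coef.
Qed.

(** Square-summability of [opL p z] bounds [zeta k * theta k] up to a multiple of
    [xi k], which is itself square-summable; dividing by [zeta k] leaves summable
    coefficients. *)
Lemma dom_L_summable z : dom_L p z -> ex_series (fun n => Rabs (shift 3 z n)).
Proof.
intros (Hz & _ & HL); pose proof chi_pos as Hchi.
set (q := fun n => zeta (S n) * shift 3 z n).
assert (Hq : l2 q).
{ apply ex_series_ext with (fun n =>
    vscal (- / chi p) (vadd (shift 3 (opL p z))
      (vscal (lin_row1 p z) (fun n => xi p (S n)))) n ^ 2).
  - intros n; f_equal; unfold q, vscal, vadd, shift, opL, theta; simpl.
    change (z (S (S (S n)))) with (z (3 + n)%nat); real_eq; field; lra.
  - apply l2_scal, l2_add; [now apply l2_shift|apply l2_scal, l2_xi]. }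
assert (Hs : ex_series (fun n => Rabs (q n * one_coef n))).
{ apply ex_series_ext with (fun n => Rabs (q n) * Rabs (one_coef n)).
  - intros n; now rewrite Rabs_mult.
  - apply (ex_series_mult_l2 (fun n => Rabs (q n)) (fun n => Rabs (one_coef n))).
    + apply ex_series_ext with (fun n => q n ^ 2); [|exact Hq].
      intros n; now rewrite pow2_abs.
    + apply ex_series_ext with (fun n => one_coef n ^ 2); [|exact l2_one_coef].
      intros n; now rewrite pow2_abs. }
pose proof PI_RGT_0 as Hpi; pose proof sqrt_2PI_pos.
assert (Hb : 0 < ball_scale) by (apply Rdiv_lt_0_compat; lra).
(* The product of [zeta (n + 1)] and [one_coef n] grows like [n] in absolute value and
   is at least [ball_scale * PI]. *)
apply (ex_series_le (K := R_AbsRing) (V := R_CompleteNormedModule))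
  with (fun n => / (ball_scale * PI) * Rabs (q n * one_coef n)).
2:{ now apply (ex_series_scal_l (K := R_AbsRing) (/ (ball_scale * PI))
      (fun n => Rabs (q n * one_coef n))). }
intros n; change (Rabs (Rabs (shift 3 z n)) <= / (ball_scale * PI) * Rabs (q n * one_coef n)).
rewrite Rabs_Rabsolu.
assert (Hn : 1 <= INR (S n)) by (rewrite S_INR; pose proof (pos_INR n); lra).
assert (E : q n * one_coef n = (-1) ^ n * (ball_scale * PI * INR (S n) * shift 3 z n)).
{ unfold q, one_coef, id_sine_coef, zeta; field; lra. }
rewrite E, !Rabs_mult, pow_1_abs, Rmult_1_l.
rewrite (Rabs_pos_eq ball_scale), (Rabs_pos_eq PI), (Rabs_pos_eq (INR (S n))) by lra.
pose proof (Rabs_pos (shift 3 z n)).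
apply Rle_trans with (INR (S n) * Rabs (shift 3 z n)); [nra|right; field; lra].
Qed.

End Constants.

(** * The density profile of an admissible state *)

Lemma rho1_sine_series z y :
  y * rho1 z y = Series (fun n => shift 3 z n / sqrt (2 * PI) * sine n y).
Proof.
pose proof sqrt_2PI_pos as Hs; unfold rho1; rewrite <- Series_scal_l.
apply Series_ext; intros n; unfold Xi.
destruct (Req_EM_T y 0) as [->|Hy].
- rewrite sine_0; ring.
- unfold theta, shift, sine; change (2 + S n)%nat with (3 + n)%nat.
  field; split; lra.
Qed.

Lemma sine_reflect n y : sine n (2 - y) = - sine n y.
Proof.
unfold sine; replace (INR (S n) * PI * (2 - y))
  with (INR (2 * S n) * PI - INR (S n) * PI * y) by (rewrite INR_double; ring).
rewrite sin_minus, sin_nPI, cos_nPI, pow_1_even; ring.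
Qed.

Lemma is_derive_glue (f g k : R -> R) x l :
  (exists d, 0 < d /\ forall y, x - d < y <= x -> f y = g y) ->
  (exists d, 0 < d /\ forall y, x <= y < x + d -> f y = k y) ->
  is_derive g x l -> is_derive k x l -> is_derive f x l.
Proof.
intros (d1 & Hd1 & H1) (d2 & Hd2 & H2) Hg Hk.
apply is_derive_Reals in Hg; apply is_derive_Reals in Hk.
apply is_derive_of_eps; intros eps Heps.
destruct (Hg eps Heps) as [e1 G1]; destruct (Hk eps Heps) as [e2 G2].
pose proof (cond_pos e1); pose proof (cond_pos e2).
exists (Rmin (Rmin d1 d2) (Rmin e1 e2)); split.
{ repeat apply Rmin_pos; assumption. }
intros h Hh0 Hh.
pose proof (Rmin_l (Rmin d1 d2) (Rmin e1 e2)); pose proof (Rmin_r (Rmin d1 d2) (Rmin e1 e2)).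
pose proof (Rmin_l d1 d2); pose proof (Rmin_r d1 d2).
pose proof (Rmin_l e1 e2); pose proof (Rmin_r e1 e2).
pose proof (Rabs_def2 _ _ Hh) as [Hha Hhb].
destruct (Rlt_le_dec h 0).
- rewrite (H1 (x + h)), (H1 x) by lra; apply G1; lra.
- rewrite (H2 (x + h)), (H2 x) by lra; apply G2; lra.
Qed.

Definition is_profile (z : state) (g g1 g2 : R -> R) : Prop :=
  (forall y, is_derive g y (g1 y)) /\ (forall y, is_derive g1 y (g2 y)) /\
  (forall y, continuous g2 y) /\ g 1 = 0 /\
  (forall y, 0 <= y <= 1 -> rho1 z y = g y).

Lemma admissible_profile p z : admissible p z ->
  exists g g1 g2 : R -> R, is_profile z g g1 g2.
Proof.
intros (_ & (g & Hg & _ & D1 & D2 & Hc) & _).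
exists g, (Derive g), (Derive_n g 2).
split; [|split; [|split; [|split]]].
- intros y; apply Derive_correct, D1.
- intros y; apply (Derive_correct (Derive g)), D2.
- exact Hc.
- rewrite <- Hg by lra; rewrite <- (Rmult_1_l (rho1 z 1)), rho1_sine_series.
  rewrite (Series_ext _ (fun n => 0 * (shift 3 z n / sqrt (2 * PI)))).
  + now rewrite Series_scal_l, Rmult_0_l.
  + intros n; rewrite sine_1; ring.
- exact Hg.
Qed.

Section Profile.

Context (z : state) (g g1 g2 : R -> R) (Hg : is_profile z g g1 g2).

Lemma profile_series y : 0 <= y <= 1 ->
  y * g y = Series (fun n => shift 3 z n / sqrt (2 * PI) * sine n y).
Proof.
destruct Hg as (_ & _ & _ & _ & E); intros Hy; rewrite <- E by exact Hy.
apply rho1_sine_series.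
Qed.

Lemma rho1_near_interior y : 0 < y < 1 -> locally y (fun s => rho1 z s = g s).
Proof.
intros Hy; destruct Hg as (_ & _ & _ & _ & E).
apply (locally_interval _ y 0 1); simpl; try lra.
intros s H0 H1; apply E; lra.
Qed.

Lemma Derive_rho1 y : 0 < y < 1 -> Derive (rho1 z) y = g1 y.
Proof.
intros Hy; rewrite (Derive_ext_loc _ g) by now apply rho1_near_interior.
apply is_derive_unique, Hg.
Qed.

Lemma laplacian_rho1 y : 0 < y < 1 -> radial_laplacian (rho1 z) y = g2 y + 2 / y * g1 y.
Proof.
intros Hy; unfold radial_laplacian; rewrite Derive_rho1 by exact Hy; f_equal.
rewrite (Derive_n_ext_loc _ g) by now apply rho1_near_interior.
simpl; rewrite (Derive_ext (Derive (fun x => g x)) g1).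
- apply is_derive_unique, Hg.
- intros t; apply is_derive_unique, Hg.
Qed.

(** Beyond the boundary the series continues the profile by odd reflection of
    [y * g y], so the two-sided derivative at 1 is the inner one. *)
Lemma Derive_rho1_boundary : Derive (rho1 z) 1 = g1 1.
Proof.
pose proof Hg as (D1 & _ & _ & E1 & E).
apply is_derive_unique, (is_derive_glue _ g (fun y => - ((2 - y) * g (2 - y)) / y)).
- exists 1; split; [lra|]; intros y Hy; apply E; lra.
- exists 1; split; [lra|]; intros y Hy.
  rewrite profile_series by lra.
  apply Rmult_eq_reg_l with y; [|lra].
  rewrite rho1_sine_series.
  rewrite (Series_ext _ (fun n => - (shift 3 z n / sqrt (2 * PI) * sine n (2 - y)))).
  + rewrite Series_opp; field; lra.
  + intros n; rewrite sine_reflect; ring.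
- apply D1.
- auto_derive.
  + repeat split; [eexists; apply D1|lra].
  + replace (2 + - (1)) with 1 by ring; rewrite E1.
    replace (Derive (fun x : R => g x) 1) with (g1 1)
      by (symmetry; apply is_derive_unique, D1).
    field.
Qed.

End Profile.

(** * The balance laws of a solution *)

(** Pressure exerted by the two interfaces on a bubble of radius [r]. *)
Definition capillary_pressure (p : params) (r : R) : R :=
  2 * Defs.sigma p / r + 2 * sigma_bar p / bar p r.

Section Balance.

Context (p : params) (Hp : well_posed p) (z w : state)
  (Hadm : admissible p z) (Heq : w = vadd (opL p z) (nonlin p z w)).

Let b := rho_dag p + z 0%nat.
Let r := radius p z.
Let v := z 2%nat.
Let a := / gamma p.
Let lk := kappa p / (gamma p * c_v p).

Lemma boundary_density_pos : 0 < b.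
Proof.
destruct (admissible_profile p z Hadm) as (g & g1 & g2 & Hg).
destruct Hadm as (_ & _ & _ & H); specialize (H 1 ltac:(lra)).
destruct Hg as (_ & _ & _ & E1 & E).
unfold rho_pert in H; rewrite E, E1 in H by lra; unfold b; lra.
Qed.

Lemma radius_pos : 0 < r.
Proof. apply Hadm. Qed.

Lemma row n : w n = opL p z n + nonlin p z w n.
Proof. exact (f_equal (fun u : state => u n) Heq). Qed.

Lemma velocity_row : w 1%nat = v.
Proof. transitivity (v + 0); [exact (row 1%nat)|ring]. Qed.

(** The third row is the Rayleigh-Plesset equation written around the equilibrium. *)
Lemma momentum_balance :
  rho_l p * (r - r ^ 2 / bar p r) * w 2%nat
  = R_gas p * T_c p * b - capillary_pressure p r
    - 4 * mu_l p * Vbar p / (r * (r ^ 3 + Vbar p)) * v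
    - rho_l p * (3 / 2 - 2 * r / bar p r + r ^ 4 / (2 * bar p r ^ 4)) * v ^ 2.
Proof.
pose proof (R_tilde_pos p Hp) as Ht; pose proof (RT_pos p Hp) as HRT.
pose proof (proj1 (proj1 Hp)) as Hl.
pose proof radius_pos as Hr; pose proof (R_dag_pos p Hp) as Hd.
pose proof (Vbar_pos p Hp) as HV; pose proof (bar_pos p r) as Hbr.
pose proof (bar_pos p (R_dag p)) as Hbd.
assert (Erho : rho_dag p = capillary_pressure p (R_dag p) / (R_gas p * T_c p)).
{ destruct Hp as (_ & _ & (_ & _ & _ & E)); unfold capillary_pressure.
  rewrite E at 1; field; repeat split; try lra.
  - intros E0; rewrite E0, Rmult_0_r in HRT; lra.
  - intros E0; rewrite E0, Rmult_0_l in HRT; lra. }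
assert (E : w 2%nat = 1 / (rho_l p * R_tilde p)
    * (R_gas p * T_c p * z 0%nat + coefA p * z 1%nat - coefB p * v)
    - R_gas p * T_c p / (rho_l p * R_tilde p) * Psi p z w).
{ etransitivity; [exact (row 2%nat)|unfold opL, nonlin, v; ring]. }
assert (E2 : rho_l p * R_tilde p * w 2%nat
  = R_gas p * T_c p * z 0%nat + coefA p * z 1%nat - coefB p * v
    - R_gas p * T_c p * Psi p z w).
{ rewrite E at 1; field; lra. }
pose proof (pow_lt r 3 Hr); pose proof (pow_lt _ 3 Hd).
set (RT := R_gas p * T_c p) in *.
assert (E3 : RT * Psi p z w =
  4 * mu_l p * Vbar p
     * (1 / (r * (r ^ 3 + Vbar p)) - 1 / (R_dag p * (R_dag p ^ 3 + Vbar p))) * v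
  + (coefA p * z 1%nat + capillary_pressure p r - capillary_pressure p (R_dag p))
  + rho_l p * ((z 1%nat + R_dag p ^ 2 / bar p (R_dag p) - r ^ 2 / bar p r) * w 2%nat
     + (3 / 2 - 2 * r / bar p r + r ^ 4 / (2 * bar p r ^ 4)) * v ^ 2)).
{ unfold Psi; fold r; fold RT; fold v; unfold coefA, capillary_pressure.
  set (k := 1 / (r * (r ^ 3 + Vbar p)) - 1 / (R_dag p * (R_dag p ^ 3 + Vbar p))).
  set (k2 := 3 / 2 - 2 * r / bar p r + r ^ 4 / (2 * bar p r ^ 4)).
  set (k3 := z 1%nat + R_dag p ^ 2 / bar p (R_dag p) - r ^ 2 / bar p r).
  field; repeat split; lra. }
rewrite E3 in E2; clear E E3.
replace (RT * b) with (RT * z 0%nat + capillary_pressure p (R_dag p)).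
2:{ unfold b; rewrite Erho; field; lra. }
assert (Er : z 1%nat = r - R_dag p) by (unfold r, radius; ring).
unfold R_tilde, coefB in E2; rewrite Er in E2.
unfold Rdiv in E2 |- *; rewrite !Rmult_1_l in E2; lra.
Qed.

Context (g g1 g2 : R -> R) (Hg : is_profile z g g1 g2).

Lemma density_pos y : 0 <= y <= 1 -> 0 < b + g y.
Proof.
intros Hy; destruct Hadm as (_ & _ & _ & H); specialize (H y Hy).
destruct Hg as (_ & _ & _ & _ & E).
unfold rho_pert in H; rewrite E in H by exact Hy; unfold b; lra.
Qed.

Lemma summable_coefs : ex_series (fun n => Rabs (shift 3 z n)).
Proof. apply (dom_L_summable p Hp), Hadm. Qed.

Lemma moment_continuous : continuous01 (fun y => y * g y).
Proof.
apply (continuous01_mult (fun y => y)); [apply continuous01_id|].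
apply (profile_continuous g g1), Hg.
Qed.

Lemma laplacian_continuous : continuous01 (fun y => y * g2 y + 2 * g1 y).
Proof.
destruct Hg as (D1 & D2 & Hc & _).
apply (continuous01_plus (fun y => y * g2 y) (fun y => 2 * g1 y)).
- apply (continuous01_mult (fun y => y)); [apply continuous01_id|intros y _; apply Hc].
- apply (continuous01_mult (fun _ => 2)); [apply continuous01_const|].
  exact (profile1_continuous g1 g2 D2).
Qed.

Lemma laplacian_theta n :
  ball_coef (fun y => y * g2 y + 2 * g1 y) n = - zeta (S n) * shift 3 z n.
Proof.
pose proof Hg as (D1 & D2 & Hc & E1 & _).
rewrite (laplacian_coef g g1 g2 D1 D2 Hc E1).
rewrite (expansion_coef (shift 3 z) (fun y => y * g y) summable_coefs moment_continuous
  (profile_series z g g1 g2 Hg) n).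
reflexivity.
Qed.

(** The boundary flux is the sum over the eigenfunctions of the coefficients of the
    Laplacian against the constant function. *)
Lemma omega_sum :
  Series (fun n => omega p (S n) * theta z (S n))
  = - lk / (R_dag p * rho_dag p ^ 2) * g1 1.
Proof.
pose proof Hg as (D1 & D2 & Hc & E1 & _).
pose proof (R_dag_pos p Hp); pose proof (rho_dag_pos p Hp); pose proof PI_RGT_0 as Hpi.
pose proof sqrt_2PI_pos as Hs.
pose proof (one_coef_series _ laplacian_continuous) as Hser.
cbv beta in Hser; rewrite (laplacian_flux g1 g2 D2 Hc) in Hser.
assert (Hb : 0 < ball_scale) by (apply Rdiv_lt_0_compat; lra).
assert (Hk : sqrt (PI / 2) * sqrt (2 * PI) = PI).
{ rewrite <- sqrt_mult by lra; replace (PI / 2 * (2 * PI)) with (PI * PI) by field.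
  apply sqrt_square; lra. }
apply is_series_unique.
eapply is_series_eq.
- apply (is_series_scal_R (- (R_dag p * chi p / rho_dag p) * sqrt (PI / 2)
    / (ball_scale * PI)) _ _ Hser).
- intros n; cbv beta; rewrite laplacian_theta.
  unfold one_coef, id_sine_coef, zeta, omega.
  assert (0 < INR (S n)) by (apply lt_0_INR; lia).
  change (theta z (S n)) with (shift 3 z n); change ((-1) ^ S n) with (-1 * (-1) ^ n).
  field; lra.
- rewrite (chi_eq p Hp); fold lk.
  transitivity (- lk / (R_dag p * rho_dag p ^ 2) * g1 1
     * (sqrt (PI / 2) * sqrt (2 * PI)) * 4 / (ball_scale * sqrt (2 * PI))).
  + real_eq; field; repeat split; lra.
  + rewrite Hk, ball_scale_sqrt; real_eq; field; lra.
Qed.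

Lemma density_row :
  w 0%nat = lin_row1 p z + 3 * gamma p * rho_dag p / R_dag p * Phi p z w.
Proof. exact (row 0%nat). Qed.

(** The first row, freed of the reference equilibrium: the terms of [Phi] turn the
    constants of the linear row into the actual radius and boundary density. *)
Lemma kinematic_balance :
  v = - lk * g1 1 / (r * b ^ 2) - a * w 0%nat * r / (3 * b).
Proof.
pose proof (R_dag_pos p Hp); pose proof (rho_dag_pos p Hp).
pose proof (gamma_gt_1 p Hp) as Hgam.
pose proof boundary_density_pos as Hb; pose proof radius_pos as Hr.
pose proof density_row as E.
unfold lin_row1 in E; rewrite omega_sum in E; unfold Phi in E.
rewrite (Derive_rho1_boundary z g g1 g2 Hg) in E; fold lk in E; fold b in E.
fold v in E; fold r in E; unfold a.
assert (Ez0 : z 0%nat = b - rho_dag p) by (unfold b; ring).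
assert (Ez1 : z 1%nat = r - R_dag p) by (unfold r, radius; ring).
rewrite Ez0, Ez1 in E.
apply Rmult_eq_reg_l with (3 * gamma p * rho_dag p / R_dag p).
2:{ apply Rgt_not_eq, Rdiv_lt_0_compat; [repeat apply Rmult_lt_0_compat|]; lra. }
assert (Hgam0 : gamma p <> 0) by lra.
assert (Hb0 : b <> 0) by lra; assert (Hr0 : r <> 0) by lra.
assert (Hrd0 : rho_dag p <> 0) by lra; assert (Hd0 : R_dag p <> 0) by lra.
clearbody b r v lk.
set (w0 := w 0%nat) in *; set (q := g1 1) in *.
set (K := 3 * gamma p * rho_dag p / R_dag p) in *.
match type of E with w0 = K * (?S - v) + K * ?F =>
  assert (Ev : K * v = K * S + K * F - w0) by lra
end.
rewrite Ev; unfold K; field; repeat split; assumption.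
Qed.

(** The linear diffusion and its nonlinear correction add up to the quasi-linear
    operator [bulk]; the remaining term is the motion of the boundary density. *)
Lemma temperature_row n :
  shift 3 w n = ball_coef (bulk g g1 g2 b (lk / r ^ 2) (a * (w 0%nat / b))) n
                - (1 - a) * w 0%nat * one_coef n.
Proof.
pose proof Hg as (D1 & D2 & Hc & E1 & E).
pose proof (R_dag_pos p Hp); pose proof (rho_dag_pos p Hp).
pose proof (gamma_gt_1 p Hp) as Hgam; pose proof sqrt_2PI_pos as Hs.
pose proof boundary_density_pos as Hb; pose proof radius_pos as Hr.
assert (Hpos := density_pos).
set (bk := bulk g g1 g2 b (lk / r ^ 2) (a * (w 0%nat / b))).
assert (Hbk : continuous01 bk) by now apply bulk_continuous.
assert (Hsine := continuous01_sine n).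
assert (Hlap := laplacian_continuous).
assert (EPi : Pi_coef p z w (S n) = ball_coef bk n
   - chi p * ball_coef (fun y => y * g2 y + 2 * g1 y) n).
{ unfold Pi_coef, ball_coef.
  rewrite (RInt_ext01 _ (fun y => ball_scale * (bk y * sine n y)
     - ball_scale * chi p * ((y * g2 y + 2 * g1 y) * sine n y))).
  - rewrite RInt_minus01, !RInt_scal01; try ring;
      try (apply (continuous01_mult (fun _ => _)); [apply continuous01_const|]);
      now apply continuous01_mult.
  - intros y Hy; specialize (Hpos y ltac:(lra)).
    unfold Pi_fun, rho_pert.
    rewrite (laplacian_rho1 z g g1 g2 Hg), (Derive_rho1 z g g1 g2 Hg), E by lra.
    fold lk; fold r; fold b; rewrite (chi_eq p Hp); fold lk.
    unfold Xi; destruct (Req_EM_T y 0) as [->|Hy0]; [lra|].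
    fold (sine n y).
    replace (rho_dag p + (g y + z 0%nat)) with (b + g y) by (unfold b; ring).
    unfold ball_scale, bk, bulk, a.
    field; repeat split; lra. }
rewrite laplacian_theta in EPi.
etransitivity; [exact (row (3 + n)%nat)|simpl].
change (z (S (S (S n)))) with (shift 3 z n); unfold theta.
change (z (2 + S n)%nat) with (shift 3 z n).
rewrite EPi, (xi_eq p Hp); fold a; rewrite density_row; ring.
Qed.

(** Tested with the constants, diffusion contributes only the boundary flux, which
    [kinematic_balance] expresses by [v] and [w 0]. It follows that the mean of
    [b + g] changes at a rate proportional to [v], without any [w 0]. *)
Lemma mean_density_balance :
  pairing one_coef (shift 3 w) = - 4 * PI * b * v / r - 4 * PI / 3 * w 0%nat.
Proof.
pose proof Hg as (D1 & D2 & Hc & E1 & E).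
pose proof (gamma_gt_1 p Hp) as Hgam.
pose proof boundary_density_pos as Hb; pose proof radius_pos as Hr.
assert (Hpos := density_pos).
set (k0 := lk / r ^ 2); set (k1 := a * (w 0%nat / b)).
pose proof (one_coef_series _ (bulk_continuous g g1 g2 b k0 k1 D1 D2 Hc Hpos)) as H1.
rewrite (bulk_flux g g1 g2 b k0 k1 D1 D2 Hc E1 Hpos) in H1.
pose proof (is_series_scal_R (- (1 - a) * w 0%nat) _ _ one_coef_sq_series) as H2.
pose proof (is_series_plus (K := R_AbsRing) (V := R_NormedModule) _ _ _ _ H1 H2) as H3.
assert (Ep : pairing one_coef (shift 3 w)
  = 4 * PI * (k0 * g1 1 / b) + - (1 - a) * w 0%nat * (4 * PI / 3)).
{ apply is_series_unique; eapply is_series_ext; [|exact H3].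
  intros n; cbv beta; rewrite temperature_row; fold k0 k1.
  unfold plus; simpl; real_eq; ring. }
rewrite Ep; unfold k0.
assert (Eg : lk * g1 1 = - r * b ^ 2 * v - a * w 0%nat * r ^ 2 * b / 3).
{ rewrite kinematic_balance at 1; field; lra. }
transitivity (4 * PI * (lk * g1 1) / (r ^ 2 * b) + - (1 - a) * w 0%nat * (4 * PI / 3));
  [field; lra|rewrite Eg; field; lra].
Qed.

(** Testing with the profile itself; the inequality discards the dissipation. *)
Lemma temperature_energy_balance :
  pairing (shift 3 z) (shift 3 w)
  <= a * (w 0%nat / b) / 2 * sqsum (shift 3 z)
     - (1 - a) * w 0%nat * pairing one_coef (shift 3 z).
Proof.
pose proof Hg as (D1 & D2 & Hc & E1 & E).
pose proof (gamma_gt_1 p Hp) as Hgam; pose proof PI_RGT_0 as Hpi.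
pose proof boundary_density_pos as Hb; pose proof radius_pos as Hr.
assert (Hz : l2 (shift 3 z)) by (apply l2_shift; apply Hadm).
assert (Hpos := density_pos).
set (k0 := lk / r ^ 2); set (k1 := a * (w 0%nat / b)).
pose proof (expansion_weak (shift 3 z) (fun y => y * g y) summable_coefs
  moment_continuous (profile_series z g g1 g2 Hg)
  _ (bulk_continuous g g1 g2 b k0 k1 D1 D2 Hc Hpos)) as H1.
assert (Hk0 : 0 <= k0).
{ apply Rlt_le, Rdiv_lt_0_compat; [apply (diffusivity_pos p Hp)|now apply pow_lt]. }
pose proof (bulk_energy g g1 g2 b k0 k1 D1 D2 Hc E1 Hpos Hk0) as Hen.
pose proof (is_series_unique _ _ (expansion_sq (shift 3 z) (fun y => y * g y)
  summable_coefs moment_continuous (profile_series z g g1 g2 Hg))) as Hsq.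
fold (sqsum (shift 3 z)) in Hsq.
pose proof (is_series_scal_R (- (1 - a) * w 0%nat) _ _
  (Series_correct _ (ex_series_mult_l2 _ _ l2_one_coef Hz))) as H2.
pose proof (is_series_plus (K := R_AbsRing) (V := R_NormedModule) _ _ _ _ H1 H2) as H3.
set (J := RInt (fun y => bulk g g1 g2 b k0 k1 y * (y * g y)) 0 1) in *.
assert (Ep : pairing (shift 3 z) (shift 3 w)
  = 4 * PI * J + - (1 - a) * w 0%nat * pairing one_coef (shift 3 z)).
{ apply is_series_unique; eapply is_series_ext; [|exact H3].
  intros n; cbv beta; rewrite temperature_row; fold k0 k1.
  unfold plus; simpl; real_eq; ring. }
rewrite Ep, Hsq.
set (I := RInt (fun y => y * g y * (y * g y)) 0 1) in *.
assert (4 * PI * J <= 4 * PI * (k1 / 2 * I)) by (apply Rmult_le_compat_l; lra).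
lra.
Qed.

End Balance.

(** * A differential inequality with a strict equilibrium *)

Lemma nonincreasing_of_derive (f : R -> R) s t : s < t ->
  (forall x, s <= x <= t -> exists d : R, is_derive f x d /\ d <= 0) -> f t <= f s.
Proof.
intros Hst H.
destruct (MVT_gen f s t (Derive f)) as (c & Hc & E).
- rewrite Rmin_left, Rmax_right by lra; intros x Hx.
  destruct (H x) as (d & Hd & _); [lra|].
  apply Derive_correct; eexists; eauto.
- rewrite Rmin_left, Rmax_right by lra; intros x Hx.
  destruct (H x Hx) as (d & Hd & _).
  apply continuity_pt_filterlim; exact (continuous_of_derive f x d Hd).
- rewrite Rmin_left, Rmax_right in Hc by lra.
  destruct (H c Hc) as (d & Hd & Hle); rewrite (is_derive_unique _ _ _ Hd) in E; nra.
Qed.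

Lemma right_lim_ext f g t l : (forall s, f s = g s) -> right_lim f t l -> right_lim g t l.
Proof. intros E; apply filterlim_ext; exact E. Qed.

Lemma right_lim_const c t : right_lim (fun _ => c) t c.
Proof. apply filterlim_const. Qed.

Lemma right_lim_plus f g t l m : right_lim f t l -> right_lim g t m ->
  right_lim (fun s => f s + g s) t (l + m).
Proof.
intros Hf Hg; eapply filterlim_comp_2; [exact Hf|exact Hg|].
apply (filterlim_plus (V := R_NormedModule)).
Qed.

Lemma right_lim_mult f g t l m : right_lim f t l -> right_lim g t m ->
  right_lim (fun s => f s * g s) t (l * m).
Proof.
intros Hf Hg; eapply filterlim_comp_2; [exact Hf|exact Hg|].
apply (filterlim_mult (K := R_AbsRing)).
Qed.

Lemma right_lim_comp (h f : R -> R) t l : continuous h l -> right_lim f t l ->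
  right_lim (fun s => h (f s)) t (h l).
Proof. intros Hh Hf; exact (filterlim_comp _ _ _ f h _ _ _ Hf Hh). Qed.

Lemma right_lim_eq f t l m : right_lim f t l -> l = m -> right_lim f t m.
Proof. now intros H <-. Qed.

Lemma gronwall_zero (Q : R -> R) C t0 t1 : right_lim Q t0 0 ->
  (forall t, t0 < t < t1 -> exists d : R, is_derive Q t d /\ d <= C * Q t) ->
  forall t, t0 < t < t1 -> Q t <= 0.
Proof.
intros Hlim HQ t Ht.
destruct (Rle_lt_dec (Q t) 0) as [|Hpos]; [assumption|exfalso].
set (W := fun s => Q s * exp (- C * s)).
assert (HW : right_lim W t0 0).
{ apply right_lim_eq with (0 * exp (- C * t0)); [|ring].
  apply right_lim_mult; [exact Hlim|].
  apply (right_lim_comp (fun s => exp (- C * s)) (fun s => s)).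
  - continuous_by_derive; auto.
  - intros P HP; destruct HP as [e He]; exists e; intros y Hy _; now apply He. }
assert (HWt : 0 < W t) by (apply Rmult_lt_0_compat; [assumption|apply exp_pos]).
destruct (proj1 (right_lim_eps W t0 0) HW (W t) HWt) as (d & Hd & Hs).
pose proof (Rmin_l (t0 + d) t); pose proof (Rmin_r (t0 + d) t).
assert (t0 < Rmin (t0 + d) t) by (apply Rmin_glb_lt; lra).
set (s := (t0 + Rmin (t0 + d) t) / 2).
assert (Hst : t0 < s < t /\ s < t0 + d) by (unfold s; lra).
specialize (Hs s ltac:(lra)); rewrite Rminus_0_r in Hs; apply Rabs_def2 in Hs.
assert (W t <= W s); [|lra].
apply nonincreasing_of_derive; [lra|]; intros x Hx.
destruct (HQ x ltac:(lra)) as (q & Hq & Hle).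
exists (q * exp (- C * x) + Q x * (- C * exp (- C * x))); split.
- apply (is_derive_mult_R Q (fun y => exp (- C * y))); [exact Hq|].
  auto_derive; auto; ring.
- pose proof (exp_pos (- C * x)); nra.
Qed.

(** Bernoulli's inequality for exponents below 1, from [ln u <= u - 1] at the two
    points [x / m] and [1 / m], where [m] is the right-hand side. *)
Lemma Rpower_bernoulli x c : 0 < x -> 0 < c < 1 -> Rpower x c <= 1 + c * (x - 1).
Proof.
intros Hx Hc.
assert (Hm : 0 < 1 + c * (x - 1)) by nra.
set (m := 1 + c * (x - 1)) in *.
assert (Hln : forall u, 0 < u -> ln u <= u - 1).
{ intros u Hu; pose proof (exp_ineq1_le (ln u)) as H; rewrite exp_ln in H; lra. }
assert (H1 : ln x - ln m <= x / m - 1).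
{ rewrite <- ln_div by assumption; apply Hln; now apply Rdiv_lt_0_compat. }
assert (H2 : - ln m <= / m - 1).
{ rewrite <- ln_Rinv by assumption; apply Hln; now apply Rinv_0_lt_compat. }
assert (E : c * (x / m) + (1 - c) * / m = 1) by (unfold m in *; field; lra).
unfold Rpower; rewrite <- (exp_ln m) by assumption.
assert (c * ln x <= ln m) by nra.
destruct (Rle_lt_or_eq_dec _ _ H) as [Hlt| ->]; [left; now apply exp_increasing|right; reflexivity].
Qed.

Lemma Rpower_bernoulli_diff b e c : 0 < b -> 0 < e -> 0 < c < 1 ->
  Rpower b c - Rpower e c <= c * Rpower e (c - 1) * (b - e).
Proof.
intros Hb He Hc.
assert (E : Rpower b c = Rpower e c * Rpower (b / e) c).
{ rewrite Rpower_mult_distr; auto; [f_equal; field; lra|now apply Rdiv_lt_0_compat]. }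
pose proof (Rpower_bernoulli (b / e) c (Rdiv_lt_0_compat _ _ Hb He) Hc).
assert (E2 : Rpower e c = e * Rpower e (c - 1)).
{ rewrite <- (Rpower_1 e) at 2 by assumption; rewrite <- Rpower_plus; f_equal; ring. }
assert (Hp : 0 < Rpower e (c - 1)) by apply exp_pos.
rewrite E, E2.
apply Rle_trans with (e * Rpower e (c - 1) * (1 + c * (b / e - 1)) - e * Rpower e (c - 1)).
- apply Rplus_le_compat_r, Rmult_le_compat_l; [nra|assumption].
- right; field; lra.
Qed.

Section Stability.

Context (a : R) (Ha : 0 < a < 1).

Definition ball_volume : R := 4 * PI / 3.

(** The free energy, relative to the uniform state of the same mean density [e], of
    a state with boundary density [b] whose profile has squared norm [S].  The weight
    [Rpower b (- a)] is the integrating factor of the equation for [S], and the other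
    terms integrate the coupling of [b'] with the mean of the profile; thus its time
    derivative does not contain [b'], over which there is no control. *)
Definition free_energy (S b e : R) : R :=
  Rpower b (- a) * S / 2
  + ball_volume * (e * Rpower b (1 - a) - (1 - a) / (2 - a) * Rpower b (2 - a)
                   - Rpower e (2 - a) / (2 - a)).

Lemma Rpower_split x c : 0 < x -> Rpower x (1 + c) = x * Rpower x c.
Proof. intros Hx; rewrite Rpower_plus, Rpower_1; auto. Qed.

Lemma ball_volume_pos : 0 < ball_volume.
Proof. unfold ball_volume; pose proof PI_RGT_0; lra. Qed.

Lemma Rpower_1_minus x : 0 < x -> Rpower x (1 - a) = x * Rpower x (- a).
Proof. intros Hx; rewrite <- Rpower_split by assumption; f_equal; ring. Qed.

Lemma Rpower_2_minus x : 0 < x -> Rpower x (2 - a) = x ^ 2 * Rpower x (- a).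
Proof.
intros Hx; replace (2 - a) with (1 + (1 + - a)) by ring.
rewrite !Rpower_split by assumption; ring.
Qed.

(** The bound is Bernoulli's inequality for the exponent [a]. *)
Lemma free_energy_coercive S b e : 0 < b -> 0 < e ->
  Rpower b (- a) * ((S - ball_volume * (e - b) ^ 2) / 2
     + ball_volume * (a / (2 * (2 - a))) * (b - e) ^ 2) <= free_energy S b e.
Proof.
intros Hb He; unfold free_energy.
rewrite (Rpower_1_minus b Hb), (Rpower_2_minus b Hb).
assert (Hbeta : 0 < Rpower b (- a)) by apply exp_pos.
assert (E : Rpower e (2 - a) <= Rpower b (- a) * ((1 - a) * e ^ 2 + a * b * e)).
{ rewrite (Rpower_2_minus e He).
  assert (E1 : Rpower e (- a) = Rpower b (- a) * Rpower (b / e) a).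
  { unfold Rpower; rewrite ln_div, <- exp_plus by assumption; f_equal; ring. }
  rewrite E1.
  pose proof (Rpower_bernoulli (b / e) a (Rdiv_lt_0_compat _ _ Hb He) Ha) as H.
  replace (Rpower b (- a) * ((1 - a) * e ^ 2 + a * b * e))
    with (e ^ 2 * (Rpower b (- a) * (1 + a * (b / e - 1)))) by (field; lra).
  apply Rmult_le_compat_l; [apply pow2_ge_0|].
  apply Rmult_le_compat_l; lra. }
set (be := Rpower b (- a)) in *; set (ee := Rpower e (2 - a)) in *.
pose proof ball_volume_pos as Hk; set (k := ball_volume) in *.
assert (E3 : ee / (2 - a) <= be * ((1 - a) * e ^ 2 + a * b * e) / (2 - a)).
{ apply Rmult_le_compat_r; [|exact E]; apply Rlt_le, Rinv_0_lt_compat; lra. }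
apply Rmult_le_compat_l with (r := k) in E3; [|lra].
match goal with |- ?l <= _ =>
  replace l with (be * S / 2 + k * (e * (b * be) - (1 - a) / (2 - a) * (b ^ 2 * be))
    - k * (be * ((1 - a) * e ^ 2 + a * b * e) / (2 - a))) by (field; lra)
end.
lra.
Qed.

Lemma free_energy_rest b : 0 < b -> free_energy 0 b b = 0.
Proof.
intros Hb; unfold free_energy; rewrite Rpower_1_minus, Rpower_2_minus by assumption.
field; lra.
Qed.

(** The terms with [b'] cancel; what is left is the motion of the mean density. *)
Lemma free_energy_derive (S b e : R -> R) (t S' b' e' : R) : 0 < b t -> 0 < e t ->
  is_derive S t S' -> is_derive b t b' -> is_derive e t e' ->
  S' <= a * (b' / b t) * S t - 2 * (1 - a) * b' * (ball_volume * (e t - b t)) ->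
  exists d : R, is_derive (fun s => free_energy (S s) (b s) (e s)) t d /\
    d <= ball_volume * e' * (Rpower (b t) (1 - a) - Rpower (e t) (1 - a)).
Proof.
intros Hb He DS Db De HS.
assert (DP : forall (f : R -> R) f' c, 0 < f t -> is_derive f t f' ->
  is_derive (fun s => Rpower (f s) c) t (c * (f' / f t) * Rpower (f t) c)).
{ intros f f' c Hf Df; unfold Rpower; auto_derive.
  - split; [eexists; exact Df|split; [exact Hf|exact I]].
  - replace (Derive (fun x : R => f x) t) with f'
      by (symmetry; apply is_derive_unique, Df).
    field; lra. }
pose proof (DP b b' (- a) Hb Db) as P1.
pose proof (DP b b' (1 - a) Hb Db) as P2.
pose proof (DP b b' (2 - a) Hb Db) as P3.
pose proof (DP e e' (2 - a) He De) as P4.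
pose proof (is_derive_mult_R _ _ _ _ _ P1 DS) as M1.
pose proof (is_derive_mult_R _ _ _ _ _ De P2) as M2.
set (k := ball_volume) in *; set (l := (1 - a) / (2 - a)).
assert (D : is_derive (fun s => free_energy (S s) (b s) (e s)) t
  ((- a * (b' / b t) * Rpower (b t) (- a) * S t + Rpower (b t) (- a) * S') * / 2
   + k * ((e' * Rpower (b t) (1 - a)
           + e t * ((1 - a) * (b' / b t) * Rpower (b t) (1 - a)))
          - l * ((2 - a) * (b' / b t) * Rpower (b t) (2 - a))
          - (2 - a) * (e' / e t) * Rpower (e t) (2 - a) * / (2 - a)))).
{ unfold free_energy; fold k l.
  apply (is_derive_plus (V := R_NormedModule)).
  - apply is_derive_ext with (fun s => / 2 * (Rpower (b s) (- a) * S s)).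
    + intros s; real_eq; field.
    + rewrite Rmult_comm; now apply is_derive_scal.
  - apply is_derive_scal.
    apply (is_derive_minus (V := R_NormedModule)).
    + apply (is_derive_minus (V := R_NormedModule)); [exact M2|].
      now apply is_derive_scal.
    + apply is_derive_ext with (fun s => / (2 - a) * Rpower (e s) (2 - a)).
      * intros s; real_eq; field; lra.
      * rewrite Rmult_comm; now apply is_derive_scal. }
eexists; split; [exact D|].
assert (Hbeta : 0 < Rpower (b t) (- a)) by apply exp_pos.
rewrite (Rpower_2_minus (e t)), (Rpower_1_minus (e t)), (Rpower_2_minus (b t)),
  (Rpower_1_minus (b t)) by assumption.
set (be := Rpower (b t) (- a)) in *; set (ee := Rpower (e t) (- a)).
apply Rmult_le_compat_l with (r := be / 2) in HS; [|lra].
match goal with |- ?x <= ?y =>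
  replace x with (be / 2 * S' - be / 2 * (a * (b' / b t) * S t
      - 2 * (1 - a) * b' * (k * (e t - b t))) + y) by (unfold l; field; lra)
end.
lra.
Qed.

Lemma Rpower_neg_le x y : 0 < x -> x <= y -> Rpower y (- a) <= Rpower x (- a).
Proof.
intros Hx Hxy; unfold Rpower.
assert (H : ln x <= ln y) by (apply ln_le; assumption).
assert (H2 : - a * ln y <= - a * ln x) by nra.
destruct (Rle_lt_or_eq_dec _ _ H2) as [Hlt| ->]; [left; now apply exp_increasing|lra].
Qed.

Lemma Rpower_diff_bound m b e : 0 < m -> m <= b -> m <= e ->
  Rabs (Rpower b (1 - a) - Rpower e (1 - a)) <= Rpower m (- a) * Rabs (b - e).
Proof.
intros Hm Hb He.
assert (Hc : 0 < 1 - a < 1) by lra.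
pose proof (Rpower_bernoulli_diff b e (1 - a) ltac:(lra) ltac:(lra) Hc) as H1.
pose proof (Rpower_bernoulli_diff e b (1 - a) ltac:(lra) ltac:(lra) Hc) as H2.
replace (1 - a - 1) with (- a) in H1, H2 by ring.
pose proof (Rpower_neg_le m b Hm Hb) as Nb; pose proof (Rpower_neg_le m e Hm He) as Ne.
assert (P1 : 0 < Rpower b (- a)) by apply exp_pos.
assert (P2 : 0 < Rpower e (- a)) by apply exp_pos.
set (pm := Rpower m (- a)) in *; set (pb := Rpower b (- a)) in *.
set (pe := Rpower e (- a)) in *.
assert (Q1 : 0 <= (1 - a) * pe <= pm) by nra.
assert (Q2 : 0 <= (1 - a) * pb <= pm) by nra.
pose proof (Rle_abs (b - e)) as A1; pose proof (Rle_abs (e - b)) as A2.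
rewrite (Rabs_minus_sym e b) in A2; pose proof (Rabs_pos (b - e)).
apply Rabs_le; split; nra.
Qed.

Lemma young_bounds x1 x2 x3 x4 : let Y := x1 ^ 2 + x2 ^ 2 + x3 ^ 2 + x4 ^ 2 in
  x4 * x1 <= Y /\ x2 * x4 <= Y /\ x3 * x4 <= Y /\ x4 * (x1 + x2 + x3 + x4) <= 4 * Y.
Proof.
pose proof (pow2_ge_0 x1); pose proof (pow2_ge_0 x2); pose proof (pow2_ge_0 x3);
pose proof (pow2_ge_0 x4).
pose proof (pow2_ge_0 (x4 - x1)); pose proof (pow2_ge_0 (x4 - x2));
pose proof (pow2_ge_0 (x4 - x3)).
intros Y; unfold Y; repeat split; lra.
Qed.

(** Added to the free energy, the squared deviations of [e], [r] and [v] give a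
    function [Q] that dominates the squared distance to the equilibrium and satisfies
    [Q' <= C Q] near it. The unbounded quantity [b'] does not enter the estimate. *)
Lemma lyapunov_local_uniqueness (rs Rs K eta t0 t1 : R) (b r v S e : R -> R) :
  0 < rs -> 0 < Rs -> 0 <= K -> 0 < eta -> t0 < t1 ->
  right_lim b t0 rs -> right_lim r t0 Rs -> right_lim v t0 0 ->
  right_lim S t0 0 -> right_lim e t0 rs ->
  (forall t, t0 < t < t1 -> exists b' v' S' : R,
     is_derive b t b' /\ is_derive r t (v t) /\ is_derive v t v' /\
     is_derive e t (- 3 * b t * v t / r t) /\ is_derive S t S' /\
     S' <= a * (b' / b t) * S t - 2 * (1 - a) * b' * (ball_volume * (e t - b t)) /\
     ball_volume * (e t - b t) ^ 2 <= S t /\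
     (Rabs (b t - rs) < eta -> Rabs (r t - Rs) < eta -> Rabs (v t) < eta ->
      Rabs v' <= K * (Rabs (b t - rs) + Rabs (r t - Rs) + Rabs (v t)))) ->
  exists delta, 0 < delta /\ forall t, t0 < t < t0 + delta -> t < t1 ->
    b t = rs /\ r t = Rs /\ v t = 0 /\ S t = 0.
Proof.
intros Hrs HRs HK Heta Ht01 Lb Lr Lv LS Le Hode.
pose proof ball_volume_pos as Hk; set (k := ball_volume) in *.
set (eta' := Rmin eta (Rmin (rs / 2) (Rs / 2))).
assert (Heta' : 0 < eta') by (unfold eta'; repeat apply Rmin_pos; lra).
assert (Hmin : eta' <= eta /\ eta' <= rs / 2 /\ eta' <= Rs / 2).
{ unfold eta'; pose proof (Rmin_l eta (Rmin (rs / 2) (Rs / 2)));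
  pose proof (Rmin_r eta (Rmin (rs / 2) (Rs / 2)));
  pose proof (Rmin_l (rs / 2) (Rs / 2)); pose proof (Rmin_r (rs / 2) (Rs / 2)); lra. }
destruct (proj1 (right_lim_eps _ _ _) Lb eta' Heta') as (d1 & Hd1 & B1).
destruct (proj1 (right_lim_eps _ _ _) Lr eta' Heta') as (d2 & Hd2 & B2).
destruct (proj1 (right_lim_eps _ _ _) Lv eta' Heta') as (d3 & Hd3 & B3).
destruct (proj1 (right_lim_eps _ _ _) Le eta' Heta') as (d4 & Hd4 & B4).
set (delta := Rmin (Rmin d1 d2) (Rmin d3 d4)).
assert (Hdelta : 0 < delta) by (unfold delta; repeat apply Rmin_pos; assumption).
assert (Hdmin : delta <= d1 /\ delta <= d2 /\ delta <= d3 /\ delta <= d4).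
{ unfold delta.
  pose proof (Rmin_l (Rmin d1 d2) (Rmin d3 d4)); pose proof (Rmin_r (Rmin d1 d2) (Rmin d3 d4)).
  pose proof (Rmin_l d1 d2); pose proof (Rmin_r d1 d2);
  pose proof (Rmin_l d3 d4); pose proof (Rmin_r d3 d4); lra. }
set (Q := fun t => free_energy (S t) (b t) (e t) + (e t - rs) ^ 2 + (r t - Rs) ^ 2 + v t ^ 2).
set (c0 := k * (a / (2 * (2 - a)))).
assert (Hc0 : 0 < c0).
{ apply Rmult_lt_0_compat; [assumption|apply Rdiv_lt_0_compat; lra]. }
set (be0 := Rpower (2 * rs) (- a)).
assert (Hbe0 : 0 < be0) by apply exp_pos.
set (pm := Rpower (rs / 2) (- a)).
assert (Hpm : 0 < pm) by apply exp_pos.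
set (E := 12 * rs / Rs).
assert (HE : 0 < E) by (apply Rdiv_lt_0_compat; lra).
set (c1 := Rmin 1 (be0 * c0)).
assert (Hc1 : 0 < c1) by (unfold c1; apply Rmin_pos; [lra|now apply Rmult_lt_0_compat]).
assert (Hc1' : c1 <= 1 /\ c1 <= be0 * c0) by (split; [apply Rmin_l|apply Rmin_r]).
set (C0 := k * E * pm + 2 * E + 2 + 8 * K).
assert (HkEp : 0 < k * E * pm) by now apply Rmult_lt_0_compat; [apply Rmult_lt_0_compat|].
assert (Hclose : forall t, t0 < t < t0 + delta ->
  Rabs (b t - rs) < eta' /\ Rabs (r t - Rs) < eta' /\ Rabs (v t) < eta' /\
  Rabs (e t - rs) < eta').
{ intros t Ht; repeat split; [apply B1|apply B2|rewrite <- (Rminus_0_r (v t)); apply B3|apply B4];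
    lra. }
assert (Hlow : forall t, t0 < t < t0 + delta -> t < t1 ->
  Rpower (b t) (- a) * ((S t - k * (e t - b t) ^ 2) / 2)
  + c1 * ((b t - e t) ^ 2 + (e t - rs) ^ 2 + (r t - Rs) ^ 2 + v t ^ 2) <= Q t).
{ intros t Ht Htt.
  destruct (Hclose t Ht) as (Cb & Cr & Cv & Ce).
  apply Rabs_def2 in Cb; apply Rabs_def2 in Ce.
  pose proof (free_energy_coercive (S t) (b t) (e t) ltac:(lra) ltac:(lra)) as Hc.
  fold k in Hc; fold c0 in Hc.
  assert (Hbe : be0 <= Rpower (b t) (- a)) by (apply Rpower_neg_le; lra).
  set (be := Rpower (b t) (- a)) in *.
  assert (c1 * (b t - e t) ^ 2 <= be * (c0 * (b t - e t) ^ 2)).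
  { rewrite <- Rmult_assoc; apply Rmult_le_compat_r; [apply pow2_ge_0|].
    apply Rle_trans with (be0 * c0); [lra|apply Rmult_le_compat_r; lra]. }
  assert (Hx : forall x, c1 * x ^ 2 <= x ^ 2) by (intros x; pose proof (pow2_ge_0 x); nra).
  pose proof (Hx (e t - rs)); pose proof (Hx (r t - Rs)); pose proof (Hx (v t)).
  unfold Q; lra. }
assert (HQ : forall t, t0 < t < Rmin t1 (t0 + delta) -> Q t <= 0).
{ apply (gronwall_zero Q (C0 / c1)).
  - unfold Q.
    apply right_lim_eq with (free_energy 0 rs rs + (rs - rs) ^ 2 + (Rs - Rs) ^ 2 + 0 ^ 2).
    2:{ rewrite free_energy_rest by assumption; ring. }
    assert (sq : forall f l, right_lim f t0 l -> right_lim (fun s => f s ^ 2) t0 (l ^ 2)).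
    { intros f l Hf; apply (right_lim_comp (fun x => x ^ 2)); [|exact Hf].
      continuous_by_derive; auto. }
    assert (sub : forall f l c, right_lim f t0 l -> right_lim (fun s => f s - c) t0 (l - c)).
    { intros f l c Hf; apply right_lim_plus; [exact Hf|apply right_lim_const]. }
    assert (pw : forall f l c, 0 < l -> right_lim f t0 l ->
      right_lim (fun s => Rpower (f s) c) t0 (Rpower l c)).
    { intros f l c Hl Hf; apply (right_lim_comp (fun x => Rpower x c)); [|exact Hf].
      unfold Rpower; continuous_by_derive; exact Hl. }
    apply right_lim_plus; [apply right_lim_plus; [apply right_lim_plus|]|].
    + unfold free_energy; apply right_lim_plus.
      * apply right_lim_mult; [|apply right_lim_const].
        apply right_lim_mult; [now apply pw|exact LS].
      * apply right_lim_mult; [apply right_lim_const|].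
        unfold Rminus at 1; unfold Rminus at 4.
        apply right_lim_ext with (fun s => e s * Rpower (b s) (1 - a)
          + - ((1 - a) / (2 - a)) * Rpower (b s) (2 - a)
          + Rpower (e s) (2 - a) * - / (2 - a)).
        { intros s; field; lra. }
        apply right_lim_eq with (rs * Rpower rs (1 - a)
          + - ((1 - a) / (2 - a)) * Rpower rs (2 - a)
          + Rpower rs (2 - a) * - / (2 - a)); [|field; lra].
        apply right_lim_plus; [apply right_lim_plus|];
          apply right_lim_mult; auto; apply right_lim_const.
    + now apply sq, sub.
    + now apply sq, sub.
    + now apply sq.
  - intros t Ht.
    pose proof (Rmin_l t1 (t0 + delta)); pose proof (Rmin_r t1 (t0 + delta)).
    destruct (Hode t ltac:(lra)) as (b' & v' & S' & Db & Dr & Dv & De & DS & HS & HSb & Hv').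
    destruct (Hclose t ltac:(lra)) as (Cb & Cr & Cv & Ce).
    specialize (Hv' ltac:(lra) ltac:(lra) ltac:(lra)).
    pose proof (Hlow t ltac:(lra) ltac:(lra)) as Hl.
    pose proof (Rabs_def2 _ _ Cb); pose proof (Rabs_def2 _ _ Cr);
    pose proof (Rabs_def2 _ _ Ce).
    set (e' := - 3 * b t * v t / r t) in *.
    assert (He' : Rabs e' <= E * Rabs (v t)).
    { unfold e', Rdiv; rewrite !Rabs_mult, (Rabs_left (-3)), (Rabs_pos_eq (b t)) by lra.
      rewrite (Rabs_pos_eq (/ r t)) by (apply Rlt_le, Rinv_0_lt_compat; lra).
      replace (- -3 * b t * Rabs (v t) * / r t)
        with ((3 * b t * / r t) * Rabs (v t)) by ring.
      apply Rmult_le_compat_r; [apply Rabs_pos|].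
      unfold E; apply Rmult_le_reg_r with (r t); [lra|].
      rewrite Rmult_assoc, Rinv_l, Rmult_1_r by lra.
      apply Rle_trans with (12 * rs / Rs * (Rs / 2)).
      - replace (12 * rs / Rs * (Rs / 2)) with (6 * rs) by (field; lra); lra.
      - apply Rmult_le_compat_l; [fold E; lra|lra]. }
    destruct (free_energy_derive S b e t S' b' e' ltac:(lra) ltac:(lra) DS Db De HS)
      as (d & Dd & Hd); fold k in Hd.
    pose proof (Rpower_diff_bound (rs / 2) (b t) (e t) ltac:(lra) ltac:(lra) ltac:(lra))
      as Hpow; fold pm in Hpow.
    exists (d + 2 * (e t - rs) * e' + 2 * (r t - Rs) * v t + 2 * v t * v'); split.
    + assert (sq : forall (f : R -> R) l c, is_derive f t l ->
        is_derive (fun s => (f s - c) ^ 2) t (2 * (f t - c) * l)).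
      { intros f l c Df; auto_derive; [repeat split; eexists; exact Df|].
        replace (Derive (fun x : R => f x) t) with l
          by (symmetry; apply is_derive_unique, Df).
        ring. }
      unfold Q; apply (is_derive_plus (V := R_NormedModule));
        [apply (is_derive_plus (V := R_NormedModule));
          [apply (is_derive_plus (V := R_NormedModule))|]|].
      * exact Dd.
      * now apply sq.
      * now apply sq.
      * apply is_derive_ext with (fun s => (v s - 0) ^ 2); [intros; real_eq; ring|].
        replace (2 * v t * v') with (2 * (v t - 0) * v') by ring; now apply sq.
    + assert (Hbe : 0 < Rpower (b t) (- a)) by apply exp_pos.
      assert (HSn : 0 <= Rpower (b t) (- a) * ((S t - k * (e t - b t) ^ 2) / 2)).
      { apply Rmult_le_pos; lra. }
      set (X := (b t - e t) ^ 2 + (e t - rs) ^ 2 + (r t - Rs) ^ 2 + v t ^ 2) in *.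
      assert (HCX : C0 * X <= C0 / c1 * Q t).
      { replace (C0 * X) with (C0 / c1 * (c1 * X)) by (field; lra).
        apply Rmult_le_compat_l; [|lra].
        apply Rlt_le, Rdiv_lt_0_compat; unfold C0; lra. }
      eapply Rle_trans; [|exact HCX].
      assert (Hbrs : Rabs (b t - rs) <= Rabs (b t - e t) + Rabs (e t - rs)).
      { replace (b t - rs) with ((b t - e t) + (e t - rs)) by ring; apply Rabs_triang. }
      assert (T1 : k * e' * (Rpower (b t) (1 - a) - Rpower (e t) (1 - a))
        <= k * E * pm * (Rabs (v t) * Rabs (b t - e t))).
      { eapply Rle_trans; [apply Rle_abs|].
        rewrite !Rabs_mult, (Rabs_pos_eq k) by lra.
        replace (k * E * pm * (Rabs (v t) * Rabs (b t - e t)))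
          with (k * (E * Rabs (v t)) * (pm * Rabs (b t - e t))) by ring.
        apply Rmult_le_compat.
        - apply Rmult_le_pos; [lra|apply Rabs_pos].
        - apply Rabs_pos.
        - apply Rmult_le_compat_l; lra.
        - exact Hpow. }
      assert (T2 : 2 * (e t - rs) * e' <= 2 * E * (Rabs (e t - rs) * Rabs (v t))).
      { eapply Rle_trans; [apply Rle_abs|].
        rewrite !Rabs_mult, (Rabs_pos_eq 2) by lra; pose proof (Rabs_pos (e t - rs)).
        nra. }
      assert (T3 : 2 * (r t - Rs) * v t <= 2 * (Rabs (r t - Rs) * Rabs (v t))).
      { eapply Rle_trans; [apply Rle_abs|].
        rewrite !Rabs_mult, (Rabs_pos_eq 2) by lra; lra. }
      assert (T4 : 2 * v t * v' <= 2 * K * (Rabs (v t) * (Rabs (b t - e t)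
        + Rabs (e t - rs) + Rabs (r t - Rs) + Rabs (v t)))).
      { eapply Rle_trans; [apply Rle_abs|].
        rewrite !Rabs_mult, (Rabs_pos_eq 2) by lra.
        replace (2 * K * (Rabs (v t) * (Rabs (b t - e t)
          + Rabs (e t - rs) + Rabs (r t - Rs) + Rabs (v t))))
          with (2 * Rabs (v t) * (K * (Rabs (b t - e t)
          + Rabs (e t - rs) + Rabs (r t - Rs) + Rabs (v t)))) by ring.
        apply Rmult_le_compat_l; [pose proof (Rabs_pos (v t)); lra|].
        eapply Rle_trans; [exact Hv'|apply Rmult_le_compat_l; lra]. }
      assert (HX : X = Rabs (b t - e t) ^ 2 + Rabs (e t - rs) ^ 2
        + Rabs (r t - Rs) ^ 2 + Rabs (v t) ^ 2) by (unfold X; now rewrite !pow2_abs).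
      revert T1 T2 T3 T4; rewrite HX.
      generalize (Rabs_pos (b t - e t)) (Rabs_pos (e t - rs))
        (Rabs_pos (r t - Rs)) (Rabs_pos (v t)).
      generalize (Rabs (b t - e t)) (Rabs (e t - rs)) (Rabs (r t - Rs)) (Rabs (v t)).
      intros x1 x2 x3 x4 P1 P2 P3 P4 T1 T2 T3 T4.
      destruct (young_bounds x1 x2 x3 x4) as (V1 & V2 & V3 & V4).
      set (Y := x1 ^ 2 + x2 ^ 2 + x3 ^ 2 + x4 ^ 2) in *.
      apply Rmult_le_compat_l with (r := k * E * pm) in V1; [|lra].
      apply Rmult_le_compat_l with (r := 2 * E) in V2; [|lra].
      apply Rmult_le_compat_l with (r := 2 * K) in V4; [|lra].
      unfold C0; lra. }
exists delta; split; [exact Hdelta|]; intros t Ht Htt.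
assert (HQt : Q t <= 0) by (apply HQ; split; [lra|apply Rmin_glb_lt; lra]).
pose proof (Hlow t Ht Htt) as Hl.
destruct (Hode t ltac:(lra)) as (b' & v' & S' & _ & _ & _ & _ & _ & _ & HSb & _).
assert (Hbe : 0 < Rpower (b t) (- a)) by apply exp_pos.
set (be := Rpower (b t) (- a)) in *.
assert (HSn : 0 <= be * ((S t - k * (e t - b t) ^ 2) / 2)) by (apply Rmult_le_pos; lra).
set (x1 := b t - e t) in *; set (x2 := e t - rs) in *; set (x3 := r t - Rs) in *.
pose proof (pow2_ge_0 x1); pose proof (pow2_ge_0 x2); pose proof (pow2_ge_0 x3);
pose proof (pow2_ge_0 (v t)).
assert (HX : 0 <= c1 * (x1 ^ 2 + x2 ^ 2 + x3 ^ 2 + v t ^ 2)) by (apply Rmult_le_pos; lra).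
assert (HX0 : x1 ^ 2 + x2 ^ 2 + x3 ^ 2 + v t ^ 2 = 0).
{ apply Rmult_eq_reg_l with c1; lra. }
assert (Z : forall x, x ^ 2 = 0 -> x = 0).
{ intros x Hx; apply Rsqr_0_uniq; unfold Rsqr; nra. }
assert (Z1 : x1 = 0) by (apply Z; lra); assert (Z2 : x2 = 0) by (apply Z; lra).
assert (Z3 : x3 = 0) by (apply Z; lra); assert (Z4 : v t = 0) by (apply Z; lra).
unfold x1, x2, x3 in *.
split; [lra|split; [lra|split; [exact Z4|]]].
assert (HS0 : be * ((S t - k * (e t - b t) ^ 2) / 2) = 0) by lra.
apply Rmult_integral in HS0; destruct HS0 as [|HS0]; [lra|].
replace (e t - b t) with 0 in HS0 by lra; lra.
Qed.

End Stability.

(** * Solutions that start at an equilibrium *)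

Lemma locally_bounded (f : R -> R) x : continuous f x ->
  exists eta, 0 < eta /\ forall y, Rabs (y - x) < eta -> Rabs (f y - f x) < 1.
Proof.
intros Hf.
destruct (Hf (fun u => Rabs (u - f x) < 1)) as [d Hd].
{ exists (mkposreal 1 Rlt_0_1); intros u Hu; exact Hu. }
exists d; split; [apply cond_pos|]; intros y Hy; now apply Hd.
Qed.

Lemma locally_lipschitz (f : R -> R) x l : is_derive f x l ->
  exists eta, 0 < eta /\ forall y, Rabs (y - x) < eta ->
    Rabs (f y - f x) <= (Rabs l + 1) * Rabs (y - x).
Proof.
intros Hf; apply is_derive_Reals in Hf; destruct (Hf 1 Rlt_0_1) as [d Hd].
exists d; split; [apply cond_pos|]; intros y Hy.
destruct (Req_dec y x) as [->|Hne].
- rewrite !Rminus_diag, Rabs_R0; lra.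
- specialize (Hd (y - x) ltac:(lra) Hy).
  replace (x + (y - x)) with y in Hd by ring.
  set (q := (f y - f x) / (y - x)) in *.
  assert (E : f y - f x = q * (y - x)) by (unfold q; field; lra).
  rewrite E, Rabs_mult; apply Rmult_le_compat_r; [apply Rabs_pos|].
  replace q with ((q - l) + l) by ring.
  pose proof (Rabs_triang (q - l) l); lra.
Qed.

Section Equilibria.

Context (p : params) (Hp : well_posed p).

Lemma bar_derive r : 0 < r -> is_derive (bar p) r (r ^ 2 / bar p r ^ 2).
Proof.
intros Hr; pose proof (Vbar_pos p Hp); pose proof (pow_lt r 3 Hr).
pose proof (bar_cube p Hp r Hr) as E; pose proof (bar_pos p r).
replace (r ^ 2 / bar p r ^ 2) with (r ^ 2 * bar p r / (r ^ 3 + Vbar p))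
  by (rewrite <- E; field; lra).
unfold bar, cbrt, Rpower; auto_derive; [simpl in *; lra|].
change (exp (1 / 3 * ln (r ^ 3 + Vbar p))) with (bar p r).
replace (r * (r * (r * 1))) with (r ^ 3) by ring.
change (exp (1 / 3 * ln (r ^ 3 + Vbar p))) with (bar p r).
field; simpl in *; lra.
Qed.

Definition capillary_slope (r : R) : R :=
  - (2 * Defs.sigma p / r ^ 2 + 2 * sigma_bar p * r ^ 2 / bar p r ^ 4).

Lemma capillary_derive r : 0 < r -> is_derive (capillary_pressure p) r (capillary_slope r).
Proof.
intros Hr; pose proof (bar_derive r Hr) as D; pose proof (bar_pos p r).
unfold capillary_pressure; auto_derive.
- repeat split; [lra|eexists; exact D|lra].
- replace (Derive (fun x : R => bar p x) r) with (r ^ 2 / bar p r ^ 2)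
    by (symmetry; apply is_derive_unique, D).
  unfold capillary_slope; field; lra.
Qed.

Lemma coefA_slope : coefA p = - capillary_slope (R_dag p).
Proof. unfold coefA, capillary_slope; ring. Qed.

(** Where gas and capillary pressures balance, the acceleration is at most
    proportional to the distance from the equilibrium. *)
Lemma acceleration_bound rs Rs : 0 < Rs -> R_gas p * T_c p * rs = capillary_pressure p Rs ->
  exists K eta, 0 <= K /\ 0 < eta /\ forall b r v w2,
    rho_l p * (r - r ^ 2 / bar p r) * w2 = R_gas p * T_c p * b - capillary_pressure p r
      - 4 * mu_l p * Vbar p / (r * (r ^ 3 + Vbar p)) * v
      - rho_l p * (3 / 2 - 2 * r / bar p r + r ^ 4 / (2 * bar p r ^ 4)) * v ^ 2 ->
    Rabs (b - rs) < eta -> Rabs (r - Rs) < eta -> Rabs v < eta ->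
    Rabs w2 <= K * (Rabs (b - rs) + Rabs (r - Rs) + Rabs v).
Proof.
intros HRs Hbal.
pose proof (bar_derive Rs HRs) as Db; pose proof (bar_pos p Rs) as Hbp.
pose proof (Vbar_pos p Hp) as HV; pose proof (pow_lt Rs 3 HRs) as HR3.
pose proof (RT_pos p Hp) as HRT; pose proof (proj1 (proj1 Hp)) as Hl.
pose proof (shell_pos p Hp Rs HRs) as Hsh.
set (sh := fun r => r - r ^ 2 / bar p r).
set (cf := fun r => 4 * mu_l p * Vbar p / (r * (r ^ 3 + Vbar p))).
set (df := fun r => 3 / 2 - 2 * r / bar p r + r ^ 4 / (2 * bar p r ^ 4)).
change (0 < sh Rs) in Hsh.
assert (Hcf : Rs * (Rs ^ 3 + Vbar p) <> 0).
{ apply Rgt_not_eq, Rmult_lt_0_compat; lra. }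
assert (Csh : continuous (fun r => 2 / sh Rs * sh r) Rs).
{ unfold sh; continuous_by_derive; repeat split; [eexists; exact Db|lra]. }
assert (Ccf : continuous cf Rs).
{ unfold cf; continuous_by_derive; simpl in *; repeat split; lra. }
assert (Cdf : continuous df Rs).
{ unfold df; continuous_by_derive; repeat split; try (eexists; exact Db); try lra.
  apply Rgt_not_eq; repeat apply Rmult_lt_0_compat; lra. }
destruct (locally_bounded _ _ Csh) as (e1 & He1 & B1).
destruct (locally_bounded _ _ Ccf) as (e2 & He2 & B2).
destruct (locally_bounded _ _ Cdf) as (e3 & He3 & B3).
destruct (locally_lipschitz _ _ _ (capillary_derive Rs HRs)) as (e4 & He4 & B4).
set (LP := Rabs (capillary_slope Rs) + 1) in *.
set (Mc := Rabs (cf Rs) + 1); set (Md := Rabs (df Rs) + 1).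
assert (HLP : 0 < LP) by (unfold LP; pose proof (Rabs_pos (capillary_slope Rs)); lra).
assert (HMc : 0 < Mc) by (unfold Mc; pose proof (Rabs_pos (cf Rs)); lra).
assert (HMd : 0 < Md) by (unfold Md; pose proof (Rabs_pos (df Rs)); lra).
set (RT := R_gas p * T_c p) in *; set (rl := rho_l p) in *.
set (Ks := RT + LP + Mc + rl * Md).
assert (HlM : 0 < rl * Md) by now apply Rmult_lt_0_compat.
assert (Hls : 0 < rl * (sh Rs / 2)) by (apply Rmult_lt_0_compat; lra).
exists (Ks / (rl * (sh Rs / 2))), (Rmin (Rmin 1 e1) (Rmin (Rmin e2 e3) e4)).
split; [|split].
- apply Rlt_le, Rdiv_lt_0_compat; [unfold Ks; lra|exact Hls].
- repeat apply Rmin_pos; lra.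
- intros b r v w2 Heq Hb Hr Hv.
  set (eta := Rmin (Rmin 1 e1) (Rmin (Rmin e2 e3) e4)) in *.
  assert (Heta : eta <= 1 /\ eta <= e1 /\ eta <= e2 /\ eta <= e3 /\ eta <= e4).
  { unfold eta.
    pose proof (Rmin_l (Rmin 1 e1) (Rmin (Rmin e2 e3) e4));
    pose proof (Rmin_r (Rmin 1 e1) (Rmin (Rmin e2 e3) e4));
    pose proof (Rmin_l 1 e1); pose proof (Rmin_r 1 e1);
    pose proof (Rmin_l (Rmin e2 e3) e4); pose proof (Rmin_r (Rmin e2 e3) e4);
    pose proof (Rmin_l e2 e3); pose proof (Rmin_r e2 e3); lra. }
  specialize (B1 r ltac:(lra)); specialize (B2 r ltac:(lra)).
  specialize (B3 r ltac:(lra)); specialize (B4 r ltac:(lra)).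
  fold (sh r) in Heq; fold (cf r) in Heq; fold (df r) in Heq.
  assert (Hsr : sh Rs / 2 <= sh r).
  { apply Rabs_def2 in B1; destruct B1 as [_ B1].
    replace (2 / sh Rs * sh Rs) with 2 in B1 by (field; lra).
    apply Rmult_le_reg_l with (2 / sh Rs); [apply Rdiv_lt_0_compat; lra|].
    replace (2 / sh Rs * (sh Rs / 2)) with 1 by (field; lra); lra. }
  assert (Hcr : Rabs (cf r) <= Mc).
  { unfold Mc; replace (cf r) with ((cf r - cf Rs) + cf Rs) by ring.
    pose proof (Rabs_triang (cf r - cf Rs) (cf Rs)); lra. }
  assert (Hdr : Rabs (df r) <= Md).
  { unfold Md; replace (df r) with ((df r - df Rs) + df Rs) by ring.
    pose proof (Rabs_triang (df r - df Rs) (df Rs)); lra. }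
  assert (Hnum : rl * sh r * w2 = RT * (b - rs)
     + - (capillary_pressure p r - capillary_pressure p Rs)
     + - (cf r * v) + - (rl * df r * v ^ 2)) by (rewrite Heq, <- Hbal; ring).
  assert (Habs : rl * sh r * Rabs w2 <= RT * Rabs (b - rs) + LP * Rabs (r - Rs)
     + Mc * Rabs v + rl * Md * Rabs v).
  { replace (rl * sh r * Rabs w2) with (Rabs (rl * sh r * w2)).
    2:{ rewrite Rabs_mult, (Rabs_pos_eq (rl * sh r)); [reflexivity|].
        apply Rmult_le_pos; lra. }
    rewrite Hnum.
    eapply Rle_trans; [apply Rabs_triang|]; apply Rplus_le_compat.
    - eapply Rle_trans; [apply Rabs_triang|]; apply Rplus_le_compat.
      + eapply Rle_trans; [apply Rabs_triang|]; apply Rplus_le_compat.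
        * rewrite Rabs_mult, (Rabs_pos_eq RT) by lra; lra.
        * rewrite Rabs_Ropp; exact B4.
      + rewrite Rabs_Ropp, Rabs_mult; apply Rmult_le_compat_r; [apply Rabs_pos|exact Hcr].
    - rewrite Rabs_Ropp, !Rabs_mult, (Rabs_pos_eq rl), <- RPow_abs by lra.
      rewrite !Rmult_assoc; apply Rmult_le_compat_l; [lra|].
      apply Rmult_le_compat; try apply Rabs_pos; [apply pow2_ge_0|exact Hdr|].
      pose proof (Rabs_pos v); simpl; nra. }
  pose proof (Rabs_pos (b - rs)) as P1; pose proof (Rabs_pos (r - Rs)) as P2;
  pose proof (Rabs_pos v) as P3; pose proof (Rabs_pos w2) as P4.
  apply Rmult_le_reg_l with (rl * (sh Rs / 2)); [exact Hls|].
  replace (rl * (sh Rs / 2) * (Ks / (rl * (sh Rs / 2))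
      * (Rabs (b - rs) + Rabs (r - Rs) + Rabs v)))
    with (Ks * (Rabs (b - rs) + Rabs (r - Rs) + Rabs v)) by (field; lra).
  apply Rle_trans with (rl * sh r * Rabs w2).
  { apply Rmult_le_compat_r; [exact P4|]; apply Rmult_le_compat_l; lra. }
  eapply Rle_trans; [exact Habs|]; unfold Ks.
  assert (Hle : forall k x, 0 < k -> 0 <= x -> 0 <= k * x) by (intros; apply Rmult_le_pos; lra).
  pose proof (Hle RT _ HRT P2); pose proof (Hle RT _ HRT P3).
  pose proof (Hle LP _ HLP P1); pose proof (Hle LP _ HLP P3).
  pose proof (Hle Mc _ HMc P1); pose proof (Hle Mc _ HMc P2).
  pose proof (Hle _ _ HlM P1); pose proof (Hle _ _ HlM P2).
  lra.
Qed.

End Equilibria.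

(** Extends local uniqueness, which covers a short time only, to the whole interval
    of existence. *)
Lemma real_induction (P : R -> Prop) (T : Rbar) :
  P 0 ->
  (forall t, 0 <= t -> Rbar_lt t T -> P t ->
     exists d, 0 < d /\ forall s, t < s < t + d -> Rbar_lt s T -> P s) ->
  (forall t, 0 < t -> Rbar_lt t T -> (forall s, 0 <= s < t -> P s) -> P t) ->
  forall t, 0 <= t -> Rbar_lt t T -> P t.
Proof.
intros H0 Hstep Hlim t Ht HtT.
set (E := fun s => 0 <= s <= t /\ forall u, 0 <= u <= s -> P u).
assert (HT : forall s, s <= t -> Rbar_lt s T).
{ intros s Hs; apply (Rbar_le_lt_trans _ t); assumption. }
destruct (completeness E) as [m [Hub Hlub]].
- exists t; intros s [Hs _]; lra.
- exists 0; split; [lra|]; intros u Hu; replace u with 0 by lra; exact H0.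
- assert (Hm0 : 0 <= m).
  { apply Hub; split; [lra|]; intros u Hu; replace u with 0 by lra; exact H0. }
  assert (Hmt : m <= t) by (apply Hlub; intros s [Hs _]; lra).
  assert (Hlow : forall u, 0 <= u < m -> P u).
  { intros u Hu; destruct (classic (exists s, E s /\ u < s)) as [(s & [Hs HP] & Hus)|Hno].
    - apply HP; lra.
    - exfalso; apply (Rlt_irrefl m), Rle_lt_trans with u; [|lra].
      apply Hlub; intros s Hs; apply Rnot_lt_le; intros Hlt; apply Hno; eauto. }
  assert (HPm : P m).
  { destruct (Rle_lt_or_eq_dec _ _ Hm0) as [Hpos|<-]; [|exact H0].
    apply Hlim; auto. }
  destruct (Rle_lt_or_eq_dec _ _ Hmt) as [Hlt|<-]; [|exact HPm].
  exfalso; destruct (Hstep m Hm0 (HT m Hmt) HPm) as (d & Hd & Hs).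
  set (s := Rmin (m + d / 2) t).
  assert (Hsm : m < s) by (unfold s; apply Rmin_glb_lt; lra).
  assert (Hs2 : s <= m + d / 2 /\ s <= t) by (split; [apply Rmin_l|apply Rmin_r]).
  apply (Rlt_not_le _ _ Hsm), Hub; split; [lra|]; intros u Hu.
  destruct (Rtotal_order u m) as [Hum|[->|Hum]]; [apply Hlow; lra|exact HPm|].
  apply Hs; [lra|apply HT; lra].
Qed.

Lemma derive_limit_constant (f : R -> R) t l c : 0 < t -> is_derive f t l ->
  (forall s, 0 <= s < t -> f s = c) -> f t = c.
Proof.
intros Ht Hf Hc.
destruct (Req_dec (f t) c) as [|Hne]; [assumption|exfalso].
assert (Hcont : continuous f t) by exact (continuous_of_derive f t l Hf).
destruct (Hcont (fun u => Rabs (u - f t) < Rabs (c - f t))) as [d Hd].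
{ assert (Hpos : 0 < Rabs (c - f t)) by (apply Rabs_pos_lt; lra).
  exists (mkposreal _ Hpos); intros u Hu; exact Hu. }
pose proof (cond_pos d).
set (s := Rmax 0 (t - d / 2)).
assert (Hs : 0 <= s < t /\ t - d / 2 <= s).
{ unfold s; split; [split; [apply Rmax_l|apply Rmax_lub_lt; lra]|apply Rmax_r]. }
assert (B : ball t d s) by (change (Rabs (s - t) < d); apply Rabs_def1; lra).
specialize (Hd s B); rewrite (Hc s (proj1 Hs)) in Hd; lra.
Qed.

(** The right limit at [t0] serves as the initial value, because solutions are
    differentiable at positive times only. *)
Lemma zero_derive_constant (f : R -> R) t0 t1 l : right_lim f t0 l ->
  (forall t, t0 < t < t1 -> is_derive f t 0) -> forall t, t0 < t < t1 -> f t = l.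
Proof.
intros Hl Hf t Ht; apply Rle_antisym; apply Rminus_le.
- apply (gronwall_zero (fun s => f s - l) 0 t0 t1); [| |exact Ht].
  + apply right_lim_eq with (l + - l); [|ring].
    apply right_lim_plus; [exact Hl|apply right_lim_const].
  + intros s Hs; exists 0; split; [|lra].
    replace 0 with (0 - 0) by ring.
    apply (is_derive_minus (V := R_NormedModule)); [now apply Hf|].
    apply (is_derive_const (K := R_AbsRing) (V := R_NormedModule)).
- apply (gronwall_zero (fun s => l - f s) 0 t0 t1); [| |exact Ht].
  + apply right_lim_eq with (l + -1 * l); [|ring].
    apply right_lim_ext with (fun s => l + -1 * f s); [intros; ring|].
    apply right_lim_plus; [apply right_lim_const|].
    apply right_lim_mult; [apply right_lim_const|exact Hl].
  + intros s Hs; exists 0; split; [|lra].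
    replace 0 with (0 - 0) by ring.
    apply (is_derive_minus (V := R_NormedModule)); [|now apply Hf].
    apply (is_derive_const (K := R_AbsRing) (V := R_NormedModule)).
Qed.

Lemma is_l2_derive_right_continuous f t d : is_l2_derive f t d ->
  right_lim (fun s => l2norm (vsub (f s) (f t))) t 0.
Proof.
intros Hf; apply right_lim_eps; intros eps Heps.
destruct (is_l2_derive_eps f t d Hf 1 Rlt_0_1) as (d1 & Hd1 & H1).
assert (Ht := is_l2_derive_l2 _ _ _ Hf); assert (Hd := proj1 Hf).
pose proof (l2norm_nonneg d) as Hn.
exists (Rmin d1 (eps / (1 + l2norm d))); split.
{ apply Rmin_pos; [assumption|apply Rdiv_lt_0_compat; lra]. }
intros s Hs; pose proof (Rmin_l d1 (eps / (1 + l2norm d)));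
pose proof (Rmin_r d1 (eps / (1 + l2norm d))).
set (h := s - t); assert (Hh : 0 < h) by (unfold h; lra).
destruct (H1 h ltac:(lra)) as [Hl Hq].
{ rewrite Rabs_pos_eq; unfold h; lra. }
replace (t + h) with s in * by (unfold h; ring).
set (q := vsub (vscal (/ h) (vsub (f s) (f t))) d) in *.
assert (Hq2 : l2 q) by (apply l2_sub; auto; apply l2_scal, l2_sub; auto).
replace (vsub (f s) (f t)) with (vscal h (vadd q d)).
2:{ apply functional_extensionality; intros n; unfold q, vscal, vadd, vsub; field; lra. }
assert (E : l2norm (vscal h (vadd q d)) = h * l2norm (vadd q d)).
{ apply Rsqr_inj; [apply l2norm_nonneg|apply Rmult_le_pos; [lra|apply l2norm_nonneg]|].
  rewrite !Rsqr_pow2, Rpow_mult_distr, !l2norm_sq, sqsum_scal;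
    auto using l2_scal, l2_add. }
rewrite E, Rminus_0_r, Rabs_pos_eq
  by (apply Rmult_le_pos; [lra|apply l2norm_nonneg]).
pose proof (l2norm_triangle q d Hq2 Hd).
apply Rle_lt_trans with (h * (1 + l2norm d)).
- apply Rmult_le_compat_l; lra.
- apply Rmult_lt_reg_r with (/ (1 + l2norm d)); [apply Rinv_0_lt_compat; lra|].
  rewrite Rmult_assoc, Rinv_r by lra; fold (eps / (1 + l2norm d)); unfold h; lra.
Qed.

Lemma Rbar_lt_between (t : R) (T : Rbar) : Rbar_lt t T ->
  exists t1, t < t1 /\ forall s : R, s < t1 -> Rbar_lt s T.
Proof.
destruct T as [T| |]; simpl; intros H.
- exists T; auto.
- exists (t + 1); split; [lra|auto].
- contradiction.
Qed.

(** A uniform bubble: density [rs], radius [Rs], no motion. *)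
Definition uniform_state (p : params) (rs Rs : R) : state := fun n =>
  match n with
  | 0%nat => rs - rho_dag p
  | 1%nat => Rs - R_dag p
  | _ => 0
  end.

Lemma uniform_state_two p rs Rs n : (2 <= n)%nat -> uniform_state p rs Rs n = 0.
Proof. intros Hn; destruct n as [|[|n]]; [lia|lia|reflexivity]. Qed.

Section Uniqueness.

Context (p : params) (Hp : well_posed p) (rs Rs : R) (Hrs : 0 < rs) (HRs : 0 < Rs)
  (Hbal : R_gas p * T_c p * rs = capillary_pressure p Rs).

Let zs := uniform_state p rs Rs.

Lemma l2_zs : l2 zs.
Proof. apply l2_two, uniform_state_two. Qed.

Context (T : Rbar) (z : R -> state)
  (Hz : forall t, 0 < t -> Rbar_lt t T -> exists w,
     is_l2_derive z t w /\ admissible p (z t) /\ w = vadd (opL p (z t)) (nonlin p (z t) w)).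

(** The balance laws verify the hypotheses of [lyapunov_local_uniqueness], with [e]
    the mean density; [ball_volume * (e - b) ^ 2 <= S] is the Cauchy-Schwarz inequality
    against the constants. *)
Lemma equilibrium_short_time_uniqueness t0 : 0 <= t0 -> Rbar_lt t0 T ->
  right_lim (fun s => l2norm (vsub (z s) zs)) t0 0 ->
  exists d, 0 < d /\ forall s, t0 < s < t0 + d -> Rbar_lt s T -> z s = zs.
Proof.
intros Ht0 HT Hlim.
destruct (Rbar_lt_between t0 T HT) as (t1 & Ht1 & HtT).
destruct (acceleration_bound p Hp rs Rs HRs Hbal) as (K & eta & HK & Heta & Hacc).
pose proof (gamma_gt_1 p Hp) as Hgam; pose proof PI_RGT_0 as Hpi.
set (a := / gamma p).
assert (Ha : 0 < a < 1).
{ unfold a; split; [apply Rinv_0_lt_compat; lra|].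
  rewrite <- Rinv_1; apply Rinv_lt_contravar; lra. }
assert (Hl2 : forall s, t0 < s < t1 -> l2 (z s)).
{ intros s Hs; destruct (Hz s ltac:(lra) (HtT s ltac:(lra))) as (w & Hw & _).
  exact (is_l2_derive_l2 _ _ _ Hw). }
assert (Hloc : exists d, 0 < d /\ forall s, t0 < s < t0 + d -> l2 (z s)).
{ exists (t1 - t0); split; [lra|]; intros s Hs; apply Hl2; lra. }
assert (Hzero : shift 3 zs = vzero) by reflexivity.
assert (Hlim3 : right_lim (fun s => l2norm (vsub (shift 3 (z s)) (shift 3 zs))) t0 0).
{ apply right_lim_eps; intros eps Heps.
  destruct (proj1 (right_lim_eps _ _ _) Hlim eps Heps) as (d & Hd & Hs).
  exists (Rmin d (t1 - t0)); split; [apply Rmin_pos; lra|]; intros s Hts.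
  pose proof (Rmin_l d (t1 - t0)); pose proof (Rmin_r d (t1 - t0)).
  specialize (Hs s ltac:(lra)); rewrite Rminus_0_r, Rabs_pos_eq in * by apply l2norm_nonneg.
  eapply Rle_lt_trans; [|exact Hs].
  apply (l2norm_shift (vsub (z s) zs)), l2_sub; [apply Hl2; lra|apply l2_zs]. }
set (b := fun s => rho_dag p + z s 0%nat).
set (mean := fun s => pairing one_coef (shift 3 (z s))).
destruct (lyapunov_local_uniqueness a Ha rs Rs K eta t0 t1 b
  (fun s => radius p (z s)) (fun s => z s 2%nat) (fun s => sqsum (shift 3 (z s)))
  (fun s => b s + 3 / (4 * PI) * mean s)) as (d & Hd & Hconc); auto.
- apply right_lim_eq with (rho_dag p + zs 0%nat); [|unfold zs, uniform_state; ring].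
  apply right_lim_plus; [apply right_lim_const|].
  now apply right_lim_entry; [apply l2_zs| |].
- apply right_lim_eq with (R_dag p + zs 1%nat); [|unfold zs, uniform_state; ring].
  apply right_lim_plus; [apply right_lim_const|].
  now apply right_lim_entry; [apply l2_zs| |].
- change 0 with (zs 2%nat); now apply right_lim_entry; [apply l2_zs| |].
- apply right_lim_eps; intros eps Heps.
  rewrite Hzero in Hlim3.
  destruct (proj1 (right_lim_eps _ _ _) (right_lim_mult _ _ _ _ _ Hlim3 Hlim3) eps Heps)
    as (d & Hd & Hs).
  exists (Rmin d (t1 - t0)); split; [apply Rmin_pos; lra|]; intros s Hts.
  pose proof (Rmin_l d (t1 - t0)); pose proof (Rmin_r d (t1 - t0)).
  specialize (Hs s ltac:(lra)).
  replace (vsub (shift 3 (z s)) vzero) with (shift 3 (z s)) in Hs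
    by (apply functional_extensionality; intros n; unfold vsub, vzero; ring).
  rewrite <- l2norm_sq by (apply l2_shift, Hl2; lra).
  rewrite Rmult_0_r in Hs; replace (l2norm (shift 3 (z s)) ^ 2)
    with (l2norm (shift 3 (z s)) * l2norm (shift 3 (z s))) by ring; exact Hs.
- apply right_lim_eq with (rs + 3 / (4 * PI) * pairing one_coef (shift 3 zs)).
  + apply right_lim_plus.
    * apply right_lim_eq with (rho_dag p + zs 0%nat); [|unfold zs, uniform_state; ring].
      apply right_lim_plus; [apply right_lim_const|].
      now apply right_lim_entry; [apply l2_zs| |].
    * apply right_lim_mult; [apply right_lim_const|].
      apply right_lim_pairing; [apply l2_one_coef|apply l2_shift, l2_zs| |exact Hlim3].
      exists (t1 - t0); split; [lra|]; intros s Hs; apply l2_shift, Hl2; lra.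
  + rewrite Hzero; unfold pairing, vzero.
    rewrite (is_series_unique _ 0); [ring|apply is_series_zero; intros; ring].
- intros t Ht.
  destruct (Hz t ltac:(lra) (HtT t ltac:(lra))) as (w & Dw & Hadm & Hw).
  assert (Hwl : l2 w) by apply Dw.
  destruct (admissible_profile p (z t) Hadm) as (g & g1 & g2 & Hg).
  pose proof (boundary_density_pos p (z t) Hadm) as Hb; fold (b t) in Hb.
  pose proof (radius_pos p (z t) Hadm) as Hr.
  assert (Hzl : l2 (shift 3 (z t))) by (apply l2_shift, Hl2; lra).
  exists (w 0%nat), (w 2%nat), (2 * pairing (shift 3 (z t)) (shift 3 w)).
  assert (Db : is_derive b t (w 0%nat)).
  { unfold b; replace (w 0%nat) with (0 + w 0%nat) by ring.
    apply (is_derive_plus (V := R_NormedModule)); [|now apply is_derive_entry].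
    apply (is_derive_const (K := R_AbsRing) (V := R_NormedModule)). }
  split; [exact Db|split; [|split; [now apply is_derive_entry|split; [|split; [|split; [|split]]]]]].
  + rewrite <- (velocity_row p (z t) w Hw).
    unfold radius; replace (w 1%nat) with (0 + w 1%nat) by ring.
    apply (is_derive_plus (V := R_NormedModule)); [|now apply is_derive_entry].
    apply (is_derive_const (K := R_AbsRing) (V := R_NormedModule)).
  + pose proof (mean_density_balance p Hp (z t) w Hadm Hw g g1 g2 Hg) as Hm.
    replace (-3 * b t * z t 2%nat / radius p (z t))
      with (w 0%nat + 3 / (4 * PI) * pairing one_coef (shift 3 w))
      by (rewrite Hm; fold (b t); field; lra).
    apply (is_derive_plus (V := R_NormedModule)); [exact Db|].
    apply is_derive_scal; unfold mean.
    apply (is_derive_pairing one_coef (fun s => shift 3 (z s)) t (shift 3 w));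
      [apply l2_one_coef|now apply is_l2_derive_shift].
  + apply (is_derive_sqsum (fun s => shift 3 (z s)) t (shift 3 w)).
    now apply is_l2_derive_shift.
  + pose proof (temperature_energy_balance p Hp (z t) w Hadm Hw g g1 g2 Hg) as He.
    fold a in He; fold (b t) in He; fold (mean t) in He.
    replace (ball_volume * (b t + 3 / (4 * PI) * mean t - b t)) with (mean t)
      by (unfold ball_volume; field; lra).
    lra.
  + pose proof (cauchy_schwarz one_coef (shift 3 (z t)) l2_one_coef Hzl) as Hcs.
    rewrite sqsum_one_coef in Hcs; fold (mean t) in Hcs.
    apply Rmult_le_reg_l with (4 * PI / 3); [lra|].
    eapply Rle_trans; [|exact Hcs]; right; unfold ball_volume; field; lra.
  + intros B1 B2 B3.
    apply (Hacc (b t) (radius p (z t)) (z t 2%nat) (w 2%nat)); auto.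
    exact (momentum_balance p Hp (z t) w Hadm Hw).
- exists (Rmin d (t1 - t0)); split; [apply Rmin_pos; lra|]; intros s Hs HsT.
  pose proof (Rmin_l d (t1 - t0)); pose proof (Rmin_r d (t1 - t0)).
  destruct (Hconc s ltac:(lra) ltac:(lra)) as (E0 & E1 & E2 & E3).
  apply functional_extensionality; intros [|[|[|n]]]; unfold zs, uniform_state.
  + unfold b in E0; lra.
  + unfold radius in E1; lra.
  + exact E2.
  + pose proof (sqsum_entry (shift 3 (z s)) n ltac:(apply l2_shift, Hl2; lra)) as Hen.
    cbv beta in E3; rewrite E3 in Hen; change (shift 3 (z s) n) with (z s (S (S (S n)))) in Hen.
    apply Rsqr_0_uniq; unfold Rsqr; nra.
Qed.

Lemma equilibrium_uniqueness : z 0 = zs ->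
  right_lim (fun s => l2norm (vsub (z s) zs)) 0 0 ->
  forall t, 0 <= t -> Rbar_lt t T -> z t = zs.
Proof.
intros H0 Hlim0; apply (real_induction (fun t => z t = zs)); [exact H0| |].
- intros t Ht HT Hzt; apply equilibrium_short_time_uniqueness; auto.
  destruct (Rle_lt_or_eq_dec _ _ Ht) as [Hpos|<-]; [|exact Hlim0].
  destruct (Hz t Hpos HT) as (w & Hw & _).
  rewrite <- Hzt; exact (is_l2_derive_right_continuous _ _ _ Hw).
- intros t Ht HT Hbefore; destruct (Hz t Ht HT) as (w & Hw & _).
  apply functional_extensionality; intros n.
  apply (derive_limit_constant (fun s => z s n) t (w n)); auto.
  + now apply is_derive_entry.
  + intros s Hs; now rewrite Hbefore.
Qed.

End Uniqueness.

(** * The curve of equilibria *)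

Lemma Series_zero (u : nat -> R) : (forall n, u n = 0) -> Series u = 0.
Proof. intros Hu; now apply is_series_unique, is_series_zero. Qed.

Section Curve.

Context (p : params) (Hp : well_posed p) (Rhat : R -> R)
  (HRpos : forall a, 0 < Rhat a)
  (HRC1 : forall a, ex_derive Rhat a /\ continuous (Derive Rhat) a)
  (HR0 : Rhat 0 = R_dag p).

Let h := hcurve p Rhat.

Lemma rhohat_eq a : rhohat p Rhat a = / (R_gas p * T_c p) * capillary_pressure p (Rhat a).
Proof. unfold rhohat, capillary_pressure, bar; unfold Rdiv; rewrite Rmult_1_l; reflexivity. Qed.

Lemma rhohat_balance a : R_gas p * T_c p * rhohat p Rhat a = capillary_pressure p (Rhat a).
Proof. rewrite rhohat_eq; pose proof (RT_pos p Hp) as H; rewrite <- Rmult_assoc, Rinv_r; lra. Qed.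

Lemma rhohat_pos a : 0 < rhohat p Rhat a.
Proof.
rewrite rhohat_eq; pose proof (RT_pos p Hp); pose proof (HRpos a).
pose proof (bar_pos p (Rhat a)).
destruct Hp as ((_ & _ & _ & _ & _ & _ & Hs & Hsb) & _).
apply Rmult_lt_0_compat; [now apply Rinv_0_lt_compat|].
unfold capillary_pressure; apply Rplus_lt_0_compat; apply Rdiv_lt_0_compat; lra.
Qed.

Lemma rhohat_0 : rhohat p Rhat 0 = rho_dag p.
Proof.
pose proof (RT_pos p Hp) as HRT.
destruct Hp as (_ & _ & (_ & Hd & _ & E)).
rewrite rhohat_eq, HR0; unfold capillary_pressure; rewrite E.
pose proof (bar_pos p (R_dag p)); set (RT := R_gas p * T_c p) in *; field; lra.
Qed.

Definition rhohat_slope (a : R) : R :=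
  / (R_gas p * T_c p) * (capillary_slope p (Rhat a) * Derive Rhat a).

Lemma rhohat_derive a : is_derive (rhohat p Rhat) a (rhohat_slope a).
Proof.
apply is_derive_ext with (fun a => / (R_gas p * T_c p) * capillary_pressure p (Rhat a)).
{ intros s; symmetry; apply rhohat_eq. }
apply is_derive_scal.
rewrite Rmult_comm.
apply (is_derive_comp (V := R_NormedModule) (capillary_pressure p) Rhat).
- apply capillary_derive; auto.
- apply Derive_correct, HRC1.
Qed.

Lemma vecU_two n : (2 <= n)%nat -> vecU p n = 0.
Proof. intros Hn; destruct n as [|[|n]]; [lia|lia|reflexivity]. Qed.

Lemma vscal_vecU_two a n : (2 <= n)%nat -> vscal a (vecU p) n = 0.
Proof. intros Hn; unfold vscal; rewrite vecU_two by exact Hn; ring. Qed.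

Lemma hcurve_two x n : (2 <= n)%nat -> h x n = 0.
Proof. intros Hn; destruct n as [|[|n]]; [lia|lia|reflexivity]. Qed.

Lemma in_X_eq x : in_X p x -> x = vscal (x 1%nat) (vecU p).
Proof.
intros (a & ->).
assert (E : vscal a (vecU p) 1%nat = a) by (unfold vscal; simpl; ring).
now rewrite E.
Qed.

Lemma hcurve_coef : 2 * Defs.sigma p / (R_gas p * T_c p * R_dag p ^ 2)
  + 2 * sigma_bar p * R_dag p ^ 2 / (R_gas p * T_c p * bar p (R_dag p) ^ 4)
  = coefA p / (R_gas p * T_c p).
Proof.
pose proof (RT_pos p Hp); pose proof (R_dag_pos p Hp); pose proof (bar_pos p (R_dag p)).
set (RT := R_gas p * T_c p) in *; unfold coefA; field; lra.
Qed.

(** The linear terms of [h] cancel [a U], so the graph of [h] consists of uniform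
    states whose gas pressure balances the capillary pressure. *)
Lemma curve_point a : vadd (vscal a (vecU p)) (h (vscal a (vecU p)))
  = uniform_state p (rhohat p Rhat a) (Rhat a).
Proof.
pose proof (RT_pos p Hp).
apply functional_extensionality; intros n; unfold vadd, h, hcurve, uniform_state.
unfold vscal at 2 3 4; simpl vecU; cbv beta; rewrite !Rmult_1_r.
destruct n as [|[|n]].
- rewrite hcurve_coef; unfold vscal, vecU.
  set (RT := R_gas p * T_c p) in *; field; lra.
- unfold vscal; simpl; ring.
- rewrite vscal_vecU_two by lia; ring.
Qed.

Lemma curve_point_in_X x : in_X p x ->
  vadd x (h x) = uniform_state p (rhohat p Rhat (x 1%nat)) (Rhat (x 1%nat)).
Proof. intros Hx; rewrite (in_X_eq x Hx) at 1 2; apply curve_point. Qed.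

Section UniformState.

Context (rs Rs : R) (Hrs : 0 < rs) (HRs : 0 < Rs)
  (Hbal : R_gas p * T_c p * rs = capillary_pressure p Rs).

Let z := uniform_state p rs Rs.

Lemma rho1_uniform : rho1 z = fun _ => 0.
Proof.
apply functional_extensionality; intros y; unfold rho1; apply Series_zero.
intros n; unfold theta; simpl; ring.
Qed.

Lemma Derive_zero y : Derive (fun _ : R => 0) y = 0.
Proof. apply Derive_const. Qed.

(** At a uniform state the profile vanishes, and the derivative [w] enters only
    through [Phi] once the interface does not accelerate. *)
Lemma nonlin_uniform w : w 2%nat = 0 -> nonlin p z w = fun n => match n with
  | 0%nat => 3 * gamma p * rho_dag p / R_dag p * Phi p z w
  | 1%nat => 0
  | 2%nat => nonlin p z vzero 2%nat
  | S (S k) => - xi p k * (3 * gamma p * rho_dag p / R_dag p) * Phi p z w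
  end.
Proof.
intros Hw.
assert (HPi : forall y, Pi_fun p z w y = 0).
{ intros y; unfold Pi_fun, radial_laplacian; rewrite rho1_uniform.
  change (Derive_n (fun _ : R => 0) 2 y) with (Derive (Derive (fun _ : R => 0)) y).
  rewrite (Derive_ext (Derive (fun _ : R => 0)) (fun _ => 0)) by apply Derive_zero.
  rewrite Derive_zero; unfold Rdiv; ring. }
apply functional_extensionality; intros [|[|[|n]]].
- reflexivity.
- reflexivity.
- unfold nonlin, Psi; rewrite Hw; reflexivity.
- unfold nonlin; replace (Pi_coef p z w (S n)) with 0; [ring|].
  unfold Pi_coef; rewrite (RInt_ext01 _ (fun _ => 0)).
  + rewrite (RInt_const (V := R_CompleteNormedModule)).
    unfold scal; simpl; unfold mult; simpl; ring.
  + intros y _; rewrite HPi; ring.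
Qed.

Lemma Phi_uniform w : Phi p z w = w 0%nat *
  (- (Rs - R_dag p) / (3 * gamma p * rs)
   + R_dag p / (3 * gamma p) * ((rs - rho_dag p) / (rho_dag p * rs))).
Proof.
pose proof (gamma_gt_1 p Hp); pose proof (rho_dag_pos p Hp).
unfold Phi; rewrite rho1_uniform, Derive_zero; unfold z, uniform_state.
replace (rho_dag p + (rs - rho_dag p)) with rs by ring.
set (k := kappa p / (gamma p * c_v p)).
match goal with |- - k * ?q * 0 - _ + _ = _ => set (q0 := q) end.
field; lra.
Qed.

Lemma opL_uniform n : opL p z n = match n with
  | 2%nat => 1 / (rho_l p * R_tilde p)
             * (R_gas p * T_c p * (rs - rho_dag p) + coefA p * (Rs - R_dag p))
  | _ => 0
  end.
Proof.
assert (Hl : lin_row1 p z = 0).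
{ unfold lin_row1; rewrite Series_zero; [unfold z; simpl; ring|].
  intros k; unfold theta; simpl; ring. }
destruct n as [|[|[|n]]]; unfold opL; rewrite ?Hl.
- reflexivity.
- reflexivity.
- unfold z, uniform_state; ring.
- unfold theta; simpl; ring.
Qed.

Lemma uniform_equilibrium : vadd (opL p z) (nonlin p z vzero) = vzero.
Proof.
apply functional_extensionality; intros n; unfold vadd.
rewrite opL_uniform, nonlin_uniform by reflexivity.
rewrite !Phi_uniform; change (vzero 0%nat) with 0.
destruct n as [|[|[|n]]]; try (unfold vzero; ring).
pose proof (R_tilde_pos p Hp) as Ht; pose proof (RT_pos p Hp) as HRT.
pose proof (proj1 (proj1 Hp)) as Hl.
assert (Erho : R_gas p * T_c p * rho_dag p = capillary_pressure p (R_dag p)).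
{ rewrite <- rhohat_0, <- HR0; apply rhohat_balance. }
unfold vzero, nonlin.
assert (EPsi : R_gas p * T_c p * Psi p z (fun _ => 0) = coefA p * (Rs - R_dag p)
   + capillary_pressure p Rs - capillary_pressure p (R_dag p)).
{ unfold Psi, z, uniform_state, coefA, capillary_pressure, radius.
  replace (R_dag p + (Rs - R_dag p)) with Rs by ring.
  pose proof (R_dag_pos p Hp).
  pose proof (bar_pos p (R_dag p)); pose proof (bar_pos p Rs).
  set (k1 := 1 / (Rs * _) - _); set (k2 := 3 / 2 - _ + _).
  set (RT := R_gas p * T_c p) in *; field; lra. }
transitivity (1 / (rho_l p * R_tilde p)
  * (R_gas p * T_c p * (rs - rho_dag p) + coefA p * (Rs - R_dag p)
     - R_gas p * T_c p * Psi p z (fun _ => 0))); [field; lra|].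
rewrite EPsi.
replace (R_gas p * T_c p * (rs - rho_dag p))
  with (capillary_pressure p Rs - capillary_pressure p (R_dag p))
  by (rewrite <- Hbal, <- Erho; ring).
ring.
Qed.

Lemma uniform_admissible : admissible p z.
Proof.
split; [|split; [|split]].
- split; [apply l2_two, uniform_state_two|split].
  + exists 0; apply is_series_zero; intros n; unfold theta; simpl; ring.
  + apply (l2_shift_iff 3), l2_two; intros n _; unfold shift; now rewrite opL_uniform.
- rewrite rho1_uniform; exists (fun _ => 0); repeat split; auto.
  + intros y; apply ex_derive_const.
  + intros y; apply ex_derive_ext with (fun _ : R => 0).
    * intros s; symmetry; apply Derive_zero.
    * apply ex_derive_const.
  + intros y; apply continuous_ext with (fun _ : R => 0); [|apply continuous_const].
    intros s; symmetry; change (Derive (Derive (fun _ : R => 0)) s = 0).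
    rewrite (Derive_ext (Derive (fun _ : R => 0)) (fun _ => 0)); apply Derive_zero.
- unfold z, radius, uniform_state; lra.
- intros y _; unfold rho_pert; rewrite rho1_uniform; unfold z, uniform_state; lra.
Qed.

(** The left eigenvector has third entry zero. *)
Lemma Q1_third_row u : (forall n, n <> 2%nat -> u n = 0) -> Q1 p u = vzero.
Proof.
intros Hu; apply functional_extensionality; intros n; unfold Q1, vscal, pairing.
rewrite Series_zero; [unfold vzero; ring|].
intros k; destruct (Nat.eq_dec k 2) as [->|Hk]; [|rewrite Hu by exact Hk; ring].
unfold Upsilon0, vscal; simpl; ring.
Qed.

Lemma Q1_nonlin_uniform : Q1 p (nonlin p z vzero) = vzero.
Proof.
apply Q1_third_row; intros n Hn.
rewrite nonlin_uniform by reflexivity; rewrite !Phi_uniform; change (vzero 0%nat) with 0.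
destruct n as [|[|[|n]]]; [ring|reflexivity|congruence|ring].
Qed.

End UniformState.

(** [U] spans the kernel of the linear operator. *)
Lemma opL_vadd_X x y : in_X p x -> opL p (vadd x y) = opL p y.
Proof.
intros Hx; pose proof (RT_pos p Hp).
assert (Hth : forall n, theta (vadd x y) (S n) = theta y (S n)).
{ intros n; unfold theta, vadd; rewrite (in_X_eq x Hx), vscal_vecU_two by lia; ring. }
assert (H2 : vadd x y 2%nat = y 2%nat).
{ unfold vadd; rewrite (in_X_eq x Hx), vscal_vecU_two by lia; ring. }
assert (Hl : lin_row1 p (vadd x y) = lin_row1 p y).
{ unfold lin_row1; rewrite H2; f_equal; f_equal; apply Series_ext.
  intros n; now rewrite Hth. }
apply functional_extensionality; intros [|[|[|n]]]; unfold opL; rewrite ?Hl, ?H2, ?Hth; auto.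
rewrite (in_X_eq x Hx); unfold vadd, vscal; simpl; field.
pose proof (R_tilde_pos p Hp); pose proof (proj1 (proj1 Hp)); repeat split; try lra.
- intros E; rewrite E in H; lra.
- intros E; rewrite E in H; lra.
Qed.

Lemma vsub_self_norm u : l2norm (vsub u u) = 0.
Proof.
unfold l2norm; rewrite Series_zero; [apply sqrt_0|].
intros n; unfold vsub; ring.
Qed.

Lemma right_continuous_const u t : right_lim (fun _ => l2norm (vsub u u)) t 0.
Proof. rewrite vsub_self_norm; apply right_lim_const. Qed.

Lemma curve_stationary x0 : in_X p x0 ->
  is_solution p p_infty (fun _ => x0) (fun _ => h x0).
Proof.
intros Hx; split; [|split; [|split]].
- intros t _ _; split; [exact Hx|apply l2_two, hcurve_two].
- apply right_continuous_const.
- apply right_continuous_const.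
- intros t _ _; exists vzero, vzero.
  set (a := x0 1%nat).
  assert (Ez : vadd x0 (h x0) = uniform_state p (rhohat p Rhat a) (Rhat a))
    by now apply curve_point_in_X.
  assert (E0 : vadd vzero vzero = vzero)
    by (apply functional_extensionality; intros n; unfold vadd, vzero; ring).
  pose proof (Q1_nonlin_uniform (rhohat p Rhat a) (Rhat a) (rhohat_pos a)) as EQ.
  split; [|split; [|split; [|split]]].
  + apply is_l2_derive_const; intros n Hn; rewrite (in_X_eq x0 Hx); now apply vscal_vecU_two.
  + apply is_l2_derive_const, hcurve_two.
  + rewrite Ez; apply uniform_admissible; auto using rhohat_pos.
  + rewrite E0, Ez; now rewrite EQ.
  + rewrite E0; unfold Q2; rewrite Ez, EQ, <- (opL_vadd_X x0 (h x0) Hx), Ez.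
    rewrite <- (uniform_equilibrium (rhohat p Rhat a) (Rhat a)) at 1
      by auto using rhohat_pos, rhohat_balance.
    apply functional_extensionality; intros n; unfold vadd, vsub, vzero; ring.
Qed.

(** The sum [x + y] solves the full system, so it stays at the equilibrium from
    which it starts; then [x] has zero derivative and both components are constant. *)
Lemma curve_invariant T x y : Rbar_lt 0 T -> is_solution p T x y -> y 0 = h (x 0) ->
  forall t, 0 <= t -> Rbar_lt t T -> y t = h (x t).
Proof.
intros HT (Hsp & Hcx & Hcy & Hsol) H0 t Ht HtT.
set (a := x 0 1%nat).
set (zs := uniform_state p (rhohat p Rhat a) (Rhat a)).
set (z := fun s => vadd (x s) (y s)).
assert (Hz0 : z 0 = zs).
{ unfold z; rewrite H0; apply curve_point_in_X, Hsp; [lra|exact HT]. }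
assert (Hl2x : forall s, 0 <= s -> Rbar_lt s T -> l2 (x s)).
{ intros s H1 H2; rewrite (in_X_eq (x s)) by now apply Hsp.
  apply l2_two; intros n; apply vscal_vecU_two. }
assert (Hl2y : forall s, 0 <= s -> Rbar_lt s T -> l2 (y s)) by (intros; now apply Hsp).
destruct (Rbar_lt_between 0 T HT) as (t1 & Ht1 & Ht1T).
assert (Hlim : right_lim (fun s => l2norm (vsub (z s) zs)) 0 0).
{ apply right_lim_eps; intros eps Heps.
  destruct (proj1 (right_lim_eps _ _ _) (right_lim_plus _ _ _ _ _ Hcx Hcy) eps Heps)
    as (d & Hd & Hs).
  exists (Rmin d t1); split; [now apply Rmin_pos|]; intros s Hts.
  pose proof (Rmin_l d t1); pose proof (Rmin_r d t1).
  assert (HsT : Rbar_lt s T) by (apply Ht1T; lra).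
  specialize (Hs s ltac:(lra)); apply Rabs_def2 in Hs.
  rewrite Rminus_0_r, Rabs_pos_eq by apply l2norm_nonneg.
  rewrite <- Hz0; unfold z.
  replace (vsub (vadd (x s) (y s)) (vadd (x 0) (y 0)))
    with (vadd (vsub (x s) (x 0)) (vsub (y s) (y 0)))
    by (apply functional_extensionality; intros n; unfold vadd, vsub; ring).
  eapply Rle_lt_trans; [apply l2norm_triangle|lra];
    apply l2_sub; auto; try apply Hl2x; try apply Hl2y; auto; lra. }
assert (Hode : forall t, 0 < t -> Rbar_lt t T -> exists w, is_l2_derive z t w /\
  admissible p (z t) /\ w = vadd (opL p (z t)) (nonlin p (z t) w)).
{ intros s Hs HsT; destruct (Hsol s Hs HsT) as (x' & y' & Dx & Dy & Hadm & Ex & Ey).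
  exists (vadd x' y'); split; [now apply is_l2_derive_add|split; [exact Hadm|]].
  unfold z; rewrite opL_vadd_X by (apply Hsp; [lra|exact HsT]).
  set (N := nonlin p (vadd (x s) (y s)) (vadd x' y')) in *.
  apply functional_extensionality; intros n.
  pose proof (f_equal (fun u : state => u n) Ex) as Exn.
  pose proof (f_equal (fun u : state => u n) Ey) as Eyn.
  cbv beta in Exn, Eyn; unfold Q2, vadd, vsub in Eyn; unfold vadd.
  rewrite Exn, Eyn; ring. }
assert (Hzs : forall s, 0 <= s -> Rbar_lt s T -> z s = zs).
{ exact (equilibrium_uniqueness p Hp (rhohat p Rhat a) (Rhat a) (rhohat_pos a)
    (HRpos a) (rhohat_balance a) T z Hode Hz0 Hlim). }
(* Along the constant state [zs] the equation of [x] reads x' = 0. *)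
assert (Dx0 : forall s n, 0 < s -> Rbar_lt s T -> is_derive (fun u => x u n) s 0).
{ intros s n Hs HsT; destruct (Hsol s Hs HsT) as (x' & y' & Dx & Dy & Hadm & Ex & Ey).
  pose proof (is_l2_derive_add _ _ _ _ _ Dx Dy) as Dz.
  assert (Ew : vadd x' y' = vzero).
  { apply functional_extensionality; intros k.
    rewrite <- (is_derive_unique _ _ _ (is_derive_entry _ _ _ k Dz)).
    rewrite (Derive_ext_loc _ (fun _ => zs k)); [apply Derive_const|].
    apply (locally_interval _ s 0 T); auto.
    intros u H1 H2; change (z u k = zs k); rewrite Hzs; auto; now apply Rlt_le. }
  assert (Ex0 : x' = vzero).
  { rewrite Ex, Ew; fold (z s); rewrite Hzs by (auto; lra).
    apply Q1_nonlin_uniform, rhohat_pos. }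
  rewrite Ex0 in Dx; exact (is_derive_entry _ _ _ n Dx). }
assert (Hxt : x t = x 0).
{ destruct (Rle_lt_or_eq_dec _ _ Ht) as [Hpos|<-]; [|reflexivity].
  destruct (Rbar_lt_between t T HtT) as (t2 & Ht2 & Ht2T).
  apply functional_extensionality; intros n.
  apply (zero_derive_constant (fun s => x s n) 0 t2); [| |lra].
  - apply right_lim_entry; [apply Hl2x; [lra|exact HT]| |exact Hcx].
    exists t1; split; [exact Ht1|]; intros s Hs; apply Hl2x; [lra|apply Ht1T; lra].
  - intros s Hs; apply Dx0; [lra|apply Ht2T; lra]. }
rewrite Hxt, <- H0.
assert (E : z t = z 0) by now rewrite Hz0, Hzs.
apply functional_extensionality; intros n.
pose proof (f_equal (fun u : state => u n) E) as En; unfold z, vadd in En.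
rewrite Hxt in En; lra.
Qed.

(** Serves both the tangency at the origin and the term [h'(x) x'] of the reduced
    equation. *)
Lemma hcurve_derive x c n : is_derive (fun s => h (vadd x (vscal s (vscal c (vecU p)))) n) 0
  (match n with
   | 0%nat => c * (rhohat_slope (x 1%nat) + coefA p / (R_gas p * T_c p))
   | 1%nat => c * (Derive Rhat (x 1%nat) - 1)
   | _ => 0
   end).
Proof.
set (al := x 1%nat).
assert (Hline : is_derive (fun s : R => al + s * c) 0 c).
{ auto_derive; auto; ring. }
assert (E : forall s, vadd x (vscal s (vscal c (vecU p))) 1%nat = al + s * c).
{ intros s; unfold vadd, vscal; simpl; fold al; ring. }
destruct n as [|[|n]]; unfold h, hcurve.
- apply is_derive_ext with (fun s => (fun u => rhohat p Rhat u
    + coefA p / (R_gas p * T_c p) * u - rho_dag p) (al + s * c)).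
  { intros s; now rewrite E, hcurve_coef. }
  apply (is_derive_comp (V := R_NormedModule)
    (fun u => rhohat p Rhat u + coefA p / (R_gas p * T_c p) * u - rho_dag p)
    (fun s => al + s * c)); [|exact Hline].
  replace (al + 0 * c) with al by ring.
  auto_derive; [eexists; apply rhohat_derive|].
  replace (Derive (fun u : R => rhohat p Rhat u) al) with (rhohat_slope al)
    by (symmetry; apply is_derive_unique, rhohat_derive).
  ring.
- apply is_derive_ext with (fun s => (fun u => Rhat u - u - R_dag p) (al + s * c)).
  { intros s; now rewrite E. }
  apply (is_derive_comp (V := R_NormedModule) (fun u => Rhat u - u - R_dag p)
    (fun s => al + s * c)); [|exact Hline].
  replace (al + 0 * c) with al by ring.
  auto_derive; [apply HRC1|].
  change (Derive (fun u : R => Rhat u) al) with (Derive Rhat al); ring.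
- apply (is_derive_const (K := R_AbsRing) (V := R_NormedModule)).
Qed.

Lemma curve_tangent : Derive Rhat 0 <> 1 -> tangent_to_X p h.
Proof.
intros HR1; pose proof (RT_pos p Hp) as HRT; split.
- apply functional_extensionality; intros n; unfold h, hcurve; change (vzero 1%nat) with 0.
  destruct n as [|[|n]]; [rewrite rhohat_0; unfold vzero; ring|rewrite HR0; unfold vzero; ring|
    reflexivity].
- exists (vscal (Derive Rhat 0 - 1) (vecU p)); split; [|split].
  + assert (Hline : forall s, h (vscal s (vecU p))
      = h (vadd vzero (vscal s (vscal 1 (vecU p))))).
    { intros s; f_equal; apply functional_extensionality; intros n.
      unfold vadd, vscal, vzero; ring. }
    apply is_l2_derive_two.
    * intros s n; apply hcurve_two.
    * intros n; apply vscal_vecU_two.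
    * apply is_derive_ext with (fun s => h (vadd vzero (vscal s (vscal 1 (vecU p)))) 0%nat).
      { intros s; now rewrite Hline. }
      replace (vscal (Derive Rhat 0 - 1) (vecU p) 0%nat)
        with (1 * (rhohat_slope 0 + coefA p / (R_gas p * T_c p)));
        [apply (hcurve_derive vzero 1 0)|].
      unfold rhohat_slope, vscal; simpl; rewrite HR0, (coefA_slope p); field; split.
      -- intros E; rewrite E in HRT; lra.
      -- intros E; rewrite E in HRT; lra.
    * apply is_derive_ext with (fun s => h (vadd vzero (vscal s (vscal 1 (vecU p)))) 1%nat).
      { intros s; now rewrite Hline. }
      replace (vscal (Derive Rhat 0 - 1) (vecU p) 1%nat)
        with (1 * (Derive Rhat 0 - 1)) by (unfold vscal; simpl; ring).
      apply (hcurve_derive vzero 1 1).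
  + eexists; reflexivity.
  + intros E; apply HR1.
    pose proof (f_equal (fun u : state => u 1%nat) E) as E1.
    unfold vscal, vzero in E1; simpl in E1; lra.
Qed.

(** * The reduced equation *)

(** At a uniform state, and without acceleration of the interface, [nonlin1] is [Phi]
    times this vector. *)
Definition flux_direction : state := fun n =>
  match n with
  | 0%nat => 3 * gamma p * rho_dag p / R_dag p
  | 1%nat | 2%nat => 0
  | S (S k) => - xi p k * (3 * gamma p * rho_dag p / R_dag p)
  end.

(** For the velocity [c] of the coordinate along [U] the reduced equation reads
    [c = reduced_factor al * c]. *)
Definition reduced_factor (al : R) : R :=
  pairing (Upsilon0 p) flux_direction
  * ((- (Rhat al - R_dag p) / (3 * gamma p * rhohat p Rhat al)
      + R_dag p / (3 * gamma p)
        * ((rhohat p Rhat al - rho_dag p) / (rho_dag p * rhohat p Rhat al)))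
     * rhohat_slope al).

Lemma reduced_velocity x t : in_X p (x t) -> manifold_equation p h x t ->
  exists c, is_derive (fun s => x s 1%nat) t c /\ c = reduced_factor (x t 1%nat) * c.
Proof.
intros Hx (x' & dh & Dx & Dh & Ex).
set (al := x t 1%nat).
set (rs := rhohat p Rhat al); set (Rs := Rhat al).
pose proof (rhohat_pos al) as Hrs; fold rs in Hrs.
assert (Ez : vadd (x t) (h (x t)) = uniform_state p rs Rs) by now apply curve_point_in_X.
rewrite Ez in Ex; set (z := uniform_state p rs Rs) in *.
assert (EQ0 : Q1 p (nonlin0 p z) = vzero) by exact (Q1_nonlin_uniform rs Rs Hrs).
rewrite EQ0 in Ex.
set (c := x' 1%nat).
assert (Ex' : x' = vscal c (vecU p)).
{ apply functional_extensionality; intros n; unfold c.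
  pose proof (f_equal (fun u : state => u n) Ex) as E1.
  pose proof (f_equal (fun u : state => u 1%nat) Ex) as E2.
  cbv beta in E1, E2; unfold Q1, vadd, vzero in E1, E2.
  unfold vscal at 1; rewrite E1, E2; unfold vscal; simpl; ring. }
exists c; split; [exact (is_derive_entry _ _ _ 1 Dx)|].
assert (Ec : x' 1%nat = c) by reflexivity; clearbody c.
set (w := vadd x' dh) in *.
assert (Edh : forall n d, is_derive (fun s => h (vadd (x t) (vscal s x')) n) 0 d -> dh n = d).
{ intros n d Hd; rewrite <- (is_derive_unique _ _ _ Hd).
  symmetry; exact (is_derive_unique _ _ _ (is_derive_entry _ _ _ n Dh)). }
assert (Ew2 : w 2%nat = 0).
{ unfold w, vadd; rewrite (Edh 2%nat 0).
  - rewrite Ex', vscal_vecU_two by lia; ring.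
  - rewrite Ex'; apply (hcurve_derive (x t) c 2). }
assert (Ew0 : w 0%nat = c * rhohat_slope al).
{ unfold w, vadd; rewrite (Edh 0%nat (c * (rhohat_slope al + coefA p / (R_gas p * T_c p)))).
  - rewrite Ex'; unfold vscal; simpl; unfold Rdiv; ring.
  - rewrite Ex'; apply (hcurve_derive (x t) c 0). }
assert (EN : nonlin1 p z w = vscal (Phi p z w) flux_direction).
{ apply functional_extensionality; intros n; unfold nonlin1, vsub.
  unfold z; rewrite !nonlin_uniform by (exact Ew2 || reflexivity).
  rewrite (Phi_uniform rs Rs Hrs vzero); change (vzero 0%nat) with 0.
  unfold vscal, flux_direction; destruct n as [|[|[|n]]]; ring. }
pose proof (f_equal (fun u : state => u 1%nat) Ex) as E1; cbv beta in E1.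
rewrite Ec in E1; rewrite E1, EN at 1; unfold Q1, vadd, vzero.
unfold vscal at 1; rewrite pairing_scal; unfold z; rewrite Phi_uniform, Ew0 by exact Hrs.
unfold reduced_factor; fold rs Rs; simpl; ring.
Qed.

(** The factor is continuous and vanishes at 0, where the equilibrium on the curve is
    the reference one. *)
Lemma reduced_factor_small : exists eps, 0 < eps /\
  forall al, Rabs al < eps -> reduced_factor al < 1.
Proof.
pose proof (gamma_gt_1 p Hp) as Hgam; pose proof (rho_dag_pos p Hp) as Hrd.
assert (Hr0 : 0 < rhohat p Rhat 0) by apply rhohat_pos.
assert (CR : continuous Rhat 0).
{ destruct (HRC1 0) as [D _]; exact (ex_derive_continuous Rhat 0 D). }
assert (Crho : continuous (rhohat p Rhat) 0).
{ exact (continuous_of_derive _ _ _ (rhohat_derive 0)). }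
assert (Cslope : continuous rhohat_slope 0).
{ unfold rhohat_slope.
  apply (continuous_mult (K := R_AbsRing)); [apply continuous_const|].
  apply (continuous_mult (K := R_AbsRing)); [|apply HRC1].
  apply (continuous_comp Rhat (capillary_slope p)); [exact CR|].
  pose proof (HRpos 0) as HR00; pose proof (bar_pos p (Rhat 0)).
  unfold capillary_slope; continuous_by_derive; repeat split; auto.
  - nra.
  - eexists; now apply bar_derive.
  - apply Rgt_not_eq; repeat apply Rmult_lt_0_compat; lra. }
assert (Cinv : continuous (fun al => / rhohat p Rhat al) 0).
{ apply (continuous_comp (rhohat p Rhat) Rinv); [exact Crho|].
  continuous_by_derive; lra. }
assert (Cf : continuous reduced_factor 0).
{ apply continuous_ext with (fun al => pairing (Upsilon0 p) flux_direction
    * ((-1 * (Rhat al - R_dag p) * (/ (3 * gamma p) * / rhohat p Rhat al)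
        + R_dag p / (3 * gamma p)
          * ((rhohat p Rhat al - rho_dag p) * (/ rho_dag p * / rhohat p Rhat al)))
       * rhohat_slope al)).
  { intros al; unfold reduced_factor; pose proof (rhohat_pos al).
    real_eq; field; lra. }
  assert (Cm : forall f g : R -> R, continuous f 0 -> continuous g 0 ->
    continuous (fun s => f s * g s) 0).
  { intros f g Hf Hg; now apply (continuous_mult (K := R_AbsRing)). }
  assert (Cs : forall (f : R -> R) k, continuous f 0 -> continuous (fun s => f s - k) 0).
  { intros f k Hf; apply (continuous_minus (V := R_NormedModule)); [exact Hf|].
    apply continuous_const. }
  assert (Cc : forall k : R, continuous (fun _ : R => k) 0) by (intros; apply continuous_const).
  assert (Cp : forall f g : R -> R, continuous f 0 -> continuous g 0 ->
    continuous (fun s => f s + g s) 0).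
  { intros f g Hf Hg; now apply (continuous_plus (V := R_NormedModule)). }
  assert (Cq : forall k, continuous (fun al => k * / rhohat p Rhat al) 0).
  { intros k; now apply (Cm (fun _ => k)). }
  apply (Cm (fun _ => pairing (Upsilon0 p) flux_direction)); [apply Cc|].
  apply (Cm (fun al => _ + _)); [|exact Cslope].
  apply (Cp (fun al => _ * _)).
  - apply (Cm (fun al => -1 * _)); [|apply Cq].
    apply (Cm (fun _ => -1)); [apply Cc|now apply Cs].
  - apply (Cm (fun _ => R_dag p / (3 * gamma p))); [apply Cc|].
    apply (Cm (fun al => rhohat p Rhat al - rho_dag p)); [now apply Cs|apply Cq]. }
destruct (locally_bounded _ _ Cf) as (eta & Heta & B).
exists eta; split; [exact Heta|]; intros al Hal.
assert (E0 : reduced_factor 0 = 0).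
{ unfold reduced_factor; rewrite HR0, rhohat_0; unfold Rdiv; ring. }
specialize (B al ltac:(now rewrite Rminus_0_r)).
rewrite E0, Rminus_0_r in B; apply Rabs_def2 in B; lra.
Qed.

Lemma reduced_trivial : exists eps, 0 < eps /\ forall x t, in_X p (x t) ->
  Rabs (x t 1%nat) < eps -> manifold_equation p h x t ->
  is_derive (fun s => x s 1%nat) t 0.
Proof.
destruct reduced_factor_small as (eps & Heps & Hsmall).
exists eps; split; [exact Heps|]; intros x t Hx Hal Heq.
destruct (reduced_velocity x t Hx Heq) as (c & Hc & Ec).
specialize (Hsmall _ Hal).
assert (c = 0); [|subst c; exact Hc].
apply Rmult_eq_reg_l with (1 - reduced_factor (x t 1%nat)); lra.
Qed.

Lemma reduced_stationary (alpha : R -> R) t : is_derive alpha t 0 ->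
  manifold_equation p h (fun s => vscal (alpha s) (vecU p)) t.
Proof.
intros Ha; exists vzero, vzero.
assert (D : forall n, is_derive (fun s => vscal (alpha s) (vecU p) n) t 0).
{ intros n; apply is_derive_ext with (fun s => vecU p n * alpha s).
  - intros s; unfold vscal; real_eq; ring.
  - replace 0 with (vecU p n * 0) by ring; now apply is_derive_scal. }
split; [|split].
- apply is_l2_derive_two; auto using vscal_vecU_two; apply D.
- set (x := vscal (alpha t) (vecU p)).
  assert (Dh : forall n, is_derive (fun s => h (vadd x (vscal s vzero)) n) 0 0).
  { intros n; apply is_derive_ext with (fun _ => h x n).
    - intros s; do 2 f_equal; apply functional_extensionality; intros k.
      unfold vadd, vscal, vzero; ring.
    - apply (is_derive_const (K := R_AbsRing) (V := R_NormedModule)). }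
  apply is_l2_derive_two; auto using hcurve_two; apply Dh.
- rewrite curve_point; set (al := alpha t).
  unfold nonlin0; rewrite Q1_nonlin_uniform by apply rhohat_pos.
  replace (vadd vzero vzero) with vzero
    by (apply functional_extensionality; intros n; unfold vadd, vzero; ring).
  rewrite Q1_third_row.
  + apply functional_extensionality; intros n; unfold vadd, vzero; ring.
  + intros n _; unfold nonlin1, vsub; ring.
Qed.

Lemma reduced_equivalence : exists eps : R, 0 < eps /\
  forall (T : Rbar) (alpha : R -> R),
    (forall t, 0 < t -> Rbar_lt t T -> Rabs (alpha t) < eps) ->
    ((forall t, 0 < t -> Rbar_lt t T ->
        manifold_equation p h (fun s => vscal (alpha s) (vecU p)) t)
     <-> (forall t, 0 < t -> Rbar_lt t T -> is_derive alpha t 0)).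
Proof.
destruct reduced_trivial as (eps & Heps & Htriv).
exists eps; split; [exact Heps|]; intros T alpha Hal; split; intros H t Ht HtT.
- assert (E : forall s, alpha s = vscal (alpha s) (vecU p) 1%nat).
  { intros s; unfold vscal; simpl; ring. }
  apply is_derive_ext with (fun s => vscal (alpha s) (vecU p) 1%nat).
  { intros s; symmetry; apply E. }
  apply (Htriv (fun s => vscal (alpha s) (vecU p)) t);
    [eexists; reflexivity| |now apply H].
  rewrite <- E; now apply Hal.
- now apply reduced_stationary, H.
Qed.

(** The coordinate is constant as long as it stays below the threshold of
    [reduced_trivial]; being constant it never reaches the threshold. *)
Lemma reduced_stable : zero_lyapunov_stable p h.
Proof.
split.
- assert (E : vscal 0 (vecU p) = vzero)
    by (apply functional_extensionality; intros n; unfold vscal, vzero; ring).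
  split; [|split].
  + intros t _ _; exists 0; now symmetry.
  + apply right_continuous_const.
  + intros t _ _.
    replace (fun _ : R => vzero) with (fun s : R => vscal ((fun _ => 0) s) (vecU p))
      by (apply functional_extensionality; intros s; exact E).
    apply reduced_stationary, (is_derive_const (K := R_AbsRing) (V := R_NormedModule)).
- intros eps Heps; destruct reduced_trivial as (e0 & He0 & Htriv).
  exists (Rmin eps e0); split; [now apply Rmin_pos|].
  intros T x HT (HX & Hc & Heq) Hx0 t Ht HtT.
  pose proof (Rmin_l eps e0); pose proof (Rmin_r eps e0).
  assert (Hl2 : forall s, 0 <= s -> Rbar_lt s T -> l2 (x s)).
  { intros s H1 H2; rewrite (in_X_eq (x s)) by now apply HX.
    apply l2_two; intros n; apply vscal_vecU_two. }
  assert (Hsmall : Rabs (x 0 1%nat) < e0).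
  { eapply Rle_lt_trans; [apply l2norm_entry, Hl2; [lra|exact HT]|lra]. }
  assert (Hconst : forall s, 0 <= s -> Rbar_lt s T -> x s 1%nat = x 0 1%nat).
  { apply (real_induction (fun s => x s 1%nat = x 0 1%nat)); [reflexivity| |].
    - intros s Hs HsT Es.
      destruct (Rbar_lt_between s T HsT) as (s1 & Hs1 & Hs1T).
      assert (Hlim : right_lim (fun u => x u 1%nat) s (x s 1%nat)).
      { apply right_lim_entry; [now apply Hl2| |].
        - exists (s1 - s); split; [lra|]; intros u Hu; apply Hl2; [lra|apply Hs1T; lra].
        - destruct (Rle_lt_or_eq_dec _ _ Hs) as [Hpos|<-]; [|exact Hc].
          destruct (Heq s Hpos HsT) as (x' & dh & Dx & _).
          exact (is_l2_derive_right_continuous _ _ _ Dx). }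
      assert (Hgap : 0 < e0 - Rabs (x 0 1%nat)) by lra.
      destruct (proj1 (right_lim_eps _ _ _) Hlim _ Hgap) as (d & Hd & Hu).
      exists (Rmin d (s1 - s)); split; [apply Rmin_pos; lra|]; intros u Hsu HuT.
      pose proof (Rmin_l d (s1 - s)); pose proof (Rmin_r d (s1 - s)).
      rewrite <- Es.
      apply (zero_derive_constant (fun r => x r 1%nat) s (s + Rmin d (s1 - s)));
        [exact Hlim| |exact Hsu].
      intros r Hr; specialize (Hu r ltac:(lra)); rewrite Es in Hu.
      assert (HrT : Rbar_lt r T) by (apply Hs1T; lra).
      apply (Htriv x r); [apply HX; [lra|exact HrT]| |apply Heq; [lra|exact HrT]].
      replace (x r 1%nat) with ((x r 1%nat - x 0 1%nat) + x 0 1%nat) by ring.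
      pose proof (Rabs_triang (x r 1%nat - x 0 1%nat) (x 0 1%nat)); lra.
    - intros s Hs HsT Hbefore; destruct (Heq s Hs HsT) as (x' & dh & Dx & _).
      apply (derive_limit_constant (fun u => x u 1%nat) s (x' 1%nat)); auto.
      now apply is_derive_entry. }
  rewrite (in_X_eq (x t)), Hconst by auto.
  rewrite <- (in_X_eq (x 0)) by (apply HX; [lra|exact HT]); lra.
Qed.

End Curve.

Theorem proposition4p4 (p : params) (Rhat : R -> R)
  (hconst : positive_constants p) (hM : 0 < mass p) (hV : 0 < vol p)
  (hdag : is_equilibrium p)
  (hRpos : forall a, 0 < Rhat a)
  (hRC1 : forall a, ex_derive Rhat a /\ continuous (Derive Rhat) a)
  (hR0 : Rhat 0 = R_dag p) (hR1 : Derive Rhat 0 <> 1) :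
  rhohat p Rhat 0 = rho_dag p /\
  global_center_manifold p (hcurve p Rhat) /\
  (exists eps : R, 0 < eps /\
    forall (T : Rbar) (alpha : R -> R),
      Rbar_lt 0 T ->
      (forall t, 0 < t -> Rbar_lt t T -> Rabs (alpha t) < eps) ->
      ((forall t, 0 < t -> Rbar_lt t T ->
          manifold_equation p (hcurve p Rhat)
            (fun s => vscal (alpha s) (vecU p)) t)
       <-> (forall t, 0 < t -> Rbar_lt t T -> is_derive alpha t 0))) /\
  zero_lyapunov_stable p (hcurve p Rhat).
Proof.
assert (Hp : well_posed p) by (split; [|split]; assumption).
split; [now apply rhohat_0|split; [|split]].
- split; [|split; [split|]].
  + intros x _; apply l2_two, hcurve_two.
  + intros x0 Hx0; exists (fun _ => x0), (fun _ => hcurve p Rhat x0).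
    split; [now apply curve_stationary|split; reflexivity].
  + intros T x y; now apply curve_invariant.
  + now apply curve_tangent.
- destruct (reduced_equivalence p Hp Rhat hRpos hRC1 hR0) as (eps & Heps & H).
  exists eps; split; [exact Heps|]; intros T alpha _ Hal; now apply H.
- now apply reduced_stable.
Qed.
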